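(* Let $\nu\in\mathbb R$, $A_2=\begin{pmatrix}0&\nu\\0&0\end{pmatrix}$, $J_2=\mathrm{diag}(1,0)$, $J_3=\mathrm{diag}(2,1,0)$ and $W(x)=e^{-x^2}e^{A_2x^2}e^{A_2^{T}x^2}$, $x\in\mathbb R$. Put $\delta_m^2:=1+\frac{m(m-1)}{4}\nu^2$. The Hermite-type Christoffel–Darboux kernel $K_n(x,y)$ associated with $W$ can be written as $$K_n(x,y)=\frac{2}{(2\pi i)^2}e^{(x^2-y^2)/2}\int_{\mathcal I}dw\oint_\gamma dz\;z^{2J_2}B_nz^{-J_3}w^{J_3}\hat B_nw^{-2J_2}\,\frac{e^{w^2-2xw-z^2+2zy+n\log(w/z)}}{w-z},$$ where $$B_n=\begin{pmatrix}\dfrac1{\delta_{n+1}^2}&\dfrac{n\nu^2}{2\delta_{n+1}^2\delta_n^2}&-\nu\\[2mm] \dfrac{\nu n(n+1)}{4\delta_{n+1}^2}&-\dfrac{n\nu}{2\delta_{n+1}^2\delta_n^2}&1\end{pmatrix},\qquad \hat B_n=\begin{pmatrix}1&\nu\\ 1&\nu\\ -\dfrac{\nu n(n-1)}{4\delta_n^2}&\dfrac1{\delta_n^2}\end{pmatrix}.$$ Moreover $\hat B_n$ is a right inverse of $B_n$, i.e. $B_n\hat B_n=I_2$.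
   Context: $T$ denotes the transpose. The matrix-valued inner product is $\langle F,G\rangle_W=\int_{\mathbb{R}}F(x)W(x)G^{T}(x)\,dx$. Let $(P_k)_{k\in\mathbb N}$ be a sequence of orthonormal matrix polynomials for $W$: $\deg P_k=k$, $\langle P_k,P_m\rangle_W=\delta_{km}I_2$. The Hermite-type Christoffel–Darboux kernel is $K_n(x,y):=\sum_{k=0}^{n-1}\Phi_k^{T}(y)\Phi_k(x)$ with $\Phi_k(x):=e^{-x^2/2}P_k(x)e^{A_2x^2}$ (it does not depend on the choice of orthonormal sequence). For a matrix $M$, $z^{M}:=e^{M\log z}$ with branch cut of $\log$ on the negative real axis; since $n$ is an integer, $e^{n\log(w/z)}=(w/z)^n$. The contour $\gamma$ comes from $-\infty$ below the negative real axis, goes counterclockwise around the origin, and returns to $-\infty$ above the negative real axis; $\mathcal I=L+i\mathbb R$ (oriented upwards), with $L>0$ such that $\gamma$ lies to the left of $\mathcal I$ and does not intersect it. *)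

(* Defs.v *)
(* MathComp-Analysis; complex numbers are R[i] from mathcomp-real-closed. *)
From mathcomp Require Import all_boot all_order all_algebra.
From mathcomp Require Import all_classical all_reals all_analysis.
From mathcomp Require Import complex.

Set Implicit Arguments.
Unset Strict Implicit.
Unset Printing Implicit Defensive.

Import Order.TTheory GRing.Theory Num.Theory.
Import numFieldNormedType.Exports.

Local Open Scope classical_set_scope.
Local Open Scope ring_scope.
Local Open Scope complex_scope.

Section Elementary.
Variable R : realType.
Implicit Types (z : R[i]) (t : R).

(* Limits in R[i], taken on real and imaginary parts; this is convergence for
   the modulus. *)
Definition clim (T : Type) (F : set_system T) (f : T -> R[i]) : R[i] :=
  lim (complex.Re (f t) @[t --> F]) +i* lim (complex.Im (f t) @[t --> F]).

Definition has_clim (T : Type) (F : set_system T) (f : T -> R[i]) :=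
  cvg (complex.Re (f t) @[t --> F]) /\ cvg (complex.Im (f t) @[t --> F]).

Definition exp_partial (K : fieldType) (d : nat) (A : 'M[K]_d.+1) (N : nat)
    : 'M[K]_d.+1 :=
  \sum_(k < N) (k`!%:R)^-1 *: A ^+ k.

Definition expmx (d : nat) (A : 'M[R]_d.+1) : 'M[R]_d.+1 :=
  \matrix_(i, j) limn (fun N : nat => exp_partial A N i j).

Definition cexpmx (d : nat) (A : 'M[R[i]]_d.+1) : 'M[R[i]]_d.+1 :=
  \matrix_(i, j) clim \oo (fun N : nat => exp_partial A N i j).

Definition cmod z : R := Num.sqrt (complex.Re z ^+ 2 + complex.Im z ^+ 2).

Definition cexp z : R[i] :=
  (expR (complex.Re z))%:C * (cos (complex.Im z) +i* sin (complex.Im z)).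

(* Principal argument, in ]-pi, pi]. *)
Definition carg z : R :=
  if 0 <= complex.Im z then acos (complex.Re z / cmod z)
  else - acos (complex.Re z / cmod z).

Definition clog z : R[i] := ln (cmod z) +i* carg z.

Definition cpowmx (d : nat) z (M : 'M[R[i]]_d.+1) : 'M[R[i]]_d.+1 :=
  cexpmx (clog z *: M).

Definition mx_toC (m n : nat) (A : 'M[R]_(m, n)) : 'M[R[i]]_(m, n) :=
  map_mx (fun a : R => a%:C) A.

End Elementary.

Section Contours.
Variable R : realType.
Implicit Types g : R -> R[i].

Definition path_deriv g (t : R) : R[i] :=
  derive1 (fun s => complex.Re (g s)) t +i* derive1 (fun s => complex.Im (g s)) t.

(* The velocity is allowed to vanish, so that every piecewise C^1 contour has
   a parametrization of this kind. *)
Definition C1_path g :=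
  [/\ (forall t : R, derivable (fun s => complex.Re (g s)) t 1),
      (forall t : R, derivable (fun s => complex.Im (g s)) t 1),
      continuous (derive1 (fun s => complex.Re (g s)))
    & continuous (derive1 (fun s => complex.Im (g s)))].

(* Integral of a matrix-valued function, entrywise, over the piece of the
   path with parameter in [a, b]. *)
Definition path_integral (m n : nat) g (F : R[i] -> 'M[R[i]]_(m, n)) (a b : R)
    : 'M[R[i]]_(m, n) :=
  \matrix_(i, j)
    ((\int[lebesgue_measure]_(t in `[a, b])
        complex.Re (F (g t) i j * path_deriv g t)) +i*
     (\int[lebesgue_measure]_(t in `[a, b])
        complex.Im (F (g t) i j * path_deriv g t))).

(* Integrals over infinite contours are improper: the two ends of the
   parameter interval go to -oo and +oo independently. *)
Definition contour_integrable (m n : nat) g (F : R[i] -> 'M[R[i]]_(m, n)) :=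
  forall i j, has_clim (filter_prod (ninfty_nbhs R) (pinfty_nbhs R))
    (fun p : R * R => path_integral g F p.1 p.2 i j).

Definition contour_integral (m n : nat) g (F : R[i] -> 'M[R[i]]_(m, n))
    : 'M[R[i]]_(m, n) :=
  \matrix_(i, j) clim (filter_prod (ninfty_nbhs R) (pinfty_nbhs R))
    (fun p : R * R => path_integral g F p.1 p.2 i j).

(* The contour goes from -oo to -oo inside the plane cut along ]-oo, 0]; it is
   tangent at infinity to the lower side of the cut at its start and to the
   upper side at its end.  Since the argument then runs from -pi to pi, the
   contour turns once, counterclockwise, around the origin. *)
Definition loop_around_cut g :=
  [/\ C1_path g,
      (forall t : R, ~ (complex.Im (g t) = 0 /\ complex.Re (g t) <= 0)),
      complex.Re (g t) @[t --> -oo] --> -oo /\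
      carg (g t) @[t --> -oo] --> - (pi : R)
    & complex.Re (g t) @[t --> +oo] --> -oo /\
      carg (g t) @[t --> +oo] --> (pi : R)].

Definition vertical_line (L : R) (t : R) : R[i] := L +i* t.

End Contours.

Section Kernel.
Variable R : realType.
Implicit Types (nu x y : R) (n : nat).

Definition mx_inner (W F G : R -> 'M[R]_2) : 'M[R]_2 :=
  \matrix_(i, j) \int[lebesgue_measure]_(x in [set: R])
    (F x *m W x *m (G x)^T) i j.

Definition orthonormal_mxpoly (W : R -> 'M[R]_2) (P : nat -> {poly 'M[R]_2}) :=
  (forall k, size (P k) = k.+1) /\
  (forall k m, mx_inner W (fun x => (P k).[x%:M]) (fun x => (P m).[x%:M])
               = if k == m then 1%:M else 0).

Definition A2 nu : 'M[R]_2 := nu *: delta_mx 0 1.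

Definition hermite_weight nu x : 'M[R]_2 :=
  expR (- x ^+ 2) *:
    (expmx (x ^+ 2 *: A2 nu) *m expmx (x ^+ 2 *: (A2 nu)^T)).

Definition Phi nu (P : nat -> {poly 'M[R]_2}) (k : nat) x : 'M[R]_2 :=
  expR (- x ^+ 2 / 2) *: ((P k).[x%:M] *m expmx (x ^+ 2 *: A2 nu)).

Definition CD_kernel nu (P : nat -> {poly 'M[R]_2}) n x y : 'M[R]_2 :=
  \sum_(k < n) (Phi nu P k y)^T *m Phi nu P k x.

Definition J2 : 'M[R[i]]_2 := diag_mx (\row_j [:: 1; 0]`_j).

Definition J3 : 'M[R[i]]_3 := diag_mx (\row_j [:: 2; 1; 0]`_j).

Definition delta_sq nu (m : nat) : R := 1 + m%:R * (m%:R - 1) / 4 * nu ^+ 2.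

Definition mx_of_rows {p q : nat} (s : seq (seq R)) : 'M[R]_(p, q) :=
  \matrix_(i, j) (nth [::] s i)`_j.

Definition B nu n : 'M[R]_(2, 3) :=
  let a := delta_sq nu n.+1 in let b := delta_sq nu n in
  mx_of_rows
    [:: [:: 1 / a; n%:R * nu ^+ 2 / (2 * a * b); - nu];
        [:: nu * n%:R * (n%:R + 1) / (4 * a); - (n%:R * nu / (2 * a * b)); 1]
    ].

Definition Bhat nu n : 'M[R]_(3, 2) :=
  let b := delta_sq nu n in
  mx_of_rows
    [:: [:: 1; nu];
        [:: 1; nu];
        [:: - (nu * n%:R * (n%:R - 1) / (4 * b)); 1 / b]
    ].

Definition CD_integrand nu n x y (w z : R[i]) : 'M[R[i]]_2 :=
  (cexp (w ^+ 2 - 2 * x%:C * w - z ^+ 2 + 2 * z * y%:C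
         + n%:R * clog (w / z)) / (w - z)) *:
  (cpowmx z (2 *: J2) *m mx_toC (B nu n) *m cpowmx z (- J3)
   *m cpowmx w J3 *m mx_toC (Bhat nu n) *m cpowmx w (- (2 *: J2))).

End Kernel.

(* Main.v *)
(** Both contour integrals are evaluated in closed form. For w to the right of
gamma, the loop integrals of z^(2-k) e^(-z^2+2yz) / (w-z) reduce, through
z^(-m) / (w-z) = w^(-1) (z^(-m) + z^(1-m) / (w-z)) and integration by parts, to
three base cases: the integrals of e^(-z^2+2yz) and of e^(-z^2+2yz) / (w-z)
vanish, that of e^(-z^2+2yz) / z is 2 pi i. This gives Laurent polynomials in w
whose coefficients are the H_j(y) / j!. The relation B_n Bhat_n = 1 and two
boundary identities kill the negative powers of w, and the remaining integrals
of w^k e^(w^2-2xw) over the vertical line are i sqrt(pi) e^(-x^2) 2^(-k) H_k(x).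

On the other side K_n is the reproducing kernel of the space of row vectors
(p1, p2 + nu x^2 p1) with deg p1, deg p2 < n, so it can be computed from the
orthogonal basis (0, H_k), (H_k, 0) for k < n-2 and (H_k, nu H_(k+2) / 4) for
k = n-2, n-1; the squared norms of the last two vectors carry the factors
delta_n^2 and delta_(n+1)^2. *)

Require Import Defs.
From mathcomp Require Import all_boot all_order all_algebra.
From mathcomp Require Import all_classical all_reals all_analysis.
From mathcomp Require Import measurable_realfun complex ring lra zify.
Import Order.TTheory GRing.Theory Num.Theory.
Import numFieldNormedType.Exports.
Local Open Scope classical_set_scope.
Local Open Scope ring_scope.
Local Open Scope complex_scope.

Set Implicit Arguments.
Unset Strict Implicit.
Unset Printing Implicit Defensive.

Local Notation Re := complex.Re.
Local Notation Im := complex.Im.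
Local Notation normc := Normc.normc.

(** * Limits and derivatives of complex-valued functions *)

Section ComplexLimits.
Variable R : realType.
Implicit Types (T : Type) (l m z w : R[i]).

(** No residue calculus is invoked: each contour integral is read off a primitive along the path
    that has a limit at both ends. When the integrand is regular on the half-plane Re z < L,
    integration along segments from 0 gives the primitive, and Gaussian decay in the sector |Im z|
    <= -Re z / 2 forces it to the same limit at both ends of the loop, so the integral vanishes. The
    ends lie in this sector because the argument tends to -pi and to pi. The value 2 pi i comes from
    a logarithm that differs from a branch regular on Re z < 0 by -i pi at one end and by i pi at
    the other. On the kernel side, x^2 H_k and H_(k+2) / 4 have the same leading term. For k + 2 < n
    the second component nu x^2 H_k is removed by the vectors (0, H_m), m < n; for the last two k
    only nu H_(k+2) / 4 remains. Its squared norm is nu^2 (k+1)(k+2) / 4 times that of H_k, which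
    produces the factors delta. Orthonormality of the P_k is a Gram identity for a square
    coefficient matrix, and inverting it removes the P_k from the kernel. *)

Lemma cReM z w : Re (z * w) = Re z * Re w - Im z * Im w.
Proof. by case: z w => [a b] [c d]. Qed.

Lemma cImM z w : Im (z * w) = Re z * Im w + Im z * Re w.
Proof. by case: z w => [a b] [c d]. Qed.

Lemma cReD z w : Re (z + w) = Re z + Re w.
Proof. by case: z w => [a b] [c d]. Qed.

Lemma cImD z w : Im (z + w) = Im z + Im w.
Proof. by case: z w => [a b] [c d]. Qed.

Lemma cReN z : Re (- z) = - Re z. Proof. by case: z. Qed.
Lemma cImN z : Im (- z) = - Im z. Proof. by case: z. Qed.

Lemma cReB z w : Re (z - w) = Re z - Re w. Proof. by rewrite cReD cReN. Qed.
Lemma cImB z w : Im (z - w) = Im z - Im w. Proof. by rewrite cImD cImN. Qed.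

Lemma cReV z : Re z^-1 = Re z / (Re z ^+ 2 + Im z ^+ 2).
Proof. by case: z. Qed.

Lemma cImV z : Im z^-1 = - Im z / (Re z ^+ 2 + Im z ^+ 2).
Proof. by case: z => a b; rewrite mulNr. Qed.

Lemma complex_ext z w : Re z = Re w -> Im z = Im w -> z = w.
Proof. by case: z w => [a b] [c d] /= -> ->. Qed.

Lemma sqr_normc_gt0 z : z != 0 -> 0 < Re z ^+ 2 + Im z ^+ 2.
Proof.
case: z => a b; rewrite eq_complex /= negb_and => /orP[h|h].
  by rewrite ltr_wpDr ?sqr_ge0 // exprn_even_gt0.
by rewrite ltr_wpDl ?sqr_ge0 // exprn_even_gt0.
Qed.

Lemma normc_sqr z : normc z ^+ 2 = Re z ^+ 2 + Im z ^+ 2.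
Proof. by case: z => a b; rewrite sqr_sqrtr // addr_ge0 ?sqr_ge0. Qed.

Lemma normc_ge0 z : 0 <= normc z.
Proof. by case: z => a b; exact: sqrtr_ge0. Qed.

Lemma normRe_le z : `|Re z| <= normc z.
Proof.
rewrite -ler_sqr ?nnegrE ?normc_ge0 // normc_sqr real_normK ?num_real //.
by rewrite lerDl sqr_ge0.
Qed.

Lemma normIm_le z : `|Im z| <= normc z.
Proof.
rewrite -ler_sqr ?nnegrE ?normc_ge0 // normc_sqr real_normK ?num_real //.
by rewrite lerDr sqr_ge0.
Qed.

Lemma normc_le_ReIm z : normc z <= `|Re z| + `|Im z|.
Proof.
rewrite -ler_sqr ?nnegrE ?normc_ge0 ?addr_ge0 // normc_sqr sqrrD.
rewrite !real_normK ?num_real //.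
by rewrite -addrA lerD2l lerDr mulrn_wge0 // mulr_ge0.
Qed.

Lemma normc_exp z n : normc (z ^+ n) = normc z ^+ n.
Proof.
elim: n => [|n IH]; first by rewrite !expr0 Normc.normc1.
by rewrite !exprS Normc.normcM IH.
Qed.

(** Convergence together with its value: [clim] is only meaningful once existence is known, so
    limits are proved in this form and converted by [ccvg_has_clim]. *)
Definition ccvg T (F : set_system T) (f : T -> R[i]) l :=
  (Re (f t) @[t --> F] --> Re l) /\ (Im (f t) @[t --> F] --> Im l).

Lemma ccvg_has_clim T (F : set_system T) (FF : ProperFilter F)
    (f : T -> R[i]) l : ccvg F f l -> has_clim F f /\ clim F f = l.
Proof.
move=> [h1 h2]; split; first by split; apply/cvg_ex; eexists; eassumption.
by case: l h1 h2 => a b /= h1 h2; rewrite /clim (cvg_lim _ h1) // (cvg_lim _ h2).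
Qed.

Section ccvg_theory.
Variables (T : Type) (F : set_system T).
Hypothesis FF : Filter F.
Implicit Types f g : T -> R[i].

Lemma ccvg_eq f g l : f =1 g -> ccvg F g l -> ccvg F f l.
Proof. by move=> /funext ->. Qed.

Lemma ccvg_cst l : ccvg F (fun=> l) l.
Proof. by split; exact: cvg_cst. Qed.

Lemma ccvgD f g l m :
  ccvg F f l -> ccvg F g m -> ccvg F (fun t => f t + g t) (l + m).
Proof.
move=> [f1 f2] [g1 g2]; split.
  by rewrite (_ : (fun t => _) = (fun t => Re (f t) + Re (g t))) ?cReD;
    [exact: cvgD|apply/funext => t; rewrite cReD].
by rewrite (_ : (fun t => _) = (fun t => Im (f t) + Im (g t))) ?cImD;
    [exact: cvgD|apply/funext => t; rewrite cImD].
Qed.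

Lemma ccvgN f l : ccvg F f l -> ccvg F (fun t => - f t) (- l).
Proof.
move=> [f1 f2]; split.
  by rewrite (_ : (fun t => _) = (fun t => - Re (f t))) ?cReN;
    [exact: cvgN|apply/funext => t; rewrite cReN].
by rewrite (_ : (fun t => _) = (fun t => - Im (f t))) ?cImN;
    [exact: cvgN|apply/funext => t; rewrite cImN].
Qed.

Lemma ccvgB f g l m :
  ccvg F f l -> ccvg F g m -> ccvg F (fun t => f t - g t) (l - m).
Proof. by move=> hf hg; apply: ccvgD => //; apply: ccvgN. Qed.

Lemma ccvgM f g l m :
  ccvg F f l -> ccvg F g m -> ccvg F (fun t => f t * g t) (l * m).
Proof.
move=> [f1 f2] [g1 g2]; split.
  rewrite (_ : (fun t => _) =
      (fun t => Re (f t) * Re (g t) - Im (f t) * Im (g t))) ?cReM.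
    by apply: cvgB; exact: cvgM.
  by apply/funext => t; rewrite cReM.
rewrite (_ : (fun t => _) =
    (fun t => Re (f t) * Im (g t) + Im (f t) * Re (g t))) ?cImM.
  by apply: cvgD; exact: cvgM.
by apply/funext => t; rewrite cImM.
Qed.

Lemma ccvgX f l n : ccvg F f l -> ccvg F (fun t => f t ^+ n) (l ^+ n).
Proof.
move=> hf; elim: n => [|n IH]; first exact: ccvg_cst.
apply: (@ccvg_eq _ (fun t => f t * f t ^+ n)) => [t|]; first by rewrite exprS.
by rewrite exprS; exact: ccvgM.
Qed.

Lemma ccvgV f l : l != 0 -> ccvg F f l -> ccvg F (fun t => (f t)^-1) l^-1.
Proof.
move=> l0 [f1 f2]; have d0 := sqr_normc_gt0 l0.
have hd : Re (f t) ^+ 2 + Im (f t) ^+ 2 @[t --> F]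
    --> Re l ^+ 2 + Im l ^+ 2.
  rewrite !expr2.
  rewrite (_ : (fun t => _) = (fun t => Re (f t) * Re (f t)
    + Im (f t) * Im (f t))); last by apply/funext => t; rewrite !expr2.
  by apply: cvgD; exact: cvgM.
have hV : (Re (f t) ^+ 2 + Im (f t) ^+ 2)^-1 @[t --> F]
    --> (Re l ^+ 2 + Im l ^+ 2)^-1 by exact: cvgV (lt0r_neq0 d0) hd.
split.
  rewrite (_ : (fun t => _) = (fun t => Re (f t) *
    (Re (f t) ^+ 2 + Im (f t) ^+ 2)^-1)) ?cReV.
    exact: cvgM.
  by apply/funext => t; rewrite cReV.
rewrite (_ : (fun t => _) = (fun t => - Im (f t) *
    (Re (f t) ^+ 2 + Im (f t) ^+ 2)^-1)) ?cImV.
  by apply: cvgM => //; exact: cvgN.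
by apply/funext => t; rewrite cImV.
Qed.

Lemma ccvg_cexp f l : ccvg F f l -> ccvg F (fun t => cexp (f t)) (cexp l).
Proof.
move=> [f1 f2].
have e1 : expR (Re (f t)) @[t --> F] --> expR (Re l).
  by apply: (cvg_comp _ _ f1); exact: continuous_expR.
have c1 : cos (Im (f t)) @[t --> F] --> cos (Im l).
  by apply: (cvg_comp _ _ f2); exact: continuous_cos.
have s1 : sin (Im (f t)) @[t --> F] --> sin (Im l).
  by apply: (cvg_comp _ _ f2); exact: continuous_sin.
split; rewrite /cexp.
  rewrite (_ : (fun t => _) = (fun t => expR (Re (f t)) * cos (Im (f t)))).
    by rewrite cReM /= mul0r subr0; exact: cvgM.
  by apply/funext => t; rewrite cReM /= mul0r subr0.
rewrite (_ : (fun t => _) = (fun t => expR (Re (f t)) * sin (Im (f t)))).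
  by rewrite cImM /= mul0r addr0; exact: cvgM.
by apply/funext => t; rewrite cImM /= mul0r addr0.
Qed.

Lemma ccvg_bound0 f (b : T -> R) :
  (\forall t \near F, normc (f t) <= b t) -> b t @[t --> F] --> 0 ->
  ccvg F f 0.
Proof.
move=> fb b0; split; rewrite /=.
  apply: norm_cvg0; apply: (squeeze_cvgr _ (cvg_cst 0) b0).
  apply: filterS fb => t h; rewrite normr_ge0 /=.
  exact: le_trans (normRe_le _) h.
apply: norm_cvg0; apply: (squeeze_cvgr _ (cvg_cst 0) b0).
apply: filterS fb => t h; rewrite normr_ge0 /=.
exact: le_trans (normIm_le _) h.
Qed.

End ccvg_theory.

(** The source is an arbitrary topological space because differentiation under the integral sign
    uses joint continuity on R * R. *)
Definition ccont (T : topologicalType) (f : T -> R[i]) (t : T) :=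
  ccvg (nbhs t) f (f t).

Section ccont_theory.
Variable T : topologicalType.
Implicit Types (u v : T -> R[i]) (x : T).

Lemma ccont_cst l x : ccont (fun=> l) x.
Proof. exact: ccvg_cst. Qed.

Lemma ccontD u v x : ccont u x -> ccont v x -> ccont (fun y => u y + v y) x.
Proof. exact: ccvgD. Qed.

Lemma ccontN u x : ccont u x -> ccont (fun y => - u y) x.
Proof. exact: ccvgN. Qed.

Lemma ccontB u v x : ccont u x -> ccont v x -> ccont (fun y => u y - v y) x.
Proof. exact: ccvgB. Qed.

Lemma ccontM u v x : ccont u x -> ccont v x -> ccont (fun y => u y * v y) x.
Proof. exact: ccvgM. Qed.

Lemma ccontX u x n : ccont u x -> ccont (fun y => u y ^+ n) x.
Proof. exact: ccvgX. Qed.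

Lemma ccontV u x : u x != 0 -> ccont u x -> ccont (fun y => (u y)^-1) x.
Proof. exact: ccvgV. Qed.

Lemma ccont_cexp u x : ccont u x -> ccont (fun y => cexp (u y)) x.
Proof. exact: ccvg_cexp. Qed.

End ccont_theory.

(** Only functions of a real parameter are differentiated; complex differentiability enters later
    through composition with curves. *)
Definition is_cderive (f : R -> R[i]) (t : R) (d : R[i]) :=
  is_derive t 1 (fun s => Re (f s)) (Re d) /\
  is_derive t 1 (fun s => Im (f s)) (Im d).

Implicit Types (f g : R -> R[i]) (t : R).

Lemma is_cderive_eq f t d d' : is_cderive f t d -> d = d' -> is_cderive f t d'.
Proof. by move=> ? <-. Qed.

Lemma is_cderive_ext f g t d : f =1 g -> is_cderive g t d -> is_cderive f t d.
Proof. by move=> /funext ->. Qed.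

Lemma is_cderive_ccont f t d : is_cderive f t d -> ccont f t.
Proof.
move=> [[h1 _] [h2 _]].
by split; apply: differentiable_continuous; apply/derivable1_diffP.
Qed.

Lemma is_cderive_cst l t : is_cderive (fun=> l) t 0.
Proof. by split; exact: is_derive_cst. Qed.

Lemma is_cderiveD f g t d e : is_cderive f t d -> is_cderive g t e ->
  is_cderive (fun s => f s + g s) t (d + e).
Proof.
move=> [f1 f2] [g1 g2]; split.
  rewrite cReD (_ : (fun s => _) = (fun s => Re (f s)) \+ (fun s => Re (g s))).
    exact: is_deriveD.
  by apply/funext => s; rewrite cReD.
rewrite cImD (_ : (fun s => _) = (fun s => Im (f s)) \+ (fun s => Im (g s))).
  exact: is_deriveD.
by apply/funext => s; rewrite cImD.
Qed.

Lemma is_cderiveM f g t d e : is_cderive f t d -> is_cderive g t e ->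
  is_cderive (fun s => f s * g s) t (d * g t + f t * e).
Proof.
move=> [f1 f2] [g1 g2]; split.
  rewrite (_ : (fun s => _) = (fun s => Re (f s)) * (fun s => Re (g s)) -
     (fun s => Im (f s)) * (fun s => Im (g s))).
    apply: is_derive_eq; rewrite !cReD !cReM /GRing.scale /=; ring.
  by apply/funext => s; rewrite cReM.
rewrite (_ : (fun s => _) = (fun s => Re (f s)) * (fun s => Im (g s)) +
   (fun s => Im (f s)) * (fun s => Re (g s))).
  apply: is_derive_eq; rewrite !cImD !cImM /GRing.scale /=; ring.
by apply/funext => s; rewrite cImM.
Qed.

Lemma is_cderiveMl l f t d :
  is_cderive f t d -> is_cderive (fun s => l * f s) t (l * d).
Proof.
move=> hf; apply: is_cderive_eq (is_cderiveM (is_cderive_cst l t) hf) _.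
by rewrite mul0r add0r.
Qed.

Lemma is_cderiveN f t d : is_cderive f t d -> is_cderive (fun s => - f s) t (- d).
Proof.
move=> hf; apply: (@is_cderive_ext _ (fun s => (-1) * f s)).
  by move=> s; rewrite mulN1r.
by apply: is_cderive_eq (is_cderiveMl _ hf) _; rewrite mulN1r.
Qed.

Lemma is_cderiveB f g t d e : is_cderive f t d -> is_cderive g t e ->
  is_cderive (fun s => f s - g s) t (d - e).
Proof. by move=> hf hg; apply: is_cderiveD => //; exact: is_cderiveN. Qed.

Lemma is_cderiveV f t d : f t != 0 -> is_cderive f t d ->
  is_cderive (fun s => (f s)^-1) t (- d / f t ^+ 2).
Proof.
move=> f0 [f1 f2]; have n0 := lt0r_neq0 (sqr_normc_gt0 f0).
pose N := (fun s => Re (f s)) ^+ 2 + (fun s => Im (f s)) ^+ 2 : R -> R.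
have N0 : N t != 0 by [].
have dN : is_derive t 1 N (2 * (Re (f t) * Re d + Im (f t) * Im d)).
  apply: is_derive_eq; rewrite /GRing.scale /= expr1; ring.
have dV := is_deriveV N0 dN.
have e2 : Re (f t ^+ 2) = Re (f t) ^+ 2 - Im (f t) ^+ 2 /\
    Im (f t ^+ 2) = 2 * Re (f t) * Im (f t).
  by rewrite !expr2 cReM cImM; split=> //; ring.
have e4 : Re (f t ^+ 2) ^+ 2 + Im (f t ^+ 2) ^+ 2 =
    (Re (f t) ^+ 2 + Im (f t) ^+ 2) ^+ 2.
  by rewrite !e2.1 !e2.2; ring.
split.
  rewrite (_ : (fun s => _) = (fun s => Re (f s)) * (fun s => (N s)^-1)).
    apply: is_derive_eq; rewrite /GRing.scale /= /N.
    rewrite cReM cReV cImV !cReN !cImN e4 !e2.1 !e2.2 /N /=.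
    by rewrite !fctE; field; rewrite n0.
  by apply/funext => s; rewrite cReV.
rewrite (_ : (fun s => _) = (- (fun s => Im (f s))) * (fun s => (N s)^-1)).
  apply: is_derive_eq; rewrite /GRing.scale /= /N.
  rewrite cImM cReV cImV !cReN !cImN e4 !e2.1 !e2.2 /N /=.
  by rewrite !fctE; field; rewrite n0.
by apply/funext => s; rewrite cImV.
Qed.

Lemma is_cderiveX f t d n : is_cderive f t d ->
  is_cderive (fun s => f s ^+ n) t (n%:R * f t ^+ n.-1 * d).
Proof.
move=> hf; elim: n => [|n IH].
  by rewrite !mul0r; exact: is_cderive_cst.
apply: (@is_cderive_ext _ (fun s => f s * f s ^+ n)).
  by move=> s; rewrite exprS.
apply: is_cderive_eq (is_cderiveM hf IH) _.
case: n {IH} => [|n]; first by rewrite /= expr0 !mul0r mulr0 addr0 mulr1 !mul1r.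
by rewrite /= -!natr1 exprS; ring.
Qed.

Lemma is_cderive_cexp f t d : is_cderive f t d ->
  is_cderive (fun s => cexp (f s)) t (cexp (f t) * d).
Proof.
move=> [f1 f2].
have de : is_derive t 1 (fun s => expR (Re (f s))) (expR (Re (f t)) * Re d).
  exact: (is_derive1_comp (is_derive_expR (Re (f t))) f1).
have dc : is_derive t 1 (fun s => cos (Im (f s))) (- sin (Im (f t)) * Im d).
  exact: (is_derive1_comp (is_derive_cos (Im (f t))) f2).
have ds : is_derive t 1 (fun s => sin (Im (f s))) (cos (Im (f t)) * Im d).
  exact: (is_derive1_comp (is_derive_sin (Im (f t))) f2).
split.
  rewrite (_ : (fun s => _) = (fun s => expR (Re (f s))) *
      (fun s => cos (Im (f s)))).
    apply: is_derive_eq.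
    by rewrite /GRing.scale /= /cexp !(cReM, cImM) /=; ring.
  by apply/funext => s; rewrite /cexp cReM /= mul0r subr0.
rewrite (_ : (fun s => _) = (fun s => expR (Re (f s))) *
    (fun s => sin (Im (f s)))).
  apply: is_derive_eq.
  by rewrite /GRing.scale /= /cexp !(cReM, cImM) /=; ring.
by apply/funext => s; rewrite /cexp cImM /= mul0r addr0.
Qed.

Lemma is_cderive_ofreal (u : R -> R) t d :
  is_derive t 1 u d -> is_cderive (fun s => (u s)%:C) t d%:C.
Proof. by move=> hu; split => //=; exact: is_derive_cst. Qed.

Lemma is_cderive_id t : is_cderive (fun s => s%:C) t 1.
Proof. by apply: is_cderive_ofreal; exact: is_derive_id. Qed.

End ComplexLimits.

(** * Real and complex line integrals *)

Section RealIntegrals.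
Variable R : realType.
Local Notation mu := (@lebesgue_measure R).
Implicit Types (f F : R -> R) (a b : R).

Lemma continuous_at_integrable f a b :
  (forall x, x \in `[a, b] -> {for x, continuous f}) ->
  mu.-integrable `[a, b] (EFin \o f).
Proof.
move=> cf; apply: continuous_compact_integrable; first exact: segment_compact.
apply: continuous_in_subspaceT => x; rewrite inE /= => xab.
exact: cf.
Qed.

Lemma Rintegral_FTC2 f F a b : a < b ->
  (forall x, x \in `[a, b] -> {for x, continuous f}) ->
  (forall x, x \in `[a, b] -> is_derive x 1 F (f x)) ->
  \int[mu]_(x in `[a, b]) f x = F b - F a.
Proof.
move=> ab cf dF.
have cF x : x \in `[a, b] -> {for x, continuous F}.
  move=> /dF[h _]; apply: differentiable_continuous; exact/derivable1_diffP.
rewrite /Rintegral (@continuous_FTC2 _ f F) //.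
- apply: continuous_in_subspaceT => x; rewrite inE /= => xab; exact: cf.
- split.
  + by move=> x xab; have [] := dF x (subset_itv_oo_cc xab).
  + by apply: cvg_at_right_filter; apply: cF; rewrite in_itv /= lexx ltW.
  + by apply: cvg_at_left_filter; apply: cF; rewrite in_itv /= lexx ltW.
- move=> x xab; rewrite derive1E.
  by have [_ ->] := dF x (subset_itv_oo_cc xab).
Qed.

(** A comparison test stated on primitives: the domination makes G + U and U - G nondecreasing,
    boundedness of U makes G + U and U converge, and G is their difference. *)
Lemma derive_dominated_cvgy (G dG U dU : R -> R) (M : R) :
  (forall t : R, is_derive t 1 G (dG t)) ->
  (forall t : R, is_derive t 1 U (dU t)) ->
  (forall t, `|dG t| <= dU t) -> (forall t, `|U t| <= M) ->
  exists l : R, G t @[t --> +oo] --> l.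
Proof.
move=> hG hU hGU hM.
have mono (H dH : R -> R) : (forall t : R, is_derive t 1 H (dH t)) ->
    (forall t, 0 <= dH t) -> nondecreasing_fun H.
  move=> hH dH0 s t st; rewrite -subr_ge0.
  have [|c _ ->] := @MVT_segment R H dH s t st.
  - apply: continuous_subspaceT => x; apply: differentiable_continuous.
    by apply/derivable1_diffP; have [] := hH x.
  - by rewrite mulr_ge0 // subr_ge0.
have m1 : nondecreasing_fun (G \+ U).
  apply: (mono _ (fun t => dG t + dU t)) => t.
  have := hGU t; rewrite ler_norml => /andP[h _].
  by rewrite -lerBlDr sub0r.
have m2 : nondecreasing_fun (U \- G).
  apply: (mono _ (fun t => dU t - dG t)) => t.
  have := hGU t; rewrite ler_norml => /andP[_ h].
  by rewrite subr_ge0.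
have c1 : cvg ((G \+ U) t @[t --> +oo]).
  apply/cvg_ex; eexists; apply: nondecreasing_cvgr => //.
  (* A crude bound for both half-lines: for t >= 0 monotonicity of U - G gives (G + U)(t) <= 2 U(t)
     - (U - G)(0), for t < 0 monotonicity of G + U gives its value at 0. *)
  exists (`|U 0 - G 0| + 2 * M + G 0 + U 0 + 2 * M
     + `|G 0| + `|U 0|) => _ [t _ <-] /=.
  have := hM t; have := hM 0; rewrite !ler_norml => /andP[h1 h2] /andP[h3 h4].
  case: (lerP 0 t) => t0.
    have := m2 _ _ t0 => /= h5.
    have := normr_ge0 (G 0); have := normr_ge0 (U 0).
    have := normr_ge0 (U 0 - G 0); lra.
  have /= := m1 _ _ (ltW t0).
  have := normr_ge0 (G 0); have := normr_ge0 (U 0).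
  have := normr_ge0 (U 0 - G 0); lra.
have c2 : cvg (U t @[t --> +oo]).
  apply/cvg_ex; eexists; apply: nondecreasing_cvgr.
    apply: (mono _ dU) => // t.
    exact: le_trans (normr_ge0 _) (hGU t).
  by exists M => _ [t _ <-]; exact: le_trans (ler_norm _) (hM t).
exists (lim ((G \+ U) t @[t --> +oo]) - lim (U t @[t --> +oo])).
rewrite (_ : (fun t => G t) = (fun t => (G \+ U) t - U t)); last first.
  by apply/funext => t /=; rewrite addrK.
by apply: cvgB.
Qed.

(** Truncation to [-n, n] with |f| as dominating function reduces this to the compact case. *)
Lemma Rintegral_FTC2_setT f F (lp lm : R) :
  mu.-integrable setT (EFin \o f) -> continuous f ->
  (forall x : R, is_derive x 1 F (f x)) ->
  F x @[x --> +oo] --> lp -> F x @[x --> -oo] --> lm ->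
  \int[mu]_(x in setT) f x = lp - lm.
Proof.
move=> intf cf dF Fp Fm.
pose h n : R -> \bar R := fun x => (f x * \1_(`[- n%:R, n%:R] : set R) x)%:E.
have mf : measurable_fun [set: R] f by apply: continuous_measurable_fun.
have [|||||_ _ cvgh] := @dominated_convergence _ _ _ mu setT measurableT h
  (EFin \o f) (fun x => `|f x|%:E).
- move=> n; apply/measurable_EFinP; apply: measurable_funM => //.
- exact/measurable_EFinP.
- apply: aeW => x _; apply: cvg_near_cst; near=> n.
  rewrite /h indicE mem_set ?mulr1 //= in_itv /= -ler_norml.
  near: n; exact: nbhs_infty_ger.
- exact: (integrable_abse intf).
- apply: aeW => x n _; rewrite /h /= lee_fin normrM ler_piMr //.
  by rewrite indicE; case: (_ \in _); rewrite ?normr1 ?normr0.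
have /fine_cvg : (\int[mu]_(x in setT) h n x)%E @[n --> \oo] -->
    (fine (\int[mu]_(x in setT) (f x)%:E)%E)%:E.
  by rewrite fineK //; apply: integrable_fin_num.
rewrite /comp => hlim.
have /cvg_lim <- // : fine (\int[mu]_(x in setT) h n x)%E @[n --> \oo]
    --> lp - lm.
  have e : \forall n \near \oo, F (n%:R : R) - F (- n%:R) =
      fine (\int[mu]_(x in setT) h n x)%E.
    near=> n.
    have n0 : - n%:R < n%:R :> R.
      rewrite -subr_gt0 opprK -natrD ltr0n addn_gt0; apply/orP; left.
      by near: n; exact: nbhs_infty_gt.
    rewrite -(@Rintegral_FTC2 f) // => [|x _]; last exact: cf.
    rewrite Rintegral_mkcond /Rintegral; congr fine.
    by apply: eq_integral => x _; rewrite /h patchE indicE;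
      case: (x \in _); rewrite ?mulr1 ?mulr0.
  apply: cvg_trans; first by apply: near_eq_cvg; exact: e.
  apply: cvgB.
    by move/cvg_pinftyP : Fp; apply; exact: cvgr_idn.
  by move/cvg_ninftyP : Fm; apply; apply/cvgNrNy; exact: cvgr_idn.
by apply/esym; apply: cvg_lim.
Unshelve. all: by end_near. Qed.

(** The interval is open because the kernel (h (t z) - h 0) / t of [punctured_primitive] takes the
    default value 0 at t = 0, where the derivative formula would fail. *)
Lemma is_derive_Rintegral01 (k dk : R -> R -> R) (s e C : R) : 0 < e ->
  (forall r, `|r - s| < e -> forall t, 0 < t < 1 ->
     is_derive r 1 (fun x => k x t) (dk r t) /\ `|dk r t| <= C) ->
  (forall r, `|r - s| < e -> mu.-integrable `]0, 1[ (EFin \o k r)) ->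
  is_derive s 1 (fun r => \int[mu]_(t in `]0, 1[) k r t)
    (\int[mu]_(t in `]0, 1[) dk s t).
Proof.
move=> e0 hk ik.
have near_s r : r \in `]s - e, s + e[ -> `|r - s| < e.
  by rewrite in_itv /= ltr_distl.
have ss : s \in `]s - e, s + e[ by rewrite in_itv /= ltrBlDr !ltrDl e0.
have C0 : 0 <= C.
  have [|_] := hk s (near_s _ ss) (2^-1).
    by apply/andP; split; lra.
  exact: le_trans (normr_ge0 _).
have h1 r : `]s - e, s + e[%classic r -> mu.-integrable `]0, 1[ (EFin \o k r).
  by move=> /near_s /ik.
have h2 r t : `]s - e, s + e[%classic r -> `]0, 1[%classic t ->
    derivable (k ^~ t) r 1.
  move=> /near_s h /=; rewrite in_itv /= => t01.
  by have [[]] := hk _ h _ t01.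
have h3 : mu.-integrable `]0, 1[ (EFin \o (fun=> C)).
  have : mu.-integrable `[0, 1] (EFin \o (fun=> C)).
    by apply: continuous_at_integrable => x _; exact: cst_continuous.
  by apply: integrableS => //; exact: subset_itv_oo_cc.
have h4 r t : `]s - e, s + e[%classic r -> `]0, 1[%classic t ->
    `|partial1of2 k r t| <= C.
  move=> /near_s h /=; rewrite in_itv /= => t01.
  have [hd hb] := hk _ h _ t01.
  by rewrite partial1of2E; case: hd => _ ->.
have mI : measurable (`]0, 1[ : set R) by [].
split.
  exact: (@derivable_under_integral _ _ _ mu k `]0, 1[ mI s _ _ ss h1 h2
    (fun=> C) (fun=> C0) h3 h4).
rewrite -derive1E.
rewrite (@differentiation_under_integral _ _ _ mu k `]0, 1[ mI s _ _ ss h1 h2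
    (fun=> C) (fun=> C0) h3 h4).
apply: eq_Rintegral => t; rewrite inE /= in_itv /= => t01.
have [[_ hd] _] := hk s (near_s _ ss) _ t01.
by rewrite -hd partial1of2E.
Qed.

Lemma Rintegral_oo_cc f a b : mu.-integrable `[a, b] (EFin \o f) ->
  \int[mu]_(t in `]a, b[) f t = \int[mu]_(t in `[a, b]) f t.
Proof.
move=> fi; rewrite Rintegral_itv_bndo_bndc.
  rewrite Rintegral_itv_obnd_cbnd //.
  by apply: integrableS fi => // x /=; rewrite !in_itv /= => /andP[/ltW-> ->].
by apply: integrableS fi => //; exact: subset_itv_oo_cc.
Qed.

Lemma ccont_compact_bounded (T : topologicalType) (K : set T) (f : T -> R[i]) :
  compact K -> (forall t, K t -> ccont f t) ->
  exists C : R, forall t, K t -> normc (f t) <= C.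
Proof.
move=> cK cf.
have bd (u : T -> R^o) : (forall t, K t -> {for t, continuous u}) ->
    exists C : R, forall t, K t -> `|u t| <= C.
  move=> cu; have : {within K, continuous u}.
    by apply: continuous_in_subspaceT => t; rewrite inE => /cu.
  move=> /continuous_compact /(_ cK) /compact_bounded[M [_ hM]].
  by exists (M + 1) => t Kt; apply: (hM (M + 1)); rewrite ?ltrDl //; exists t.
have [C1 h1] := bd (fun t => Re (f t)) (fun t Kt => (cf t Kt).1).
have [C2 h2] := bd (fun t => Im (f t)) (fun t Kt => (cf t Kt).2).
exists (C1 + C2) => t Kt; apply: le_trans (normc_le_ReIm _) _.
by apply: lerD; [exact: h1|exact: h2].
Qed.

End RealIntegrals.

(** * Improper integrals and primitives along paths *)

Section PathCalculus.
Variable R : realType.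
Local Notation mu := (@lebesgue_measure R).
Implicit Types (phi Phi psi p dp : R -> R[i]) (F f h : R[i] -> R[i]).

Lemma near_eq_cvg_to (T : Type) (F : set_system T) (FF : Filter F)
    (f g : T -> R) (l : R) :
  (\forall t \near F, g t = f t) -> g t @[t --> F] --> l -> f t @[t --> F] --> l.
Proof. by move=> fg; apply: cvg_trans; exact: near_eq_cvg. Qed.

Lemma near_eq_ccvg (T : Type) (F : set_system T) (FF : Filter F)
    (f g : T -> R[i]) (l : R[i]) :
  (\forall t \near F, g t = f t) -> ccvg F g l -> ccvg F f l.
Proof.
by move=> fg [h1 h2]; split; [apply: near_eq_cvg_to h1|apply: near_eq_cvg_to h2];
  apply: filterS fg => t ->.
Qed.

Lemma ccont_comp (S T : topologicalType) (u : S -> R[i]) (v : T -> S) (x : T) :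
  ccont u (v x) -> {for x, continuous v} -> ccont (u \o v) x.
Proof.
by move=> [u1 u2] cv; split; [exact: (cvg_comp _ _ cv u1)|exact: (cvg_comp _ _ cv u2)].
Qed.

Lemma ccont_ofreal (T : topologicalType) (u : T -> R) (x : T) :
  {for x, continuous u} -> ccont (fun y => (u y)%:C) x.
Proof. by move=> cu; split => //=; exact: cvg_cst. Qed.

Lemma improper_FTC2 phi Phi (lp lm : R[i]) :
  (forall t, ccont phi t) -> (forall t, is_cderive Phi t (phi t)) ->
  ccvg +oo Phi lp -> ccvg -oo Phi lm ->
  ccvg (filter_prod (ninfty_nbhs R) (pinfty_nbhs R))
    (fun q => (\int[mu]_(t in `[q.1, q.2]) Re (phi t)) +i*
      (\int[mu]_(t in `[q.1, q.2]) Im (phi t))) (lp - lm).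
Proof.
move=> cphi dPhi hp hm.
have hlt : \forall q \near filter_prod (ninfty_nbhs R) (pinfty_nbhs R),
    q.1 < q.2.
  exists ([set x : R | x < 0], [set x : R | 0 < x]) => /=.
    by split; exists 0; split => //; exact: num_real.
  by move=> q /= [] ; exact: lt_trans.
have FF : Filter (filter_prod (ninfty_nbhs R) (pinfty_nbhs R)) by typeclasses eauto.
apply: (@near_eq_ccvg _ _ _ _ (fun q => Phi q.2 - Phi q.1)).
  apply: filterS hlt => q q12; apply: complex_ext; rewrite ?cReB ?cImB /=; apply/esym.
    exact: (@Rintegral_FTC2 _ (fun t => Re (phi t)) (fun t => Re (Phi t)) _ _ q12
      (fun x _ => (cphi x).1) (fun x _ => (dPhi x).1)).
  exact: (@Rintegral_FTC2 _ (fun t => Im (phi t)) (fun t => Im (Phi t)) _ _ q12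
    (fun x _ => (cphi x).2) (fun x _ => (dPhi x).2)).
apply: ccvgB.
  by case: hp => h1 h2; split; [apply: cvg_comp h1|apply: cvg_comp h2]; exact: cvg_snd.
by case: hm => h1 h2; split; [apply: cvg_comp h1|apply: cvg_comp h2]; exact: cvg_fst.
Qed.

(* Asking for a primitive with limits at both ends makes linearity immediate
   and, by the fundamental theorem, yields the two-ended improper integral. *)
Definition improper_integral phi (l : R[i]) :=
  exists Phi lp lm,
    [/\ forall t, ccont phi t, forall t, is_cderive Phi t (phi t),
        ccvg +oo Phi lp, ccvg -oo Phi lm & l = lp - lm].

Lemma improper_integral_ext phi psi l : phi =1 psi ->
  improper_integral psi l -> improper_integral phi l.
Proof. by move=> /funext ->. Qed.

Lemma improper_integral0 : improper_integral (fun=> 0) 0.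
Proof.
exists (fun=> 0), 0, 0; split; last by rewrite subr0.
- by move=> t; exact: ccvg_cst.
- by move=> t; exact: is_cderive_cst.
- exact: ccvg_cst.
- exact: ccvg_cst.
Qed.

Lemma improper_integralD phi psi l m :
  improper_integral phi l -> improper_integral psi m ->
  improper_integral (fun t => phi t + psi t) (l + m).
Proof.
move=> [F [a [b [h1 h2 h3 h4 ->]]]] [G [c [d [k1 k2 k3 k4 ->]]]].
exists (fun t => F t + G t), (a + c), (b + d); split.
- by move=> t; exact: ccontD.
- by move=> t; exact: is_cderiveD.
- exact: ccvgD.
- exact: ccvgD.
- by rewrite opprD addrACA.
Qed.

Lemma improper_integralMl c phi l : improper_integral phi l ->
  improper_integral (fun t => c * phi t) (c * l).
Proof.
move=> [F [a [b [h1 h2 h3 h4 ->]]]].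
exists (fun t => c * F t), (c * a), (c * b); split.
- by move=> t; apply: ccontM => //; exact: ccont_cst.
- by move=> t; exact: is_cderiveMl.
- by apply: ccvgM => //; exact: ccvg_cst.
- by apply: ccvgM => //; exact: ccvg_cst.
- by rewrite mulrBr.
Qed.

Lemma improper_integral_sum (I : Type) (r : seq I) (c : I -> R[i])
    (phi : I -> R -> R[i]) (l : I -> R[i]) :
  (forall i, improper_integral (phi i) (l i)) ->
  improper_integral (fun t => \sum_(i <- r) c i * phi i t)
    (\sum_(i <- r) c i * l i).
Proof.
move=> h; elim: r => [|i r IH].
  apply: (@improper_integral_ext _ (fun=> 0)); first by move=> t; rewrite big_nil.
  by rewrite big_nil; exact: improper_integral0.
apply: (@improper_integral_ext _
  (fun t => c i * phi i t + \sum_(i <- r) c i * phi i t)).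
  by move=> t; rewrite big_cons.
rewrite big_cons; apply: improper_integralD => //.
exact: improper_integralMl.
Qed.

(** Passage from primitives to the notions of the statement: existence and value of the two-ended
    limit come together. *)
Lemma contour_integralE (m n : nat) (g : R -> R[i])
    (F : R[i] -> 'M[R[i]]_(m, n)) (l : 'M[R[i]]_(m, n)) :
  (forall i j, improper_integral
     (fun t => F (g t) i j * path_deriv g t) (l i j)) ->
  contour_integrable g F /\ contour_integral g F = l.
Proof.
move=> h; have key i j : has_clim (filter_prod (ninfty_nbhs R) (pinfty_nbhs R))
      (fun q : R * R => path_integral g F q.1 q.2 i j) /\
    clim (filter_prod (ninfty_nbhs R) (pinfty_nbhs R))
      (fun q : R * R => path_integral g F q.1 q.2 i j) = l i j.
  apply: ccvg_has_clim.
  have [Phi [lp [lm [h1 h2 h3 h4 ->]]]] := h i j.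
  apply: ccvg_eq (improper_FTC2 h1 h2 h3 h4) => q.
  by rewrite mxE.
split; first by move=> i j; case: (key i j).
by apply/matrixP => i j; rewrite mxE; case: (key i j).
Qed.

Lemma derive_le (v dv u du : R -> R) a b : a <= b ->
  (forall t : R, t \in `[a, b] -> is_derive t 1 v (dv t)) ->
  (forall t : R, t \in `[a, b] -> is_derive t 1 u (du t)) ->
  (forall t, t \in `[a, b] -> `|dv t| <= du t) -> `|v b - v a| <= u b - u a.
Proof.
move=> ab hv hu bv.
have aux (w dw : R -> R) :
    (forall t : R, t \in `[a, b] -> is_derive t 1 w (dw t)) ->
    (forall t, t \in `[a, b] -> 0 <= dw t) -> w a <= w b.
  move=> hw dw0.
  have hw' x : x \in `]a, b[ -> is_derive x 1 w (dw x).
    by move=> /subset_itv_oo_cc; exact: hw.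
  have cw : {within `[a, b], continuous w}.
    apply: continuous_in_subspaceT => x; rewrite inE /= => /hw[hx _].
    by apply: differentiable_continuous; exact/derivable1_diffP.
  have [c cab e] := @MVT_segment R w dw a b ab hw' cw.
  by rewrite -subr_ge0 e mulr_ge0 ?dw0 ?subr_ge0.
have h1 := aux (u \- v) (fun t => du t - dv t)
  (fun t tab => is_deriveB (hu t tab) (hv t tab)).
have h2 := aux (u \+ v) (fun t => du t + dv t)
  (fun t tab => is_deriveD (hu t tab) (hv t tab)).
have {}h1 : u a - v a <= u b - v b.
  by apply: h1 => t tab; have := bv t tab; rewrite ler_norml => /andP[]; lra.
have {}h2 : u a + v a <= u b + v b.
  by apply: h2 => t tab; have := bv t tab; rewrite ler_norml => /andP[]; lra.
by rewrite ler_norml; apply/andP; split; lra.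
Qed.

(** The factor 2 is the price of applying the real mean value theorem to the real and imaginary
    parts separately. It is harmless, since only decay is extracted from this bound. *)
Lemma cderive_le phi Phi (u du : R -> R) a b : a <= b ->
  (forall t, t \in `[a, b] -> is_cderive Phi t (phi t)) ->
  (forall t : R, t \in `[a, b] -> is_derive t 1 u (du t)) ->
  (forall t, t \in `[a, b] -> normc (phi t) <= du t) ->
  normc (Phi b - Phi a) <= 2 * (u b - u a).
Proof.
move=> ab dP du' bP; apply: le_trans (normc_le_ReIm _) _.
rewrite mulr_natl mulr2n cReB cImB; apply: lerD.
  apply: (@derive_le (fun t => Re (Phi t)) (fun t => Re (phi t)) u du) => // t tab.
    by case: (dP t tab).
  by apply: le_trans (bP t tab); exact: normRe_le.
apply: (@derive_le (fun t => Im (Phi t)) (fun t => Im (phi t)) u du) => // t tab.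
  by case: (dP t tab).
by apply: le_trans (bP t tab); exact: normIm_le.
Qed.

Lemma cderive_bound phi Phi a b C : a <= b ->
  (forall t, t \in `[a, b] -> is_cderive Phi t (phi t)) ->
  (forall t, t \in `[a, b] -> normc (phi t) <= C) ->
  normc (Phi b - Phi a) <= 2 * C * (b - a).
Proof.
move=> ab dP bP; rewrite -mulrA mulrBr.
have du (t : R) : t \in `[a, b] -> is_derive t 1 (fun s : R => C * s) C.
  by move=> _; apply: is_derive_eq (is_deriveZ C (is_derive_id t (1 : R))) _;
    rewrite /GRing.scale /= mulr1.
exact: (@cderive_le phi Phi (fun s : R => C * s) (fun=> C)).
Qed.

Definition C1_pair p dp :=
  (forall t, is_cderive p t (dp t)) /\ (forall t, ccont dp t).

(* Primitives are tested along C^1 curves, the only way they are used. *)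
Definition primitive_on (D : set R[i]) F f :=
  forall p dp, C1_pair p dp -> (forall t, D (p t)) ->
  forall t, is_cderive (fun s => F (p s)) t (f (p t) * dp t).

Definition cint01 phi : R[i] :=
  (\int[mu]_(t in `]0, 1[) Re (phi t)) +i* (\int[mu]_(t in `]0, 1[) Im (phi t)).

Lemma is_cderive_cint01 (k dk : R -> R -> R[i]) (s e C : R) : 0 < e ->
  (forall r, `|r - s| < e -> forall t, 0 < t < 1 ->
     is_cderive (fun x => k x t) r (dk r t) /\ normc (dk r t) <= C) ->
  (forall r, `|r - s| < e -> mu.-integrable `]0, 1[ (EFin \o (fun t => Re (k r t)))
     /\ mu.-integrable `]0, 1[ (EFin \o (fun t => Im (k r t)))) ->
  is_cderive (fun r => cint01 (k r)) s (cint01 (dk s)).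
Proof.
move=> e0 hk ik; split=> /=.
  apply: (@is_derive_Rintegral01 _ (fun r t => Re (k r t))
    (fun r t => Re (dk r t)) s e C) => // [r re t t01|r re].
    have [[h _] b] := hk r re t t01; split=> //.
    exact: le_trans (normRe_le _) b.
  by case: (ik r re).
apply: (@is_derive_Rintegral01 _ (fun r t => Im (k r t))
  (fun r t => Im (dk r t)) s e C) => // [r re t t01|r re].
  have [[_ h] b] := hk r re t t01; split=> //.
  exact: le_trans (normIm_le _) b.
by case: (ik r re).
Qed.

Lemma cint01_FTC2 phi Phi :
  (forall t, t \in `[0, 1] -> ccont phi t) ->
  (forall t, t \in `[0, 1] -> is_cderive Phi t (phi t)) ->
  cint01 phi = Phi 1 - Phi 0.
Proof.
move=> cp dP; apply: complex_ext; rewrite /= ?cReB ?cImB.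
  rewrite Rintegral_oo_cc.
    exact: (@Rintegral_FTC2 _ (fun t => Re (phi t)) (fun t => Re (Phi t)) _ _
      ltr01 (fun x x01 => (cp x x01).1) (fun x x01 => (dP x x01).1)).
  by apply: continuous_at_integrable => x x01; case: (cp x x01).
rewrite Rintegral_oo_cc.
  exact: (@Rintegral_FTC2 _ (fun t => Im (phi t)) (fun t => Im (Phi t)) _ _
    ltr01 (fun x x01 => (cp x x01).2) (fun x x01 => (dP x x01).2)).
by apply: continuous_at_integrable => x x01; case: (cp x x01).
Qed.

(** Complex differentiability as a chain rule along curves; the Cauchy-Riemann equations are hidden
    in the complex product [df z * d]. *)
Definition cholo (f df : R[i] -> R[i]) (z : R[i]) :=
  forall (p : R -> R[i]) t d, p t = z -> is_cderive p t d ->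
    is_cderive (fun s => f (p s)) t (df z * d).

(** Continuity in compositional form, so that it applies equally to curves and to two-parameter
    families such as t z(r). *)
Definition ccont_at (f : R[i] -> R[i]) (z : R[i]) :=
  forall (T : topologicalType) (u : T -> R[i]) (x : T), u x = z ->
    ccont u x -> ccont (fun y => f (u y)) x.

Definition half_plane (L : R) : set R[i] := [set z | Re z < L].

Lemma half_plane_star (L : R) (z : R[i]) (t : R) : 0 < L -> Re z < L ->
  0 <= t <= 1 -> Re (t%:C * z) < L.
Proof.
move=> L0 zL /andP[t0 t1]; rewrite cReM /= mul0r subr0.
case: (lerP (Re z) 0) => z0.
  by apply: le_lt_trans L0; rewrite mulr_ge0_le0.
by apply: le_lt_trans zL; rewrite ler_piMl // ltW.
Qed.

Lemma ccont_integrable01 phi : (forall t, t \in `[0, 1] -> ccont phi t) ->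
  mu.-integrable `]0, 1[ (EFin \o (fun t => Re (phi t))) /\
  mu.-integrable `]0, 1[ (EFin \o (fun t => Im (phi t))).
Proof.
move=> cphi.
have aux (u : R -> R) : (forall t, t \in `[0, 1] -> {for t, continuous u}) ->
    mu.-integrable `]0, 1[ (EFin \o u).
  by move=> /continuous_at_integrable; apply: integrableS => //; exact: subset_itv_oo_cc.
by split; apply: aux => t /cphi[].
Qed.

(** For integrands that are bounded on the open interval but may jump at its endpoints. *)
Lemma ccont_bounded_integrable01 phi C : (forall t, 0 < t < 1 -> ccont phi t) ->
  (forall t, 0 < t < 1 -> normc (phi t) <= C) ->
  mu.-integrable `]0, 1[ (EFin \o (fun t => Re (phi t))) /\
  mu.-integrable `]0, 1[ (EFin \o (fun t => Im (phi t))).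
Proof.
move=> cphi bphi.
have aux (u : R -> R) : (forall t, 0 < t < 1 -> {for t, continuous u}) ->
    (forall t, 0 < t < 1 -> `|u t| <= C) -> mu.-integrable `]0, 1[ (EFin \o u).
  move=> cu bu; apply: measurable_bounded_integrable => //.
  - have h : (lebesgue_measure (`]0%R, 1%R[%classic : set R) < +oo)%E.
      by rewrite lebesgue_measure_itv /= lte_fin ltr01 -EFinB subr0 ltry.
    exact: h.
  - apply: open_continuous_measurable_fun; first exact: interval_open.
    by move=> t; rewrite inE /= in_itv /= => /cu.
  - exists C; split; first exact: num_real.
    move=> M CM t /=; rewrite in_itv /= => t01.
    by apply: le_trans (ltW CM); exact: bu.
split; apply: aux => t t01; try by case: (cphi t t01).
- exact: le_trans (normRe_le _) (bphi t t01).
- exact: le_trans (normIm_le _) (bphi t t01).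
Qed.

Lemma compact_rectangle (a b c d : R) :
  compact (`[a, b] `*` `[c, d] : set (R * R)).
Proof. by apply: compact_setX; exact: segment_compact. Qed.

(* The primitive is the integral of f along the segment from 0 to z. *)
Lemma half_plane_primitive (L : R) f df : 0 < L ->
  (forall z, Re z < L -> [/\ cholo f df z, ccont_at f z & ccont_at df z]) ->
  exists F, primitive_on (half_plane L) F f.
Proof.
move=> L0 hf.
exists (fun z => cint01 (fun t => f (t%:C * z) * z)) => p dp [hp hdp] pD s.
pose dk r t := df (t%:C * p r) * (t%:C * dp r) * p r + f (t%:C * p r) * dp r.
have inD r t : 0 <= t <= 1 -> Re (t%:C * p r) < L.
  by move=> t01; apply: half_plane_star => //; exact: pD.
have cp1 (x : R * R) : ccont (fun y : R * R => p y.1) x.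
  by apply: (@ccont_comp _ _ p fst); [exact: is_cderive_ccont (hp _)|exact: cvg_fst].
have cdp1 (x : R * R) : ccont (fun y : R * R => dp y.1) x.
  by apply: (@ccont_comp _ _ dp fst); [exact: hdp|exact: cvg_fst].
have ct1 (x : R * R) : ccont (fun y : R * R => y.2%:C) x.
  by apply: ccont_ofreal; exact: cvg_snd.
have cdk (x : R * R) : (`[s - 1, s + 1] `*` `[0, 1])%classic x ->
    ccont (fun y : R * R => dk y.1 y.2) x.
  move=> [_ /=]; rewrite in_itv /= => t01.
  have [_ h2 h3] := hf _ (inD x.1 x.2 t01).
  have ctp : ccont (fun y : R * R => y.2%:C * p y.1) x by exact: ccontM.
  apply: ccontD.
    apply: ccontM => //; apply: ccontM; last exact: ccontM.
    exact: (h3 _ (fun y : R * R => y.2%:C * p y.1)).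
  apply: ccontM => //.
  exact: (h2 _ (fun y : R * R => y.2%:C * p y.1)).
(* Compactness of the rectangle supplies the dominating constant; the radius 1 around s is
   arbitrary. *)
have [C hC] := ccont_compact_bounded (@compact_rectangle (s - 1) (s + 1) 0 1) cdk.
have dtp r t : is_cderive (fun x => t%:C * p x) r (t%:C * dp r).
  exact: is_cderiveMl.
have dts (z : R[i]) t : is_cderive (fun x => x%:C * z) t z.
  apply: is_cderive_eq (is_cderiveM (is_cderive_id t) (is_cderive_cst z t)) _.
  by rewrite mul1r mulr0 addr0.
(* The r-derivative of the kernel is also the t-derivative of t f (t p(s)) p'(s), so its integral
   over t is evaluated by its endpoints. *)
have -> : f (p s) * dp s = cint01 (dk s).
  rewrite (@cint01_FTC2 _ (fun t => t%:C * f (t%:C * p s) * dp s)).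
  - by rewrite !mul1r !mul0r subr0.
  - move=> t; rewrite in_itv /= => t01; have [h1 h2 h3] := hf _ (inD s t t01).
    have ctp : ccont (fun x : R => x%:C * p s) t by exact: is_cderive_ccont (dts _ _).
    have cid : ccont (fun x : R => x%:C) t by exact: is_cderive_ccont (is_cderive_id _).
    have cc (z : R[i]) : ccont (fun x : R => z) t by exact: ccvg_cst.
    apply: ccontD.
      apply: ccontM => //; apply: ccontM; last exact: ccontM.
      exact: (h3 _ (fun x : R => x%:C * p s)).
    apply: ccontM => //.
    exact: (h2 _ (fun x : R => x%:C * p s)).
  - move=> t; rewrite in_itv /= => t01; have [h1 h2 h3] := hf _ (inD s t t01).
    have d1 := h1 _ _ _ erefl (dts (p s) t).
    have d2 := is_cderiveM (is_cderive_id t) d1.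
    apply: is_cderive_eq (is_cderiveM d2 (is_cderive_cst (dp s) t)) _.
    by rewrite /dk; ring.
apply: (@is_cderive_cint01 (fun r t => f (t%:C * p r) * p r) dk s 1 C).
- exact: ltr01.
- move=> r rs t /andP[t0 t1].
  have t01 : 0 <= t <= 1 by rewrite !ltW.
  have [h1 h2 h3] := hf _ (inD r t t01).
  split.
    have d1 := h1 (fun x => t%:C * p x) r _ erefl (dtp r t).
    exact: is_cderiveM d1 (hp r).
  apply: (hC (r, t)); split => /=; rewrite in_itv //=.
  by move: rs; rewrite ltr_distl => /andP[/ltW -> /ltW ->].
- move=> r rs.
  have cr t : t \in `[0, 1] -> ccont (fun x : R => f (x%:C * p r) * p r) t.
    rewrite in_itv /= => t01; have [_ h2 _] := hf _ (inD r t t01).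
    apply: ccontM; last exact: ccvg_cst.
    by apply: (h2 _ (fun x : R => x%:C * p r)) => //; exact: is_cderive_ccont (dts _ _).
  exact: ccont_integrable01 cr.
Qed.

(* Integrating (h (t z) - h 0) / t over ]0, 1[ avoids dealing with the removable
   singularity of (h z - h 0) / z at 0. *)
Lemma punctured_primitive h dh : (forall z, [/\ cholo h dh z & ccont_at dh z]) ->
  exists F, primitive_on [set z | z != 0] F (fun z => (h z - h 0) / z).
Proof.
move=> hh.
exists (fun z => cint01 (fun t => (h (t%:C * z) - h 0) / t%:C)) => p dp [hp hdp] pD s.
pose dk r t := dh (t%:C * p r) * dp r.
have cp1 (x : R * R) : ccont (fun y : R * R => p y.1) x.
  by apply: (@ccont_comp _ _ p fst); [exact: is_cderive_ccont (hp _)|exact: cvg_fst].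
have cdp1 (x : R * R) : ccont (fun y : R * R => dp y.1) x.
  by apply: (@ccont_comp _ _ dp fst); [exact: hdp|exact: cvg_fst].
have ct1 (x : R * R) : ccont (fun y : R * R => y.2%:C) x.
  by apply: ccont_ofreal; exact: cvg_snd.
have cdh (x : R * R) : ccont (fun y : R * R => dh (y.2%:C * p y.1)) x.
  have [_ h2] := hh (x.2%:C * p x.1).
  by apply: (h2 _ (fun y : R * R => y.2%:C * p y.1)) => //; exact: ccontM.
have [C hC] := ccont_compact_bounded (@compact_rectangle (s - 1) (s + 1) 0 1)
  (fun x _ => ccontM (cdh x) (cdp1 x)).
have [C' hC'] := ccont_compact_bounded (@compact_rectangle (s - 1) (s + 1) 0 1)
  (fun x _ => ccontM (cdh x) (cp1 x)).
have dtp r t : is_cderive (fun x => t%:C * p x) r (t%:C * dp r).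
  exact: is_cderiveMl.
have dts (z : R[i]) t : is_cderive (fun x => x%:C * z) t z.
  apply: is_cderive_eq (is_cderiveM (is_cderive_id t) (is_cderive_cst z t)) _.
  by rewrite mul1r mulr0 addr0.
have dht r t : is_cderive (fun x => h (x%:C * p r)) t (dh (t%:C * p r) * p r).
  by have [h1 _] := hh (t%:C * p r); exact: (h1 _ _ _ erefl (dts (p r) t)).
(* Here the integral over t is evaluated with the primitive h (t p(s)) p'(s) / p(s). *)
have -> : (h (p s) - h 0) / p s * dp s = cint01 (dk s).
  have ps0 : p s != 0 by exact: pD.
  rewrite (@cint01_FTC2 _ (fun t => h (t%:C * p s) * (dp s / p s))).
  - by rewrite mul1r mul0r -mulrBl mulrA mulrAC.
  - move=> t _; have [_ h2] := hh (t%:C * p s).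
    apply: ccontM; last exact: ccont_cst.
    apply: (h2 _ (fun x : R => x%:C * p s)) => //.
    exact: is_cderive_ccont (dts _ _).
  - move=> t _.
    apply: is_cderive_eq (is_cderiveM (dht s t) (is_cderive_cst _ t)) _.
    by rewrite /dk mulr0 addr0; field.
have in_s r : `|r - s| < 1 -> r \in `[s - 1, s + 1].
  by rewrite ltr_distl in_itv /= => /andP[/ltW -> /ltW ->].
have tC0 (t : R) : 0 < t -> t%:C != 0 :> R[i].
  by move=> t0; rewrite eq_complex /= eqxx andbT gt_eqF.
apply: (@is_cderive_cint01 (fun r t => (h (t%:C * p r) - h 0) / t%:C) dk s 1 C).
- exact: ltr01.
- move=> r rs t /andP[t0 t1]; split.
    have [h1 _] := hh (t%:C * p r).
    have d1 := h1 (fun x => t%:C * p x) r _ erefl (dtp r t).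
    have d2 := is_cderiveM (is_cderiveB d1 (is_cderive_cst (h 0) r))
      (is_cderive_cst (t%:C^-1) r).
    apply: is_cderive_eq d2 _.
    by rewrite /dk; field; exact: tC0.
  apply: (hC (r, t)); split => /=; first exact: in_s.
  by rewrite in_itv /= !ltW.
(* The mean value bound on h between 0 and t p(r) contains a factor t, which cancels the
   denominator: the kernel stays below 2 C'. *)
- move=> r rs; apply: (@ccont_bounded_integrable01 _ (2 * C')) => t /andP[t0 t1].
    apply: ccontM.
      by apply: ccontB; [exact: is_cderive_ccont (dht r t)|exact: ccont_cst].
    by apply: ccontV; [exact: tC0|exact: is_cderive_ccont (is_cderive_id _)].
  have h0t : h (t%:C * p r) - h 0 =
      h (t%:C * p r) - h (0%:C * p r) by rewrite mul0r.
  have := @cderive_bound _ _ 0 t C' (ltW t0) (fun x _ => dht r x).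
  rewrite -h0t subr0 Normc.normcM Normc.normcV => hb.
  have -> : normc t%:C = t by rewrite /= expr0n /= addr0 sqrtr_sqr gtr0_norm.
  rewrite ler_pdivrMr //; apply: hb => x; rewrite in_itv /= => /andP[x0 xt].
  apply: (hC' (r, x)); split => /=; first exact: in_s.
  by rewrite in_itv /= x0 (le_trans xt (ltW t1)).
Qed.

Lemma is_cderive_real_line (t : R) (c d : R[i]) :
  is_cderive (fun s => c + s%:C * d) t d.
Proof.
apply: is_cderive_eq (is_cderiveD (is_cderive_cst c t)
  (is_cderiveM (is_cderive_id t) (is_cderive_cst d t))) _.
by rewrite mul1r mulr0 addr0 add0r.
Qed.

Lemma expR_cvgNy (T : Type) (Fl : set_system T) (FF : Filter Fl) (u : T -> R) :
  u t @[t --> Fl] --> -oo -> expR (u t) @[t --> Fl] --> 0.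
Proof.
move=> hu; have h1 : (- u t) @[t --> Fl] --> +oo by apply/cvgNry.
have := cvg_comp _ _ h1 (@cvgr_expR R).
by apply: cvg_trans; apply: near_eq_cvg; apply: nearW => t /=; rewrite opprK.
Qed.

(** F converges along the negative axis because f is exponentially small there, and the vertical
    move from Re g to g changes F by a vanishing amount. That [kappa] serves every filter is the
    point: both ends of the loop get the same limit. *)
Lemma sector_limit F f (C : R) : primitive_on [set z | Re z < 0] F f ->
  (forall z, Re z <= -1 -> `|Im z| <= - Re z / 2 ->
     normc (f z) <= C * expR (2 * Re z)) ->
  exists kappa, forall (T : Type) (Fl : set_system T), Filter Fl ->
    forall g : T -> R[i], Re (g t) @[t --> Fl] --> -oo ->
    (\forall t \near Fl, `|Im (g t)| <= - Re (g t) / 2) ->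
    ccvg Fl (fun t => F (g t)) kappa.
Proof.
move=> hF hf.
have C0 : 0 <= C.
  have : normc (f (-1)%:C) <= C * expR (2 * -1).
    by apply: (hf (-1)%:C) => //=; rewrite normr0; lra.
  move=> /(le_trans (normc_ge0 _)).
  by rewrite pmulr_lge0 // expR_gt0.
(* [primitive_on] wants a curve inside the domain for all real parameters; -1 - e^t maps the whole
   line to the part of the negative axis where f is bounded. *)
pose p (t : R) : R[i] := (- 1 - expR t)%:C.
have hp t : is_cderive p t (- expR t)%:C.
  apply: is_cderive_ofreal.
  have d : is_derive t 1 (cst (-1) - expR) (0 - expR t) by exact: is_deriveB.
  by apply: is_derive_eq d _; rewrite sub0r.
have C1p : C1_pair p (fun t => (- expR t)%:C).
  split=> // t; apply: ccont_ofreal; apply: continuousN.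
  exact: continuous_expR.
have pD t : Re (p t) < 0 by rewrite /=; have := expR_gt0 t; lra.
have dFp := hF _ _ C1p pD.
(* The dominating function for [derive_dominated_cvgy]: |f (p t)| <= C e^(-2 - 2 e^t) <= C
   e^(-e^t). *)
have dU (t : R) : is_derive t 1 (fun s => - (C * expR (- expR s)))
    (C * (expR (- expR t) * expR t)).
  have d1 : is_derive t 1 (fun s : R => - expR s) (- expR t).
    exact: (is_deriveN (is_derive_expR t)).
  have d2 : is_derive t 1 (fun s : R => expR (- expR s)) (expR (- expR t) * - expR t).
    exact: (@is_derive1_comp _ expR (fun s : R => - expR s) t _ _
      (is_derive_expR (- expR t)) d1).
  have d3 := is_deriveN (is_deriveZ C d2).
  by apply: is_derive_eq d3 _; rewrite /GRing.scale /=; ring.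
have bFp t : normc (f (p t) * (- expR t)%:C) <= C * (expR (- expR t) * expR t).
  rewrite Normc.normcM mulrA; apply: ler_pM; rewrite ?normc_ge0 //.
    apply: le_trans (hf (p t) _ _) _.
    - by rewrite /=; have := expR_gt0 t; lra.
    - by rewrite /= normr0; have := expR_gt0 t; lra.
    - rewrite ler_wpM2l // ler_expR /=; have := expR_gt0 t; lra.
  by rewrite /= expr0n /= addr0 sqrtr_sqr normrN ger0_norm // expR_ge0.
have bU t : `|- (C * expR (- expR t))| <= C.
  rewrite normrN ger0_norm ?mulr_ge0 ?expR_ge0 // ler_piMr //.
have [l1 hl1] := @derive_dominated_cvgy _ _ _ _ _ C (fun t => (dFp t).1) dU
  (fun t => le_trans (normRe_le _) (bFp t)) bU.
have [l2 hl2] := @derive_dominated_cvgy _ _ _ _ _ C (fun t => (dFp t).2) dU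
  (fun t => le_trans (normIm_le _) (bFp t)) bU.
exists (l1 +i* l2) => T Fl FFl g hg sg.
have near_lt (A : R) : \forall t \near Fl, Re (g t) <= A.
  by move/cvgrNyPle : hg; apply; exact: num_real.
have to_y : ln (- 1 - Re (g t)) @[t --> Fl] --> +oo.
  apply/cvgryPge => A; apply: filterS (near_lt (- 1 - expR A)) => t ht.
  have eA := expR_gt0 A; rewrite -[leLHS]expRK ler_ln ?posrE //; lra.
have hre : ccvg Fl (fun t => F (Re (g t))%:C) (l1 +i* l2).
  apply: (@near_eq_ccvg _ _ _ _ (fun t => F (p (ln (- 1 - Re (g t)))))).
    apply: filterS (near_lt (- 2)) => t ht; congr (F _%:C).
    by rewrite lnK ?posrE; lra.
  by split; [exact: cvg_comp to_y hl1|exact: cvg_comp to_y hl2].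
have -> : (l1 +i* l2 : R[i]) = (l1 +i* l2) + 0 by rewrite addr0.
apply: (@ccvg_eq _ _ _ _ (fun t => F (Re (g t))%:C + (F (g t) - F (Re (g t))%:C))).
  by move=> t; rewrite addrC subrK.
apply: ccvgD => //.
apply: (@ccvg_bound0 _ _ _ _ _ (fun t => C * expR (Re (g t)))); last first.
  rewrite -[X in _ --> X](mulr0 C); apply: cvgMr.
  exact: expR_cvgNy.
apply: filterS2 sg (near_lt (-1)) => t.
set X := Re (g t); set Y := Im (g t) => hY hX.
(* The vertical segment from X to X + i Y, which stays in the sector for 0 <= s <= 1. *)
pose q (s : R) : R[i] := X%:C + s%:C * (0 +i* Y).
have Req s : Re (q s) = X by rewrite /q cReD cReM /=; ring.
have Imq s : Im (q s) = s * Y by rewrite /q cImD cImM /=; ring.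
have C1q : C1_pair q (fun=> 0 +i* Y).
  by split=> s; [exact: is_cderive_real_line|exact: ccont_cst].
have qD s : Re (q s) < 0 by rewrite Req; lra.
have -> : F (g t) = F (q 1).
  by congr F; apply: complex_ext; rewrite ?Req ?Imq ?mul1r.
have -> : F X%:C = F (q 0) by rewrite /q mul0r addr0.
apply: le_trans (cderive_bound ler01 (fun s _ => hF _ _ C1q qD s) (_ : forall s, _ ->
  normc _ <= C * expR (2 * X) * (- X / 2))) _.
  move=> s; rewrite in_itv /= => /andP[s0 s1]; rewrite Normc.normcM.
  apply: ler_pM; rewrite ?normc_ge0 //.
    rewrite -(Req s); apply: hf; rewrite Req // Imq normrM (ger0_norm s0).
    by apply: le_trans hY; rewrite ler_piMl.
  by rewrite /= expr0n /= add0r sqrtr_sqr.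
have -> : 2 * (C * expR (2 * X) * (- X / 2)) * (1 - 0) =
    C * (expR (2 * X) * - X) by field.
(* Half of the decay e^(2X) absorbs the length: -X <= e^(-X). *)
rewrite ler_wpM2l // (_ : 2 * X = X + X); last by ring.
rewrite expRD -mulrA ler_piMr ?expR_ge0 //.
rewrite -(mulVf (lt0r_neq0 (expR_gt0 X))) mulrC ler_wpM2r ?expR_ge0 // -expRN.
by have := expR_ge1Dx (- X); lra.
Qed.

End PathCalculus.

(** * The loop around the cut *)

Section Logarithm.
Variable R : realType.
Implicit Types (z w : R[i]).

Lemma normcE z : normc z = Num.sqrt (Re z ^+ 2 + Im z ^+ 2).
Proof. by case: z. Qed.

Lemma normc_gt0 z : z != 0 -> 0 < normc z.
Proof. by move=> z0; rewrite normcE sqrtr_gt0 sqr_normc_gt0. Qed.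

Lemma cexpD z w : cexp (z + w) = cexp z * cexp w.
Proof.
rewrite /cexp cReD cImD expRD cosD sinD.
by apply: complex_ext; rewrite !(cReM, cImM) /=; ring.
Qed.

Lemma cexp0 : cexp (0 : R[i]) = 1.
Proof. by rewrite /cexp /= expR0 cos0 sin0 mul1r. Qed.

Lemma normc_cexp z : normc (cexp z) = expR (Re z).
Proof.
rewrite /cexp Normc.normcM /= cos2Dsin2 sqrtr1 mulr1 expr0n /= addr0 sqrtr_sqr.
by rewrite ger0_norm // expR_ge0.
Qed.

Lemma cexp_neq0 z : cexp z != 0.
Proof.
apply/eqP => h; have := normc_cexp z; rewrite h normcE /= expr0n /= addr0 sqrtr0.
by move/eqP; rewrite lt_eqF // expR_gt0.
Qed.

Lemma cexpN z : cexp (- z) = (cexp z)^-1.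
Proof.
by apply: (mulfI (cexp_neq0 z)); rewrite -cexpD subrr cexp0 divff // cexp_neq0.
Qed.

Lemma cexpMn (n : nat) z : cexp (n%:R * z) = cexp z ^+ n.
Proof.
elim: n => [|n IH]; first by rewrite mul0r cexp0 expr0.
by rewrite -natr1 mulrDl mul1r cexpD IH exprSr.
Qed.

Lemma norm_Re_div_le1 z : z != 0 -> -1 <= Re z / cmod z <= 1.
Proof.
move=> z0; have r0 := normc_gt0 z0; rewrite /cmod -normcE.
by rewrite -ler_norml normrM normfV (gtr0_norm r0) ler_pdivrMr // mul1r normRe_le.
Qed.

Lemma cos_carg z : z != 0 -> cos (carg z) = Re z / cmod z.
Proof.
move=> z0; have b := norm_Re_div_le1 z0.
by rewrite /carg; case: ifP => _; rewrite ?cosN acosK // in_itv.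
Qed.

Lemma sin_carg z : z != 0 -> sin (carg z) = Im z / cmod z.
Proof.
move=> z0; have b := norm_Re_div_le1 z0; have r0 := normc_gt0 z0.
have e : Num.sqrt (1 - (Re z / cmod z) ^+ 2) = `|Im z| / cmod z.
  rewrite /cmod -normcE.
  have -> : 1 - (Re z / normc z) ^+ 2 = (Im z / normc z) ^+ 2.
    have := normc_sqr z; rewrite !expr_div_n => h.
    have -> : Im z ^+ 2 = normc z ^+ 2 - Re z ^+ 2 by rewrite h; ring.
    by field; rewrite gt_eqF.
  by rewrite sqrtr_sqr normrM normfV (gtr0_norm r0).
rewrite /carg; case: ifPn => hi; first by rewrite sin_acos // e ger0_norm.
by rewrite sinN sin_acos // e ltr0_norm ?ltNge // mulNr opprK.
Qed.

Lemma cexp_clog z : z != 0 -> cexp (clog z) = z.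
Proof.
move=> z0; have r0 := normc_gt0 z0.
rewrite /cexp /clog /= cos_carg // sin_carg // /cmod -normcE lnK ?posrE //.
by apply: complex_ext; rewrite !(cReM, cImM) /=; field; rewrite gt_eqF.
Qed.

Lemma atanD_inv (u : R) : 0 < u -> atan u + atan u^-1 = pi / 2.
Proof.
move=> u0; have a0 : 0 < atan u by rewrite -(atan0 R); exact: lt_atan.
have a1 := atan_ltpi2 u; have p0 := pi_gt0 R.
have -> : u^-1 = tan (pi / 2 - atan u).
  rewrite -{1}(atanK u) /tan.
  rewrite -(addrC (- atan u)) sinDpihalf cosDpihalf sinN cosN opprK invf_div.
  by [].
rewrite tanK; first by rewrite addrC subrK.
by rewrite in_itv /=; apply/andP; split; lra.
Qed.

Definition slit : set R[i] := [set z | ~ (Im z = 0 /\ Re z <= 0)].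

(* Half the argument has tangent y / (r + x); unlike [clog], this form is
   visibly differentiable on the whole slit plane. *)
Definition slit_log z : R[i] :=
  ln (normc z) +i* (2 * atan (Im z / (normc z + Re z))).

Lemma slit_neq0 z : slit z -> z != 0.
Proof. by move=> h; apply/eqP => z0; apply: h; rewrite z0 /= lexx. Qed.

(** When Re z < 0, the product (|z| + Re z)(|z| - Re z) = (Im z)^2 is positive and so is its second
    factor. *)
Lemma slit_gt0 z : slit z -> 0 < normc z + Re z.
Proof.
move=> h; have r0 := normc_gt0 (slit_neq0 h).
case: (lerP 0 (Re z)) => x0; first by rewrite ltr_wpDr.
have y0 : Im z != 0 by apply/eqP => y0; apply: h; split=> //; exact: ltW.
have h2 := normc_sqr z; have y2 : 0 < Im z ^+ 2 by rewrite exprn_even_gt0.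
have : 0 < (normc z + Re z) * (normc z - Re z) by nra.
by rewrite pmulr_lgt0 //; lra.
Qed.

(** The half-angle tangents y / (r + x) and y / (r - x) are reciprocal, so their arctangents add up
    to pi / 2. This jump is the source of 2 pi i. *)
Lemma slit_logN z : 0 < Im z -> slit_log z = slit_log (- z) + (0 +i* pi).
Proof.
move=> y0; have s1 : slit z by move=> [h _]; rewrite h ltxx in y0.
have s2 : slit (- z).
  by move=> [h _]; move: y0; rewrite -oppr_lt0 -cImN h ltxx.
have g1 := slit_gt0 s1; have g2 := slit_gt0 s2.
have nN : normc (- z) = normc z by rewrite !normcE cReN cImN !sqrrN.
rewrite /slit_log; apply: complex_ext; rewrite ?cReD ?cImD /= nN ?addr0 //.
rewrite cReN nN in g2.
have u0 : 0 < Im z / (normc z + Re z) by rewrite divr_gt0.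
have := atanD_inv u0.
have -> : (Im z / (normc z + Re z))^-1 = Im z / (normc z - Re z).
  have h2 := normc_sqr z.
  have y2 : Im z ^+ 2 = (normc z + Re z) * (normc z - Re z).
    by transitivity (normc z ^+ 2 - Re z ^+ 2); [rewrite h2|]; ring.
  rewrite invf_div; apply/eqP; rewrite eqr_div ?(lt0r_neq0 y0, lt0r_neq0 g2) //.
  by rewrite -expr2 y2.
by rewrite cImN cReN mulNr atanN => ?; lra.
Qed.

Lemma is_cderive_slit_log (p : R -> R[i]) (t : R) (d : R[i]) :
  slit (p t) -> is_cderive p t d ->
  is_cderive (fun s => slit_log (p s)) t (d / p t).
Proof.
move=> sp [dx dy].
have n0 := sqr_normc_gt0 (slit_neq0 sp).
have g0 := slit_gt0 sp; have r0 := normc_gt0 (slit_neq0 sp).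
have r2 := normc_sqr (p t).
set x := fun s => Re (p s); set y := fun s => Im (p s).
pose N : R -> R := x * x + y * y.
have dN : is_derive t 1 N (2 * (x t * Re d + y t * Im d)).
  apply: is_derive_eq (is_deriveD (is_deriveM dx dx) (is_deriveM dy dy)) _.
  by rewrite /GRing.scale /=; ring.
have Npos : 0 < N t by [].
have rE : (fun s => normc (p s)) = (fun s => Num.sqrt (N s)).
  by apply/funext => s; rewrite normcE !expr2.
have dr : is_derive t 1 (fun s => normc (p s))
    ((x t * Re d + y t * Im d) / normc (p t)).
  rewrite rE.
  have d1 := @is_derive1_comp _ Num.sqrt N t _ _ (is_derive1_sqrt Npos) dN.
  apply: is_derive_eq d1 _; rewrite /= (_ : Num.sqrt (N t) = normc (p t)); last first.
    by rewrite normcE !expr2.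
  by field; rewrite gt_eqF.
have dln : is_derive t 1 (fun s => ln (normc (p s)))
    ((x t * Re d + y t * Im d) / normc (p t) ^+ 2).
  have d1 := @is_derive1_comp _ (@ln R) (fun s => normc (p s)) t _ _
    (is_derive1_ln r0) dr.
  by apply: is_derive_eq d1 _; field; rewrite gt_eqF.
pose q : R -> R := (fun s => normc (p s)) + x.
have dq : is_derive t 1 q ((x t * Re d + y t * Im d) / normc (p t) + Re d).
  exact: is_deriveD dr dx.
have q0 : q t != 0 by rewrite gt_eqF.
have dV := is_deriveV q0 dq.
have dyq := is_deriveM dy dV.
have dat := @is_derive1_comp _ (@atan R) (y * (fun s => (q s)^-1)) t _ _
  (is_derive1_atan _) dyq.
split.
  rewrite cReM cReV cImV -r2.
  by apply: is_derive_eq dln _; rewrite /x /y; field; rewrite gt_eqF.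
have d2 := is_deriveZ 2 dat.
apply: is_derive_eq d2 _.
rewrite cImM cReV cImV -r2 /GRing.scale /= /q !fctE /x /y.
set a := Re (p t); set b := Im (p t); set r := normc (p t).
(* With tangent b / (r + a), this is 1 / cos^2 of the half argument. *)
have h : 1 + (b / (r + a)) ^+ 2 = 2 * r / (r + a).
  have hb : b ^+ 2 = r ^+ 2 - a ^+ 2 by rewrite r2; ring.
  by rewrite expr_div_n hb; field; rewrite gt_eqF.
rewrite h.
have hb : b ^+ 2 = r ^+ 2 - a ^+ 2 by rewrite r2; ring.
have r0' : r != 0 by rewrite gt_eqF.
have g0' : r + a != 0 by rewrite gt_eqF.
have key (u v : R) : (r + a) * u = r * v -> 2 * ((2 * r / (r + a))^-1 * u) = v.
  move=> uv; have -> : 2 * ((2 * r / (r + a))^-1 * u) = (r + a) * u / r.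
    by field; rewrite g0' r0'.
  by rewrite uv mulrAC divff // mul1r.
apply: key; apply: (mulfI r0'); apply: (mulfI g0').
transitivity (r * (r + a) * Im d - b * a * Re d - b ^+ 2 * Im d - b * r * Re d).
  by field; rewrite g0' r0'.
rewrite hb.
transitivity ((r + a) * (a * Im d - b * Re d)); first by ring.
by field.
Qed.

End Logarithm.

(** * Loop integrals of the Hermite generating function *)

Section Loop.
Variable R : realType.
Implicit Types (z w : R[i]) (f df : R[i] -> R[i]).

(** The generating function of the H_j(y) z^j / j!, which explains the coefficients found for the
    loop integrals. *)
Definition hermite_exp (y : R) z : R[i] := cexp (- z ^+ 2 + 2 * z * y%:C).

Lemma ccont_at_cst (c : R[i]) z : ccont_at (fun=> c) z.
Proof. by move=> T u x _ _; exact: ccont_cst. Qed.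

Lemma ccont_at_id z : ccont_at id z.
Proof. by []. Qed.

Lemma ccont_atD f g z : ccont_at f z -> ccont_at g z ->
  ccont_at (fun v => f v + g v) z.
Proof. by move=> hf hg T u x ux cu; apply: ccontD; [exact: hf|exact: hg]. Qed.

Lemma ccont_atN f z : ccont_at f z -> ccont_at (fun v => - f v) z.
Proof. by move=> hf T u x ux cu; apply: ccontN; exact: hf. Qed.

Lemma ccont_atM f g z : ccont_at f z -> ccont_at g z ->
  ccont_at (fun v => f v * g v) z.
Proof. by move=> hf hg T u x ux cu; apply: ccontM; [exact: hf|exact: hg]. Qed.

Lemma ccont_atX f n z : ccont_at f z -> ccont_at (fun v => f v ^+ n) z.
Proof. by move=> hf T u x ux cu; apply: ccontX; exact: hf. Qed.

Lemma ccont_atV f z : f z != 0 -> ccont_at f z -> ccont_at (fun v => (f v)^-1) z.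
Proof. by move=> f0 hf T u x ux cu; apply: ccontV; [rewrite ux|exact: hf]. Qed.

Lemma ccont_at_cexp f z : ccont_at f z -> ccont_at (fun v => cexp (f v)) z.
Proof. by move=> hf T u x ux cu; apply: ccont_cexp; exact: hf. Qed.

Lemma cholo_id z : cholo id (fun=> 1) z.
Proof. by move=> p t d _ hp; rewrite mul1r. Qed.

Lemma cholo_cst (c : R[i]) z : cholo (fun=> c) (fun=> 0) z.
Proof. by move=> p t d _ hp; rewrite mul0r; exact: is_cderive_cst. Qed.

Lemma cholo_eq f df df' z : df z = df' z -> cholo f df z -> cholo f df' z.
Proof. by move=> e hf p t d pt hp; rewrite -e; exact: hf. Qed.

Lemma choloD f g df dg z : cholo f df z -> cholo g dg z ->
  cholo (fun v => f v + g v) (fun v => df v + dg v) z.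
Proof.
move=> hf hg p t d pt hp; rewrite mulrDl.
by apply: is_cderiveD; [exact: hf|exact: hg].
Qed.

Lemma choloN f df z : cholo f df z -> cholo (fun v => - f v) (fun v => - df v) z.
Proof.
by move=> hf p t d pt hp; rewrite mulNr; apply: is_cderiveN; exact: hf.
Qed.

Lemma choloM f g df dg z : cholo f df z -> cholo g dg z ->
  cholo (fun v => f v * g v) (fun v => df v * g v + f v * dg v) z.
Proof.
move=> hf hg p t d pt hp.
apply: is_cderive_eq (is_cderiveM (hf p t d pt hp) (hg p t d pt hp)) _.
by rewrite pt; ring.
Qed.

Lemma choloX f df n z : cholo f df z ->
  cholo (fun v => f v ^+ n) (fun v => n%:R * f v ^+ n.-1 * df v) z.
Proof.
move=> hf p t d pt hp.
apply: is_cderive_eq (is_cderiveX n (hf p t d pt hp)) _.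
by rewrite pt mulrA.
Qed.

Lemma choloV f df z : f z != 0 -> cholo f df z ->
  cholo (fun v => (f v)^-1) (fun v => - df v / f v ^+ 2) z.
Proof.
move=> f0 hf p t d pt hp; rewrite -pt in f0.
apply: is_cderive_eq (is_cderiveV f0 (hf p t d pt hp)) _.
by rewrite pt; rewrite !mulNr; congr (- _); rewrite mulrAC.
Qed.

Lemma cholo_cexp f df z : cholo f df z ->
  cholo (fun v => cexp (f v)) (fun v => cexp (f v) * df v) z.
Proof.
move=> hf p t d pt hp.
apply: is_cderive_eq (is_cderive_cexp (hf p t d pt hp)) _.
by rewrite pt mulrA.
Qed.

(** Common form of [hermite_exp] (a = -1), [gauss_line] and e^(w^2) (a = 1), so that regularity is
    proved once. *)
Definition quad_exp (a b z : R[i]) : R[i] := cexp (a * z ^+ 2 + b * z).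

Lemma cholo_quad_exp a b z :
  cholo (quad_exp a b) (fun v => quad_exp a b v * (2 * a * v + b)) z.
Proof.
have h := cholo_cexp (choloD (choloM (@cholo_cst a z) (choloX 2 (@cholo_id z)))
  (choloM (@cholo_cst b z) (@cholo_id z))).
apply: cholo_eq h.
by rewrite /quad_exp /= expr1; ring.
Qed.

Lemma ccont_at_quad_exp a b z : ccont_at (quad_exp a b) z.
Proof.
apply: ccont_at_cexp; apply: ccont_atD.
  by apply: ccont_atM; [exact: ccont_at_cst|exact: ccont_atX].
by apply: ccont_atM; [exact: ccont_at_cst|exact: ccont_at_id].
Qed.

Lemma ccont_at_quad_exp' a b z :
  ccont_at (fun v => quad_exp a b v * (2 * a * v + b)) z.
Proof.
apply: ccont_atM; first exact: ccont_at_quad_exp.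
apply: ccont_atD; last exact: ccont_at_cst.
by apply: ccont_atM; [exact: ccont_at_cst|exact: ccont_at_id].
Qed.

Lemma hermite_expE (y : R) : hermite_exp y = quad_exp (-1) (2 * y%:C).
Proof.
by apply/funext => z; rewrite /hermite_exp /quad_exp mulN1r mulrAC.
Qed.

Lemma hermite_exp0 y : hermite_exp y 0 = 1.
Proof. by rewrite /hermite_exp expr0n /= oppr0 mulr0 mul0r addr0 cexp0. Qed.

Lemma normc_hermite_exp (y : R) z : normc (hermite_exp y z) =
  expR (- Re z ^+ 2 + Im z ^+ 2 + 2 * y * Re z).
Proof.
rewrite normc_cexp; congr expR; rewrite cReD cReN expr2 !cReM /=.
rewrite !cImM /= -!(natr1, expr2) /=; ring.
Qed.

Lemma normc_hermite_exp_sector (y : R) : exists2 C, 0 <= C &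
  forall z, Re z <= -1 -> `|Im z| <= - Re z / 2 ->
    normc (hermite_exp y z) <= C * expR (2 * Re z).
Proof.
(* In the sector the exponent minus 2 X is at most -3/4 X^2 + (2 y - 2) X, whose maximum over X is
   (2 y - 2)^2 / 3. *)
exists (expR ((2 * y - 2) ^+ 2 / 3)); first exact: expR_ge0.
move=> z hX hY; rewrite normc_hermite_exp -expRD ler_expR.
have hY2 : Im z ^+ 2 <= (- Re z / 2) ^+ 2.
  by rewrite -[Im z ^+ 2]real_normK ?num_real // ler_sqr ?nnegrE //; lra.
have : 0 <= (Re z - 2 / 3 * (2 * y - 2)) ^+ 2 by exact: sqr_ge0.
by move: hY2; rewrite !expr2 => h1 h2; nra.
Qed.

Variables (L : R) (gamma : R -> R[i]).
Hypotheses (L0 : 0 < L) (hgamma : loop_around_cut gamma).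
Hypothesis hleft : forall t, Re (gamma t) < L.

Lemma loop_C1 : C1_pair gamma (path_deriv gamma).
Proof.
have [[d1 d2 c1 c2] _ _ _] := hgamma.
split=> t; last by split; [exact: c1|exact: c2].
by split; rewrite /= derive1E; exact: derivableP.
Qed.

Lemma loop_slit t : slit (gamma t).
Proof. by have [_ h _ _] := hgamma; exact: h. Qed.

Lemma loop_sector (Fl : set_system R) (FF : Filter Fl) (theta : R) :
  Re (gamma t) @[t --> Fl] --> -oo -> carg (gamma t) @[t --> Fl] --> theta ->
  cos theta = -1 ->
  \forall t \near Fl, `|Im (gamma t)| <= - Re (gamma t) / 2.
Proof.
move=> hre harg hcos.
have hc : cos (carg (gamma t)) @[t --> Fl] --> (-1 : R).
  by rewrite -hcos; apply: (cvg_comp _ _ harg); exact: continuous_cos.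
(* From |z| < 10/9 (-Re z) follows (Im z)^2 <= 19/81 (Re z)^2, below the required quarter. *)
have : \forall t \near Fl, cos (carg (gamma t)) < - (9 / 10).
  by apply: (cvgr_lt (-1 : R) hc); lra.
apply: filterS => t.
have z0 := slit_neq0 (@loop_slit t); have r0 := normc_gt0 z0.
rewrite cos_carg // /cmod -normcE ltr_pdivrMr // => h.
have h2 := normc_sqr (gamma t).
rewrite -ler_sqr ?nnegrE //; last by lra.
rewrite real_normK ?num_real //.
have : normc (gamma t) ^+ 2 <= (10 / 9 * - Re (gamma t)) ^+ 2.
  by rewrite ler_sqr ?nnegrE; lra.
by rewrite h2 !expr2 => h3; nra.
Qed.

(** The sign of Im decides which branch of [slit_logN] applies. Near this end Im < 0 would give
    [carg] <= 0, and Im = 0 with Re <= -1 lies on the cut. *)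
Lemma loop_endp : [/\ Re (gamma t) @[t --> +oo] --> -oo,
    (\forall t \near +oo, `|Im (gamma t)| <= - Re (gamma t) / 2)
  & (\forall t \near +oo, 0 < Im (gamma t))].
Proof.
have [_ _ _ [h1 h2]] := hgamma.
split=> //; first exact: loop_sector h1 h2 (@cospi R).
have near0 : \forall t \near +oo, 0 < carg (gamma t).
  by apply: (cvgr_gt (pi : R) h2); exact: pi_gt0.
have near1 : \forall t \near +oo, Re (gamma t) <= -1.
  by move/cvgrNyPle : h1; apply; exact: num_real.
apply: filterS2 near0 near1 => t a0 x0.
have z0 := slit_neq0 (@loop_slit t); have b := norm_Re_div_le1 z0.
have yN0 : Im (gamma t) != 0.
  by apply/eqP => y0; apply: (@loop_slit t); split=> //; lra.
rewrite lt_def yN0 /=; case: (lerP 0 (Im (gamma t))) => // y0.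
move: a0; rewrite /carg leNgt y0 /= oppr_gt0 ltNge.
by rewrite acos_ge0.
Qed.

Lemma loop_endm : [/\ Re (gamma t) @[t --> -oo] --> -oo,
    (\forall t \near -oo, `|Im (gamma t)| <= - Re (gamma t) / 2)
  & (\forall t \near -oo, Im (gamma t) < 0)].
Proof.
have [_ _ [h1 h2] _] := hgamma.
split=> //; first by apply: loop_sector h1 h2 _; rewrite cosN cospi.
have near0 : \forall t \near -oo, carg (gamma t) < 0.
  by apply: (cvgr_lt (- pi : R) h2); rewrite oppr_lt0 pi_gt0.
apply: filterS near0 => t a0.
have z0 := slit_neq0 (@loop_slit t); have b := norm_Re_div_le1 z0.
rewrite ltNge; apply/negP => y0.
by move: a0; rewrite /carg y0 ltNge acos_ge0.
Qed.

(** Cauchy's theorem for this contour: the primitive on the half-plane has the same limit at both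
    ends. *)
Lemma loop_integral0 f df (C : R) :
  (forall z, Re z < L -> [/\ cholo f df z, ccont_at f z & ccont_at df z]) ->
  (forall z, Re z <= -1 -> `|Im z| <= - Re z / 2 ->
     normc (f z) <= C * expR (2 * Re z)) ->
  improper_integral (fun t => f (gamma t) * path_deriv gamma t) 0.
Proof.
move=> hf bf; have [F hF] := half_plane_primitive L0 hf.
have hF0 : primitive_on [set z | Re z < 0] F f.
  by move=> p dp C1p pD; apply: hF => // t; exact: lt_trans (pD t) L0.
have [kappa hk] := sector_limit hF0 bf.
have [p1 p2 _] := loop_endp; have [m1 m2 _] := loop_endm.
exists (fun t => F (gamma t)), kappa, kappa; split.
- move=> t; apply: ccontM; last exact: loop_C1.2.
  have [_ h _] := hf _ (hleft t).
  by apply: h => //; exact: is_cderive_ccont (loop_C1.1 t).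
- by move=> t; exact: (hF _ _ loop_C1 hleft t).
- exact: hk.
- exact: hk.
- by rewrite subrr.
Qed.

Lemma loop_integral_hermite_exp y :
  improper_integral (fun t => hermite_exp y (gamma t) * path_deriv gamma t) 0.
Proof.
have [C _ hC] := normc_hermite_exp_sector y.
apply: loop_integral0 hC => z _; rewrite hermite_expE.
split; [exact: cholo_quad_exp|exact: ccont_at_quad_exp|exact: ccont_at_quad_exp'].
Qed.

(** The pole w lies on Re = L, outside the half-plane containing the loop, and |w - z| >= L far to
    the left. *)
Lemma loop_integral_cauchy_right y w : Re w = L ->
  improper_integral (fun t => hermite_exp y (gamma t) / (w - gamma t)
    * path_deriv gamma t) 0.
Proof.
move=> wL; have [C C0 hC] := normc_hermite_exp_sector y.
have [g' [hg cg cg']] : exists g', [/\ (forall z, cholo (hermite_exp y) g' z),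
    (forall z, ccont_at (hermite_exp y) z) & (forall z, ccont_at g' z)].
  rewrite hermite_expE; eexists; split.
  - by move=> z; exact: cholo_quad_exp.
  - by move=> z; exact: ccont_at_quad_exp.
  - by move=> z; exact: ccont_at_quad_exp'.
have cwz z : ccont_at (fun v => w - v) z.
  by apply: ccont_atD; [exact: ccont_at_cst|apply: ccont_atN; exact: ccont_at_id].
apply: (@loop_integral0 (fun z => hermite_exp y z / (w - z))
   (fun v => g' v * (w - v)^-1 + hermite_exp y v * (- (0 + - 1) / (w - v) ^+ 2))
   (C / L)).
  move=> z zL; have wz : w - z != 0.
    by apply/eqP => /(congr1 (@complex.Re R)); rewrite cReB /= wL => h; lra.
  split.
  - apply: choloM => //; apply: choloV => //.
    by apply: choloD; [exact: cholo_cst|apply: choloN; exact: cholo_id].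
  - by apply: ccont_atM => //; exact: ccont_atV.
  - apply: ccont_atD; first by apply: ccont_atM => //; exact: ccont_atV.
    apply: ccont_atM => //; apply: ccont_atM; first exact: ccont_at_cst.
    by apply: ccont_atV; [rewrite expf_neq0|exact: ccont_atX].
move=> z hX hY; have hz := hC z hX hY.
have hw : L <= normc (w - z).
  apply: le_trans (normRe_le _); rewrite cReB wL.
  by apply: le_trans (ler_norm _); lra.
rewrite Normc.normcM Normc.normcV mulrAC ler_pM ?normc_ge0 ?invr_ge0 //.
  exact: normc_ge0.
by rewrite lef_pV2 ?posrE //; exact: lt_le_trans hw.
Qed.

Lemma loop_integral_cauchy0 y : improper_integral
  (fun t => hermite_exp y (gamma t) / gamma t * path_deriv gamma t)
  (2 * pi%:C * 'i%C).
Proof.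
have [C C0 hC] := normc_hermite_exp_sector y.
have [M hM] : exists M, primitive_on [set z | z != 0] M
    (fun z => (hermite_exp y z - hermite_exp y 0) / z).
  rewrite hermite_expE; apply: punctured_primitive => z; split.
    exact: cholo_quad_exp.
  exact: ccont_at_quad_exp'.
(* [slit_log] is cut along the negative axis, where the ends of the loop are; slit_log (- z) is
   regular there and makes [sector_limit] applicable. The two ends are then compared with it by
   [slit_logN]. *)
have hN : primitive_on [set z | Re z < 0] (fun z => M z + slit_log (- z))
    (fun z => hermite_exp y z / z).
  move=> p dp C1p pD t.
  have p0 s : p s != 0 by apply/eqP => h; have := pD s; rewrite /= h ltxx.
  have sN : slit (- p t).
    by move=> [_]; rewrite cReN oppr_le0 leNgt; rewrite (pD t : Re (p t) < 0).
  apply: is_cderive_eq (is_cderiveD (hM p dp C1p p0 t)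
    (is_cderive_slit_log sN (is_cderiveN (C1p.1 t)))) _.
  by rewrite hermite_exp0; field; rewrite p0.
have bN z : Re z <= -1 -> `|Im z| <= - Re z / 2 ->
    normc (hermite_exp y z / z) <= C * expR (2 * Re z).
  move=> hX hY; apply: le_trans (hC z hX hY).
  rewrite Normc.normcM Normc.normcV ler_piMr ?normc_ge0 // invf_le1.
    by apply: le_trans (normRe_le _); rewrite ler_normr; apply/orP; right; lra.
  apply: lt_le_trans (normRe_le _); rewrite normr_gt0 lt_eqF //; lra.
have [kappa hk] := sector_limit hN bN.
have [p1 p2 p3] := loop_endp; have [m1 m2 m3] := loop_endm.
exists (fun t => M (gamma t) + slit_log (gamma t)),
  (kappa + (0 +i* pi)), (kappa - (0 +i* pi)).
have g0 t : gamma t != 0 := slit_neq0 (@loop_slit t).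
split.
- move=> t; apply: ccontM; last exact: loop_C1.2.
  apply: ccontM; last first.
    by apply: ccontV => //; exact: is_cderive_ccont (loop_C1.1 t).
  rewrite hermite_expE; apply: (@ccont_at_quad_exp _ _ (gamma t)) => //.
  exact: is_cderive_ccont (loop_C1.1 t).
- move=> t; apply: is_cderive_eq (is_cderiveD (hM _ _ loop_C1 g0 t)
    (is_cderive_slit_log (@loop_slit t) (loop_C1.1 t))) _.
  by rewrite hermite_exp0; field; exact: g0.
- apply: (@near_eq_ccvg _ _ _ _ _ (fun t => M (gamma t) + slit_log (- gamma t)
    + (0 +i* pi))).
    by apply: filterS p3 => t y0; rewrite (slit_logN y0) addrA.
  by apply: ccvgD; [exact: hk|exact: ccvg_cst].
- apply: (@near_eq_ccvg _ _ _ _ _ (fun t => M (gamma t) + slit_log (- gamma t)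
    - (0 +i* pi))).
    apply: filterS m3 => t y0.
    have yN0 : 0 < Im (- gamma t) by rewrite cImN oppr_gt0.
    by rewrite (slit_logN yN0) opprK addrA addrK.
  by apply: ccvgB; [exact: hk|exact: ccvg_cst].
- transitivity ((0 +i* pi) + (0 +i* pi) : R[i]); last by ring.
  by apply: complex_ext; rewrite !(cReM, cImM, cReD, cImD) /=; ring.
Qed.

Lemma hermite_exp_decay y k (Fl : set_system R) (FF : Filter Fl) :
  Re (gamma t) @[t --> Fl] --> -oo ->
  (\forall t \near Fl, `|Im (gamma t)| <= - Re (gamma t) / 2) ->
  ccvg Fl (fun t => gamma t ^+ 2 / gamma t ^+ k * hermite_exp y (gamma t)) 0.
Proof.
move=> hre hsec; have [C C0 hC] := normc_hermite_exp_sector y.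
(* The 8 is 4 times 2: |z|^2 / |z|^k <= 4 X^2 as 1 <= |z| <= 2 |X|, then X^2 <= 2 e^(-X). *)
apply: (@ccvg_bound0 _ _ _ _ _ (fun t => 8 * C * expR (Re (gamma t)))); last first.
  rewrite -[X in _ --> X](mulr0 (8 * C)); apply: cvgMr.
  exact: expR_cvgNy.
have near1 : \forall t \near Fl, Re (gamma t) <= -1.
  by move/cvgrNyPle : hre; apply; exact: num_real.
apply: filterS2 hsec near1 => t hY hX; have h := hC _ hX hY.
set X := Re (gamma t) in hX hY h *; set r := normc (gamma t).
have r1 : 1 <= r.
  by apply: le_trans (normRe_le _); rewrite ler_normr; apply/orP; right; lra.
have r2 : r <= 2 * - X.
  apply: le_trans (normc_le_ReIm _) _; rewrite -/X ler0_norm; last by lra.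
  by lra.
have hk : r ^+ 2 / r ^+ k <= 4 * X ^+ 2.
  have rk : 1 <= r ^+ k by rewrite exprn_ege1.
  apply: (@le_trans _ _ (r ^+ 2)).
    rewrite ler_piMr ?exprn_ge0 ?normc_ge0 // invf_le1 //.
    exact: lt_le_trans rk.
  have -> : 4 * X ^+ 2 = (2 * - X) ^+ 2 by ring.
  by rewrite ler_sqr ?nnegrE //; lra.
rewrite Normc.normcM (Normc.normcM (gamma t ^+ 2)) Normc.normcV 2!normc_exp -/r.
apply: le_trans (ler_pM _ _ hk h) _; rewrite ?normc_ge0 //.
  by rewrite mulr_ge0 ?invr_ge0 ?exprn_ge0 ?normc_ge0.
have hX2 : X ^+ 2 <= 2 * expR (- X).
  have X0 : 0 <= - X by lra.
  have := expR_ge1Dxn 1 X0; rewrite sqrrN (_ : 2`!%:R = 2 :> R) //.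
  by lra.
have -> : 4 * X ^+ 2 * (C * expR (2 * X)) = 4 * C * expR (2 * X) * X ^+ 2 by ring.
apply: le_trans (ler_wpM2l _ hX2) _; first by rewrite !mulr_ge0 ?expR_ge0.
rewrite le_eqVlt; apply/orP; left; apply/eqP.
have -> : expR (2 * X) = expR X * expR X by rewrite -expRD; congr expR; ring.
rewrite expRN; have := lt0r_neq0 (expR_gt0 X) => e0.
by field.
Qed.

End Loop.

(** * Evaluation of the two contour integrals *)

Section Hermite.
Variable R : realType.

(** The physicists' Hermite polynomials, by the raising operator 2x - d/dx; this form makes
    integration by parts immediate. *)
Fixpoint hermite (n : nat) : {poly R} :=
  if n is m.+1 then 2 *: ('X * hermite m) - (hermite m)^`() else 1.

Lemma hermiteS n : hermite n.+1 = 2 *: ('X * hermite n) - (hermite n)^`().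
Proof. by []. Qed.

Lemma deriv_hermite n : (hermite n.+1)^`() = (2 * n.+1%:R) *: hermite n.
Proof.
have d0 : (hermite 0)^`() = 0 by rewrite /= -polyC1 derivC.
elim: n => [|n IH].
  rewrite hermiteS d0 subr0 derivZ /= mulr1 derivX.
  by rewrite mulr1.
rewrite hermiteS derivB derivZ derivM derivX mul1r IH derivZ.
rewrite !hermiteS -[in RHS]natr1.
rewrite -!mul_polyC !polyCM polyCD !polyC1.
by ring.
Qed.

Lemma hermiteSS n :
  hermite n.+2 = 2 *: ('X * hermite n.+1) - (2 * n.+1%:R) *: hermite n.
Proof. by rewrite hermiteS deriv_hermite. Qed.

Lemma horner_hermiteSS n (x : R) : (hermite n.+2).[x] =
  2 * x * (hermite n.+1).[x] - 2 * n.+1%:R * (hermite n).[x].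
Proof. by rewrite hermiteSS !hornerE. Qed.

Lemma horner_hermite0 (x : R) : (hermite 0).[x] = 1.
Proof. by rewrite hornerE. Qed.

Lemma horner_hermite1 (x : R) : (hermite 1).[x] = 2 * x.
Proof.
have d0 : (hermite 0)^`() = 0 by rewrite /= -polyC1 derivC.
by rewrite hermiteS d0 subr0 hornerZ hornerM hornerX horner_hermite0 mulr1.
Qed.

Lemma expr_le_fact_expR (x : R) (k : nat) : 0 <= x -> x ^+ k <= k`!%:R * expR x.
Proof.
move=> x0; case: k => [|k].
  by rewrite expr0 fact0 mul1r -expR0 ler_expR.
have := expR_ge1Dxn k x0.
rewrite -ler_pdivrMl ?ltr0n ?fact_gt0 // mulrC => h.
by apply: le_trans h; rewrite lerDr.
Qed.

End Hermite.

Section ExactDerivative.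
Variable R : realType.

Lemma improper_integral_exact (phi Phi : R -> R[i]) :
  (forall t, ccont phi t) -> (forall t, is_cderive Phi t (phi t)) ->
  ccvg +oo Phi 0 -> ccvg -oo Phi 0 -> improper_integral phi 0.
Proof.
by move=> h1 h2 h3 h4; exists Phi, 0, 0; split=> //; rewrite subr0.
Qed.

Lemma improper_integral_eq (phi : R -> R[i]) l m :
  l = m -> improper_integral phi l -> improper_integral phi m.
Proof. by move=> ->. Qed.

End ExactDerivative.

(** * Loop integrals with powers of z, without and with the Cauchy factor *)

Section LoopPowers.
Variables (R : realType) (L : R) (gamma : R -> R[i]).
Hypotheses (L0 : 0 < L) (hgamma : loop_around_cut gamma).
Hypothesis hleft : forall t, Re (gamma t) < L.
Variable y : R.

Let g0 t : gamma t != 0 := slit_neq0 (@loop_slit R gamma hgamma t).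
Let C1g := loop_C1 hgamma.

(** The integrand is the total derivative of z^(2-k) e^(-z^2 + 2yz), whose boundary values vanish.
    The power is written z^2 / z^k to keep natural exponents for both signs of 2 - k. *)
Lemma loop_integral_exact (k : nat) : improper_integral (fun t =>
    (2 * gamma t / gamma t ^+ k - k%:R * gamma t ^+ 2 / gamma t ^+ k.+1
     + gamma t ^+ 2 / gamma t ^+ k * (2 * y%:C - 2 * gamma t))
    * hermite_exp y (gamma t) * path_deriv gamma t) 0.
Proof.
have [p1 p2 _] := loop_endp hgamma; have [m1 m2 _] := loop_endm hgamma.
apply: (@improper_integral_exact _ _ (fun t => gamma t ^+ 2 / gamma t ^+ k
    * hermite_exp y (gamma t))); last 2 first.
- exact: hermite_exp_decay p1 p2.
- exact: hermite_exp_decay m1 m2.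
- move=> t.
  have cg : ccont gamma t := is_cderive_ccont (C1g.1 t).
  have cV m : ccont (fun t => (gamma t ^+ m)^-1) t.
    by apply: ccontV; [rewrite expf_neq0|exact: ccontX].
  have cc (c : R[i]) : ccont (fun t : R => c) t by exact: ccont_cst.
  have ch : ccont (fun t => hermite_exp y (gamma t)) t.
    by rewrite hermite_expE; apply: (@ccont_at_quad_exp _ _ _ (gamma t)).
  apply: ccontM; last exact: C1g.2.
  apply: ccontM => //; apply: ccontD.
    apply: ccontB; first by apply: ccontM => //; apply: ccontM.
    by apply: ccontM => //; apply: ccontM => //; exact: ccontX.
  apply: ccontM; first by apply: ccontM => //; exact: ccontX.
  by apply: ccontB => //; apply: ccontM.
- move=> t.
  have dg := C1g.1 t.
  have gk : gamma t ^+ k != 0 by rewrite expf_neq0.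
  have dh : is_cderive (fun t => hermite_exp y (gamma t)) t
      (hermite_exp y (gamma t) * (2 * y%:C - 2 * gamma t) * path_deriv gamma t).
    rewrite hermite_expE.
    apply: is_cderive_eq (@cholo_quad_exp R (-1) (2 * y%:C) (gamma t) _ _ _ erefl dg) _.
    by ring.
  apply: is_cderive_eq (is_cderiveM (is_cderiveM (is_cderiveX 2 dg)
    (is_cderiveV gk (is_cderiveX k dg))) dh) _.
  rewrite /= expr1; case: k gk => [|k] gk.
    by rewrite !expr0 /=; field; rewrite g0.
  by rewrite /= !exprS; field; rewrite g0 expf_neq0.
Qed.

Definition hermite_coef (j : nat) : R[i] := ((hermite R j).[y] / j`!%:R)%:C.

Lemma hermite_coefSS (m : nat) : m.+2%:R * hermite_coef m.+2 =
  2 * y%:C * hermite_coef m.+1 - 2 * hermite_coef m.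
Proof.
have f0 : m`!%:R != 0 :> R by rewrite pnatr_eq0 -lt0n fact_gt0.
have -> : m.+2%:R = (m.+2%:R : R)%:C by rewrite rmorph_nat.
have -> : 2 = (2 : R)%:C by rewrite rmorph_nat.
rewrite /hermite_coef -!rmorphM -rmorphB; congr (_%:C).
rewrite horner_hermiteSS !factS !natrM.
have m1 : 1 + m%:R != 0 :> R by rewrite nat1r pnatr_eq0.
have m2 : 2 + m%:R != 0 :> R by rewrite -natrD pnatr_eq0.
rewrite -[m.+2]/(2 + m)%N -[m.+1]/(1 + m)%N !natrD.
by field; rewrite f0 m1.
Qed.

(** 2 pi i times the residue of z^(2-k) e^(-z^2 + 2yz) at 0: the pole has order k - 2, hence the
    Taylor coefficient of index k - 3. *)
Definition loop_coef (k : nat) : R[i] :=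
  if k is m.+3 then 2 * pi%:C * 'i%C * hermite_coef m else 0.

Lemma loop_integral_pow (k : nat) : improper_integral (fun t =>
    gamma t ^+ 2 / gamma t ^+ k.+1 * hermite_exp y (gamma t) * path_deriv gamma t)
  (loop_coef k.+1).
Proof.
have base2 : improper_integral (fun t =>
    gamma t ^+ 2 / gamma t ^+ 2 * hermite_exp y (gamma t) * path_deriv gamma t)
    (loop_coef 2).
  apply: improper_integral_ext (loop_integral_hermite_exp L0 hgamma hleft y) => t.
  by rewrite divff ?mul1r // expf_neq0.
have base3 : improper_integral (fun t =>
    gamma t ^+ 2 / gamma t ^+ 3 * hermite_exp y (gamma t) * path_deriv gamma t)
    (loop_coef 3).
  have -> : loop_coef 3 = 2 * pi%:C * 'i%C.
    by rewrite /= /hermite_coef horner_hermite0 fact0 divr1 mulr1.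
  apply: improper_integral_ext (loop_integral_cauchy0 hgamma y) => t.
  by field; rewrite g0.
have base1 : improper_integral (fun t =>
    gamma t ^+ 2 / gamma t ^+ 1 * hermite_exp y (gamma t) * path_deriv gamma t)
    (loop_coef 1).
  (* At k = 2 the factor 2 - k kills the 1/z term of the total derivative, leaving z expressed
     through the constant case. *)
  have h := improper_integralD (improper_integralMl y%:C base2)
    (improper_integralMl (- 2^-1) (loop_integral_exact 2)).
  apply: improper_integral_eq (improper_integral_ext _ h).
    by rewrite /= !mulr0 addr0.
  by move=> t /=; field; rewrite g0.
case: k => [//|k].
suff : improper_integral (fun t =>
    gamma t ^+ 2 / gamma t ^+ k.+2 * hermite_exp y (gamma t) * path_deriv gamma t)
    (loop_coef k.+2) /\ improper_integral (fun t =>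
    gamma t ^+ 2 / gamma t ^+ k.+3 * hermite_exp y (gamma t) * path_deriv gamma t)
    (loop_coef k.+3).
  by case.
elim: k => [//|k [IH1 IH2]]; split=> //.
have k1 : k.+1%:R != 0 :> R[i] by rewrite pnatr_eq0.
(* The recurrence given by the total derivative, solved for its highest inverse power, whose factor
   is 2 - (k + 3) = -(k + 1). *)
have h := improper_integralMl (k.+1%:R^-1) (improper_integralD (improper_integralD
  (improper_integralMl (2 * y%:C) IH2) (improper_integralMl (- 2) IH1))
    (improper_integralMl (-1) (loop_integral_exact k.+3))).
apply: improper_integral_eq (improper_integral_ext _ h).
  rewrite !mulr0 addr0; apply: (mulfI k1); rewrite mulrA divff // mul1r.
  (* For k = 0 the lower term is a zero integral, and the recurrence reads H_1 = 2 y H_0; afterwards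
     it is [hermite_coefSS]. *)
  case: k {IH1 IH2 h} k1 => [|m] k1.
    rewrite /= /hermite_coef horner_hermite0 horner_hermite1 fact0 !divr1.
    rewrite !rmorphM rmorph_nat rmorph1; ring.
  transitivity (2 * pi%:C * 'i%C * (m.+2%:R * hermite_coef m.+2)).
    by rewrite hermite_coefSS /=; ring.
  by rewrite /=; ring.
move=> t /=; rewrite !exprS expr0.
have gk : gamma t ^+ k != 0 by rewrite expf_neq0.
have k1' : 1 + k%:R != 0 :> R[i] by rewrite nat1r pnatr_eq0.
have -> : k.+3%:R = 1 + k%:R + 2 :> R[i] by rewrite nat1r -natrD addn2.
have -> : k.+1%:R = 1 + k%:R :> R[i] by rewrite nat1r.
by field; rewrite k1' g0 gk.
Qed.

(** The sum is the Taylor polynomial of [hermite_exp] at w of degree below k - 2, the order of the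
    pole at 0; truncated subtraction makes it empty for k <= 2, when there is no pole. *)
Lemma loop_integral_cauchy (w : R[i]) (k : nat) : Re w = L ->
  improper_integral (fun t => gamma t ^+ 2 / gamma t ^+ k
     * (hermite_exp y (gamma t) / (w - gamma t)) * path_deriv gamma t)
  (2 * pi%:C * 'i%C * \sum_(j < k - 2) hermite_coef j * w ^+ j / w ^+ (k - 2)).
Proof.
move=> wL.
have wz t : w - gamma t != 0.
  apply/eqP => /(congr1 (@complex.Re R)); rewrite cReB /= wL => h.
  by have := hleft t; lra.
have w0 : w != 0 by apply/eqP => w0; rewrite w0 /= in wL; move: L0; rewrite -wL ltxx.
have base2 : improper_integral (fun t => gamma t ^+ 2 / gamma t ^+ 2
     * (hermite_exp y (gamma t) / (w - gamma t)) * path_deriv gamma t) 0.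
  apply: improper_integral_ext (loop_integral_cauchy_right L0 hgamma hleft y wL).
  by move=> t; rewrite divff ?mul1r // expf_neq0.
have base1 : improper_integral (fun t => gamma t ^+ 2 / gamma t ^+ 1
     * (hermite_exp y (gamma t) / (w - gamma t)) * path_deriv gamma t) 0.
  (* z / (w - z) = w / (w - z) - 1 lowers k, down to 0. *)
  have h := improper_integralD (improper_integralMl w base2)
    (improper_integralMl (-1) (loop_integral_pow 1)).
  apply: improper_integral_eq (improper_integral_ext _ h).
    by rewrite /= !mulr0 addr0.
  by move=> t /=; field; rewrite g0 wz.
case: k => [|[|k]].
- rewrite big_ord0 mulr0.
  have h := improper_integralD (improper_integralMl w base1)
    (improper_integralMl (-1) (loop_integral_pow 0)).
  apply: improper_integral_eq (improper_integral_ext _ h).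
    by rewrite /= !mulr0 addr0.
  by move=> t /=; field; rewrite g0 wz.
- by rewrite big_ord0 mulr0.
rewrite subn2 /=; elim: k => [|k IH]; first by rewrite big_ord0 mulr0.
have h := improper_integralMl w^-1 (improper_integralD (loop_integral_pow k.+2) IH).
apply: improper_integral_eq (improper_integral_ext _ h).
  rewrite /loop_coef -!mulr_suml big_ord_recr /= exprS.
  by field; rewrite w0 expf_neq0 //= pnatr_eq0 -lt0n fact_gt0.
move=> t; rewrite !exprS.
have gk : gamma t ^+ k != 0 by rewrite expf_neq0.
by field; rewrite g0 gk w0 wz.
Qed.

End LoopPowers.

(** * Gaussian integrals over the vertical line *)

Section VerticalLine.
Variables (R : realType).
Variables (L x : R).

Lemma path_deriv_vertical s : path_deriv (vertical_line L) s = 'i%C.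
Proof.
rewrite /path_deriv /vertical_line /= !derive1E.
by rewrite derive_cst (derive_id s (1 : R)).
Qed.

Lemma is_cderive_vertical (c s : R) : is_cderive (vertical_line c) s 'i%C.
Proof. by split => /=; [exact: is_derive_cst|exact: is_derive_id]. Qed.

Definition gauss_line (w : R[i]) : R[i] := cexp (w ^+ 2 - 2 * x%:C * w).

Lemma gauss_lineE : gauss_line = quad_exp 1 (- (2 * x%:C)).
Proof. by apply/funext => w; rewrite /gauss_line /quad_exp mul1r mulNr. Qed.

Lemma cvg_expR_norm (Fl : set_system R) (FF : Filter Fl) (C : R) :
  `|s| @[s --> Fl] --> +oo -> C * expR (- `|s|) @[s --> Fl] --> 0.
Proof.
move=> h; rewrite -[X in _ --> X](mulr0 C); apply: cvgMr.
by apply: expR_cvgNy; apply/cvgNrNy.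
Qed.

Lemma gauss_line_decay (k : nat) (Fl : set_system R) (FF : Filter Fl) :
  `|s| @[s --> Fl] --> +oo ->
  ccvg Fl (fun s => vertical_line L s ^+ k * gauss_line (vertical_line L s)) 0.
Proof.
(* |w|^k <= k! e^|w| with |w| <= |L| + |s|, and |s| - s^2 <= 1 - |s|. *)
move=> hFl; pose C := k`!%:R * expR (`|L| + (L ^+ 2 - 2 * x * L) + 1).
apply: (@ccvg_bound0 _ _ _ _ _ (fun s => C * expR (- `|s|))); last first.
  exact: cvg_expR_norm.
apply: nearW => s; rewrite Normc.normcM normc_exp /gauss_line normc_cexp.
have r0 := normc_ge0 (vertical_line L s).
apply: le_trans (ler_wpM2r (expR_ge0 _) (expr_le_fact_expR k r0)) _.
rewrite /C -[leLHS]mulrA -[leRHS]mulrA ler_wpM2l ?ler0n // -!expRD ler_expR.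
have := normc_le_ReIm (vertical_line L s).
have -> : Re (vertical_line L s ^+ 2 - 2 * x%:C * vertical_line L s) =
    L ^+ 2 - s ^+ 2 - 2 * x * L.
  by rewrite cReB !expr2 !(cReM, cImM) /=; ring.
rewrite /= => h1.
have : 0 <= (`|s| - 1) ^+ 2 by exact: sqr_ge0.
have : `|s| ^+ 2 = s ^+ 2 by rewrite real_normK ?num_real.
by move=> h2 h3; nra.
Qed.

Lemma norm_cvgy : `|s| @[s --> (+oo : set_system R)] --> +oo.
Proof.
apply/cvgryPge => A; near=> s; apply: le_trans (ler_norm s).
by near: s; apply: nbhs_pinfty_ge; exact: num_real.
Unshelve. all: by end_near. Qed.

Lemma norm_cvgNy : `|s| @[s --> (-oo : set_system R)] --> +oo.
Proof.
apply/cvgryPge => A; near=> s; apply: (@le_trans _ _ (- s)); last first.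
  by rewrite -normrN ler_norm.
by rewrite lerNr; near: s; apply: nbhs_ninfty_le; exact: num_real.
Unshelve. all: by end_near. Qed.

Lemma vertical_integral_exact (k : nat) : improper_integral (fun s =>
    (k%:R * vertical_line L s ^+ k.-1 + 2 * vertical_line L s ^+ k.+1
     - 2 * x%:C * vertical_line L s ^+ k)
    * gauss_line (vertical_line L s) * 'i%C) 0.
Proof.
apply: (@improper_integral_exact _ _
  (fun s => vertical_line L s ^+ k * gauss_line (vertical_line L s))).
- move=> s; have cl := is_cderive_ccont (is_cderive_vertical L s).
  have cX m : ccont (fun s => vertical_line L s ^+ m) s by exact: ccontX.
  have cc (c : R[i]) : ccont (fun s : R => c) s by exact: ccont_cst.
  apply: ccontM => //; apply: ccontM.
    by apply: ccontB; [apply: ccontD|]; exact: ccontM.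
  by rewrite gauss_lineE; apply: (@ccont_at_quad_exp _ _ _ (vertical_line L s)).
- move=> s; have dl := is_cderive_vertical L s.
  have dh : is_cderive (fun t => gauss_line (vertical_line L t)) s
      (gauss_line (vertical_line L s) * (2 * vertical_line L s - 2 * x%:C) * 'i%C).
    rewrite gauss_lineE.
    apply: is_cderive_eq (@cholo_quad_exp R 1 (- (2 * x%:C)) (vertical_line L s)
      _ _ _ erefl dl) _.
    by ring.
  apply: is_cderive_eq (is_cderiveM (is_cderiveX k dl) dh) _.
  by rewrite exprS; ring.
- by apply: gauss_line_decay; exact: norm_cvgy.
- by apply: gauss_line_decay; exact: norm_cvgNy.
Qed.

(** The arctangent dominates, as e^(-s^2) <= 1 / (1 + s^2); the limit at -oo is obtained by the
    reflection -G(-s), and the difference is the Gaussian integral. *)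
Lemma gauss_primitive_limits (G : R -> R) :
  (forall s : R, is_derive s 1 G (expR (- s ^+ 2))) ->
  exists l l' : R, [/\ G s @[s --> +oo] --> l, G s @[s --> -oo] --> l'
    & l - l' = Num.sqrt pi].
Proof.
move=> dG.
have dU (s : R) : is_derive s 1 (@atan R) (1 + s ^+ 2)^-1 by exact: is_derive1_atan.
have bU (s : R) : `|atan s| <= pi / 2.
  by rewrite ler_norml !ltW // ?atan_ltpi2 // atan_gtNpi2.
have bG (s : R) : `|expR (- s ^+ 2)| <= (1 + s ^+ 2)^-1.
  rewrite ger0_norm ?expR_ge0 // expRN lef_pV2 ?posrE ?expR_gt0 //.
    exact: expR_ge1Dx.
  by rewrite ltr_wpDr // sqr_ge0.
have [l hl] := derive_dominated_cvgy dG dU bG bU.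
pose G' (s : R) := - G (- s).
have dG' (s : R) : is_derive s 1 G' (expR (- s ^+ 2)).
  have dN : is_derive s 1 (fun t : R => - t) (-1) by exact: is_deriveNid.
  have d1 := @is_derive1_comp _ G (fun t : R => - t) s _ _ (dG (- s)) dN.
  apply: is_derive_eq (is_deriveN d1) _.
  by rewrite sqrrN mulrN1 opprK.
have [m hm] := derive_dominated_cvgy dG' dU bG bU.
have hGm : G s @[s --> -oo] --> - m.
  apply/cvgNy_compNP; apply: near_eq_cvg_to (cvgN hm).
  by apply: nearW => s; exact: opprK.
exists l, (- m); split=> //.
rewrite -(@Rintegral_FTC2_setT _ (fun s : R => expR (- s ^+ 2)) G) //.
- by rewrite /Rintegral (integralT_gauss (R := R)).
- exact: (integrableT_gauss (R := R)).
- exact: continuous_gauss_fun.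
Qed.

(** Completing the square turns the line Re w = L into Re = L - x for e^(w^2), up to e^(-x^2).
    Shifting to the imaginary axis leaves the real Gaussian integral, since horizontal segments
    contribute nothing in the limit. *)
Lemma vertical_integral_gauss : improper_integral
  (fun s => gauss_line (vertical_line L s) * 'i%C)
  ('i%C * (Num.sqrt pi * expR (- x ^+ 2))%:C).
Proof.
set c := L - x.
have c1 : 0 < `|c| + 1 by rewrite ltr_wpDl.
have [F hF] := half_plane_primitive c1 (fun z _ => And3 (@cholo_quad_exp R 1 0 z)
  (@ccont_at_quad_exp R 1 0 z) (@ccont_at_quad_exp' R 1 0 z)).
have q1 (a s : R) : quad_exp 1 0 (vertical_line a s) = cexp (vertical_line a s ^+ 2).
  by rewrite /quad_exp mul1r mul0r addr0.
have dF (a s : R) : a < `|c| + 1 -> is_cderive (fun t => F (vertical_line a t)) s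
    (quad_exp 1 0 (vertical_line a s) * 'i%C).
  move=> ac; apply: (hF (vertical_line a) (fun=> 'i%C)) => //.
  by split=> t; [exact: is_cderive_vertical|exact: ccont_cst].
have cN : c < `|c| + 1 by have := ler_norm c; lra.
pose Gi s := Im (F (vertical_line 0 s)).
have e0 (s : R) : quad_exp 1 0 (vertical_line 0 s) * 'i%C = 0 +i* expR (- s ^+ 2).
  rewrite q1 /cexp; have -> : vertical_line 0 s ^+ 2 = (- s ^+ 2)%:C.
    by apply: complex_ext; rewrite !expr2 ?(cReM, cImM) /=; ring.
  rewrite /= cos0 sin0.
  by apply: complex_ext; rewrite !(cReM, cImM) /=; ring.
have dGi (s : R) : is_derive s 1 Gi (expR (- s ^+ 2)).
  by have [_] := dF 0 s c1; rewrite e0.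
have dGr (s : R) : is_derive s 1 (fun s => Re (F (vertical_line 0 s))) 0.
  by have [] := dF 0 s c1; rewrite e0.
have [l [l' [hl hl' ll']]] := gauss_primitive_limits dGi.
(* On the imaginary axis the derivative of F is purely imaginary, so Re F is constant there. *)
pose k0 := Re (F (vertical_line 0 0)).
have F0E s : F (vertical_line 0 s) = k0 +i* Gi s.
  apply: complex_ext => //=.
  exact: (@is_derive_0_is_cst _ (fun s => Re (F (vertical_line 0 s))) s 0 dGr).
have lim0 (Fl : set_system R) (FF : Filter Fl) (m : R) :
    `|s| @[s --> Fl] --> +oo -> Gi s @[s --> Fl] --> m ->
    ccvg Fl (fun s => F (vertical_line c s)) (k0 +i* m).
  move=> hFl hG.
  have -> : k0 +i* m = (k0 +i* m) + 0 :> R[i] by rewrite addr0.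
  apply: (@ccvg_eq _ _ _ _ (fun s => F (vertical_line 0 s) +
      (F (vertical_line c s) - F (vertical_line 0 s)))).
    by move=> s; rewrite addrC subrK.
  apply: ccvgD.
    apply: (@ccvg_eq _ _ _ _ (fun s => k0 +i* Gi s)) => //.
    by split=> //=; exact: cvg_cst.
  (* pi is the factor 2 of [cderive_bound] times the parameter length pi / 2, and c^2 - s^2 <= c^2 +
     1 - |s|. *)
  pose C := pi * (expR (c ^+ 2 + 1) * `|c|).
  apply: (@ccvg_bound0 _ _ _ _ _ (fun s => C * expR (- `|s|))); last first.
    exact: cvg_expR_norm.
  apply: nearW => s.
  (* The horizontal shift is made along sin, so that the whole real line of
     parameters stays in the half-plane where F is a primitive. *)
  pose p (t : R) : R[i] := (sin t * c) +i* s.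
  have dp t : is_cderive p t (cos t * c)%:C.
    split => /=; last exact: is_derive_cst.
    apply: is_derive_eq (is_deriveM (is_derive_sin t) (is_derive_cst c t 1)) _.
    by rewrite /GRing.scale /=; ring.
  have C1p : C1_pair p (fun t => (cos t * c)%:C).
    split=> // t; apply: ccont_ofreal; apply: cvgM; last exact: cvg_cst.
    exact: continuous_cos.
  have pD t : half_plane (`|c| + 1) (p t).
    rewrite /half_plane /=; apply: (@le_lt_trans _ _ `|c|); last by lra.
    apply: le_trans (ler_norm _) _; rewrite normrM ler_piMl //.
    by rewrite ler_norml sin_geN1 sin_le1.
  have -> : vertical_line c s = p (pi / 2).
    by rewrite /p sin_pihalf mul1r.
  have -> : vertical_line 0 s = p 0 by rewrite /p sin0 mul0r.
  have pi2 : (0 : R) <= pi / 2 by rewrite divr_ge0 ?pi_ge0.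
  apply: le_trans (cderive_bound (C := expR (c ^+ 2 - s ^+ 2) * `|c|) pi2
    (fun t _ => hF _ _ C1p pD t) _) _.
    move=> t _; rewrite Normc.normcM normc_cexp; apply: ler_pM.
    - exact: expR_ge0.
    - exact: normc_ge0.
    - rewrite ler_expR mul1r mul0r addr0 expr2 cReM /= -!expr2 exprMn.
      have : sin t ^+ 2 <= 1 by have := cos2Dsin2 t; have := sqr_ge0 (cos t); lra.
      by have := sqr_ge0 c; nra.
    - rewrite /= expr0n /= addr0 sqrtr_sqr normrM ler_piMl //.
      by rewrite ler_norml cos_geN1 cos_le1.
  have -> : 2 * (expR (c ^+ 2 - s ^+ 2) * `|c|) * (pi / 2 - 0) =
     pi * `|c| * expR (c ^+ 2 - s ^+ 2) by field.
  have -> : C * expR (- `|s|) = pi * `|c| * (expR (c ^+ 2 + 1) * expR (- `|s|)).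
    by rewrite /C; ring.
  rewrite ler_wpM2l ?mulr_ge0 ?pi_ge0 // -expRD ler_expR.
  have : 0 <= (`|s| - 1) ^+ 2 by exact: sqr_ge0.
  have : `|s| ^+ 2 = s ^+ 2 by rewrite real_normK ?num_real.
  by have := normr_ge0 s; move=> h1 h2 h3; nra.
have gE s : gauss_line (vertical_line L s) * 'i%C =
    (expR (- x ^+ 2))%:C * (quad_exp 1 0 (vertical_line c s) * 'i%C).
  have -> : (expR (- x ^+ 2))%:C = cexp (- x ^+ 2)%:C.
    by rewrite /cexp /= cos0 sin0 -[1 +i* 0]/(1 : R[i]) mulr1.
  rewrite mulrA q1 -cexpD /gauss_line; congr (cexp _ * _).
  by apply: complex_ext; rewrite !(cReD, cImD, expr2, cReN, cImN, cReM, cImM) /= /c; ring.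
exists (fun s => (expR (- x ^+ 2))%:C * F (vertical_line c s)),
  ((expR (- x ^+ 2))%:C * (k0 +i* l)), ((expR (- x ^+ 2))%:C * (k0 +i* l')).
split.
- move=> s; apply: ccontM; last exact: ccont_cst.
  rewrite gauss_lineE; apply: (@ccont_at_quad_exp _ _ _ (vertical_line L s)) => //.
  exact: is_cderive_ccont (is_cderive_vertical L s).
- by move=> s; rewrite gE; apply: is_cderiveMl; exact: dF.
- by apply: ccvgM; [exact: ccvg_cst|apply: lim0 => //; exact: norm_cvgy].
- by apply: ccvgM; [exact: ccvg_cst|apply: lim0 => //; exact: norm_cvgNy].
- rewrite -mulrBr -ll'.
  by apply: complex_ext; rewrite !(cReM, cImM, cReB, cImB) /=; ring.
Qed.

(** Total derivatives give I_(k+2) = x I_(k+1) - (k+1)/2 I_k, which is the three-term recurrence of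
    2^(-k) H_k. *)
Lemma vertical_integral_pow (k : nat) : improper_integral
  (fun s => vertical_line L s ^+ k * gauss_line (vertical_line L s) * 'i%C)
  ('i%C * (Num.sqrt pi * expR (- x ^+ 2) * (2 ^- k * (hermite R k).[x]))%:C).
Proof.
suff [] : improper_integral
  (fun s => vertical_line L s ^+ k * gauss_line (vertical_line L s) * 'i%C)
  ('i%C * (Num.sqrt pi * expR (- x ^+ 2) * (2 ^- k * (hermite R k).[x]))%:C) /\
  improper_integral
  (fun s => vertical_line L s ^+ k.+1 * gauss_line (vertical_line L s) * 'i%C)
  ('i%C * (Num.sqrt pi * expR (- x ^+ 2) * (2 ^- k.+1 * (hermite R k.+1).[x]))%:C).
  by [].
elim: k => [|k [IH1 IH2]].
  have b0 : improper_integral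
      (fun s => vertical_line L s ^+ 0 * gauss_line (vertical_line L s) * 'i%C)
      ('i%C * (Num.sqrt pi * expR (- x ^+ 2) * (2 ^- 0 * (hermite R 0).[x]))%:C).
    apply: improper_integral_eq (improper_integral_ext _ vertical_integral_gauss).
      by rewrite horner_hermite0 expr0 invr1 !mulr1.
    by move=> s; rewrite expr0 mul1r.
  split=> //.
  have h := improper_integralD (improper_integralMl x%:C b0)
    (improper_integralMl (2^-1) (vertical_integral_exact 0)).
  apply: improper_integral_eq (improper_integral_ext _ h).
    rewrite mulr0 addr0 horner_hermite0 horner_hermite1 expr0 expr1 invr1.
    by rewrite mulrCA -rmorphM; congr (_ * _%:C); field.
  by move=> s /=; rewrite expr0 expr1; field.
split=> //.
have h := improper_integralD (improper_integralD (improper_integralMl x%:C IH2)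
    (improper_integralMl (- (k.+1%:R / 2)) IH1))
    (improper_integralMl (2^-1) (vertical_integral_exact k.+1)).
apply: improper_integral_eq (improper_integral_ext _ h).
  have -> : - (k.+1%:R / 2) = (- (k.+1%:R / 2) : R)%:C.
    by rewrite rmorphN fmorph_div !rmorph_nat.
  rewrite mulr0 addr0 !(mulrCA _ 'i%C) -mulrDr -!rmorphM -rmorphD.
  congr (_ * _%:C); rewrite horner_hermiteSS.
  have p0 : 2 ^+ k != 0 :> R by rewrite expf_neq0 // pnatr_eq0.
  by rewrite !exprS; field.
by move=> s /=; rewrite !exprS; field.
Qed.

End VerticalLine.

(** * The Christoffel-Darboux kernel *)

Section GaussianMoments.
Variable R : realType.
Local Notation mu := (@lebesgue_measure R).
Implicit Types (p q : {poly R}) (x : R).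

Lemma integrable_expR_halfsqr (C : R) :
  mu.-integrable setT (EFin \o (fun x => C * expR (- x ^+ 2 / 2))).
Proof.
have s1 : (1 : R) != 0 by exact: oner_neq0.
have h := @integrable_normal_pdf R 0 1.
have pk : normal_peak (1 : R) != 0 by rewrite gt_eqF // normal_peak_gt0.
rewrite (_ : EFin \o _ =
    (fun x => (C / normal_peak 1)%:E * (EFin \o normal_pdf 0 1) x)%E).
  exact: integrableZl.
apply/funext => x.
have e : normal_pdf 0 1 x = normal_peak 1 * normal_fun 0 1 x.
  by rewrite normal_pdfE.
rewrite /= -EFinM e mulrA divfK // /normal_fun subr0 expr1n.
by [].
Qed.

Lemma horner_le_expR p : exists2 C : R, 0 <= C &
  forall x, `|p.[x] * expR (- x ^+ 2)| <= C * expR (`|x| - x ^+ 2).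
Proof.
exists (\sum_(i < size p) `|p`_i| * i`!%:R).
  by apply: sumr_ge0 => i _; rewrite mulr_ge0 ?ler0n.
move=> x; rewrite normrM (ger0_norm (expR_ge0 _)) expRD mulrA ler_wpM2r ?expR_ge0 //.
rewrite horner_coef mulr_suml; apply: le_trans (ler_norm_sum _ _ _) _.
apply: ler_sum => i _; rewrite normrM -mulrA ler_wpM2l // normrX.
exact: expr_le_fact_expR.
Qed.

Lemma continuous_horner_gauss p : continuous (fun x => p.[x] * expR (- x ^+ 2)).
Proof.
move=> x; apply: cvgM; first exact: continuous_horner.
exact: (@continuous_gauss_fun R).
Qed.

Lemma integrable_gint p :
  mu.-integrable setT (EFin \o (fun x => p.[x] * expR (- x ^+ 2))).
Proof.
have [C C0 hC] := horner_le_expR p.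
(* A normal density dominates: |x| - x^2 <= 1 - x^2 / 2, whence the extra factor e. *)
apply: (le_integrable _ _ _ (integrable_expR_halfsqr (C * expR 1))) => //.
  apply/measurable_EFinP; apply: continuous_measurable_fun.
  exact: continuous_horner_gauss.
move=> x _ /=; rewrite lee_fin.
apply: le_trans (hC x) _; apply: le_trans (ler_norm _).
rewrite -mulrA ler_wpM2l // -expRD ler_expR.
have : `|x| ^+ 2 = x ^+ 2 by rewrite real_normK ?num_real.
by have := sqr_ge0 (`|x| - 1); nra.
Qed.

Definition gint p : R := \int[mu]_(x in setT) (p.[x] * expR (- x ^+ 2)).

Lemma gintD p q : gint (p + q) = gint p + gint q.
Proof.
rewrite /gint -RintegralD //; [|exact: integrable_gint|exact: integrable_gint].
by apply: eq_Rintegral => x _; rewrite hornerD mulrDl.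
Qed.

Lemma gintZ c p : gint (c *: p) = c * gint p.
Proof.
rewrite /gint -RintegralZl //; last exact: integrable_gint.
by apply: eq_Rintegral => x _; rewrite hornerZ mulrA.
Qed.

Lemma gint0 : gint 0 = 0.
Proof. by rewrite -(scale0r 0) gintZ mul0r. Qed.

Lemma gintN p : gint (- p) = - gint p.
Proof. by rewrite -scaleN1r gintZ mulN1r. Qed.

Lemma gintB p q : gint (p - q) = gint p - gint q.
Proof. by rewrite gintD gintN. Qed.

Lemma gint_sum (I : Type) (r : seq I) (F : I -> {poly R}) :
  gint (\sum_(i <- r) F i) = \sum_(i <- r) gint (F i).
Proof.
by elim: r => [|i r IH]; rewrite ?big_nil ?gint0 // !big_cons gintD IH.
Qed.

Lemma gint1 : gint 1 = Num.sqrt pi.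
Proof.
rewrite /gint -[RHS]/(fine (Num.sqrt pi)%:E) -(integralT_gauss (R := R)).
by congr fine; apply: eq_integral => x _; rewrite hornerE mul1r.
Qed.

Lemma gint_by_parts p : gint (p^`() - 2 *: ('X * p)) = 0.
Proof.
have [C C0 hC] := horner_le_expR p.
have lim (Fl : set_system R) (FF : Filter Fl) :
    `|x| @[x --> Fl] --> +oo -> p.[x] * expR (- x ^+ 2) @[x --> Fl] --> 0.
  move=> hFl; apply: norm_cvg0.
  apply: (squeeze_cvgr _ (cvg_cst 0) (@cvg_expR_norm R Fl FF (C * expR 1) hFl)).
  apply: nearW => x; rewrite normr_ge0 /=; apply: le_trans (hC x) _.
  rewrite -mulrA ler_wpM2l // -expRD ler_expR.
  have : `|x| ^+ 2 = x ^+ 2 by rewrite real_normK ?num_real.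
  by have := sqr_ge0 (`|x| - 1); nra.
rewrite -(subrr 0).
apply: (@Rintegral_FTC2_setT _ _ (fun x => p.[x] * expR (- x ^+ 2))).
- exact: integrable_gint.
- exact: continuous_horner_gauss.
- move=> x.
  have d1 : is_derive x 1 (fun y : R => - y ^+ 2) (- (2 * x)).
    have d0 := is_deriveN (is_deriveM (is_derive_id x (1 : R)) (is_derive_id x (1 : R))).
    rewrite (_ : (fun y : R => - y ^+ 2) = - (id * id)).
      by apply: is_derive_eq d0 _; rewrite /GRing.scale /= mulr1; ring.
    by apply/funext => y; rewrite expr2.
  have d2 := @is_derive1_comp _ expR (fun y : R => - y ^+ 2) x _ _
    (is_derive_expR (- x ^+ 2)) d1.
  apply: is_derive_eq (is_deriveM (is_derive_poly p x) d2) _.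
  rewrite hornerD hornerN hornerZ hornerM hornerX /GRing.scale /=; ring.
- by apply: lim; exact: norm_cvgy.
- by apply: lim; exact: norm_cvgNy.
Qed.

(** For the Gaussian weight the raising operator is the adjoint of d/dx. *)
Lemma gint_hermiteS n q : gint (hermite R n.+1 * q) = gint (hermite R n * q^`()).
Proof.
apply/esym/eqP; rewrite -subr_eq0 -gintB; apply/eqP.
rewrite -(gint_by_parts (hermite R n * q)); congr gint.
rewrite hermiteS derivM -!mul_polyC; ring.
Qed.

Lemma gint_hermite m n : gint (hermite R m * hermite R n) =
  if m == n then Num.sqrt pi * (2 ^+ n * n`!%:R) else 0.
Proof.
elim: m n => [|m IH] [|n].
- by rewrite mulr1 gint1 fact0 expr0 !mulr1.
- rewrite mulrC gint_hermiteS (_ : (hermite R 0)^`() = 0) ?mulr0 ?gint0 //.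
  by rewrite /= -polyC1 derivC.
- rewrite gint_hermiteS (_ : (hermite R 0)^`() = 0) ?mulr0 ?gint0 //.
  by rewrite /= -polyC1 derivC.
- rewrite gint_hermiteS deriv_hermite -scalerAr gintZ IH eqSS.
  case: eqP => _; last by rewrite mulr0.
  by rewrite factS natrM exprS; ring.
Qed.

Lemma size_hermite_le n : (size (hermite R n) <= n.+1)%N.
Proof.
elim: n => [|n IH]; first by rewrite size_poly1.
rewrite hermiteS; apply: leq_trans (size_polyD _ _) _.
rewrite geq_max size_polyN; apply/andP; split.
  apply: leq_trans (size_scale_leq _ _) _.
  by apply: leq_trans (size_polyMleq _ _) _; rewrite size_polyX.
apply/leq_sizeP => j nj; rewrite coef_deriv nth_default ?mul0rn //.
by apply: leq_trans IH _; apply: leq_trans (leqnSn _) (leqW nj).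
Qed.

Lemma coef_hermite n : (hermite R n)`_n = 2 ^+ n.
Proof.
elim: n => [|n IH]; first by rewrite coef1 expr0.
rewrite hermiteS coefB coefZ coefXM /= IH coef_deriv nth_default ?mul0rn.
  by rewrite subr0 exprS.
by apply: leq_trans (size_hermite_le n) _; rewrite leqnSn.
Qed.

Lemma hermite_expansion n p : (size p <= n)%N ->
  exists c : nat -> R, p = \sum_(k < n) c k *: hermite R k.
Proof.
elim: n p => [|n IH] p.
  rewrite leqn0 size_poly_eq0 => /eqP->.
  by exists (fun=> 0); rewrite big_ord0.
move=> sp; pose a := p`_n / 2 ^+ n.
have p2 : 2 ^+ n != 0 :> R by rewrite expf_neq0 // pnatr_eq0.
have [|c hc] := IH (p - a *: hermite R n).
  apply/leq_sizeP => j; rewrite leq_eqVlt => /orP[/eqP<-|nj].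
    by rewrite coefB coefZ coef_hermite /a divfK // subrr.
  rewrite coefB coefZ !nth_default ?mulr0 ?subr0 //.
    exact: leq_trans (size_hermite_le n) nj.
  exact: leq_trans sp nj.
exists (fun k => if k == n then a else c k).
rewrite big_ord_recr /= eqxx -{1}(subrK (a *: hermite R n) p) hc; congr (_ + _).
by apply: eq_bigr => k _; rewrite ltn_eqF.
Qed.

End GaussianMoments.

Section OrthogonalFamilies.
Variables (R : fieldType) (J : finType).

(* U diag(N) U^T = 1 forces U^T U = diag(N)^-1, because U is square. *)
Lemma gram_dual (U : J -> J -> R) (N : J -> R) :
  (forall l, N l != 0) ->
  (forall j j', \sum_l U j l * N l * U j' l = (j == j')%:R) ->
  forall l l', \sum_j U j l * U j l' = (l == l')%:R / N l.
Proof.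
move=> N0 hU l l'.
pose A : 'M[R]_#|J| := \matrix_(a, b) U (enum_val a) (enum_val b).
pose AD : 'M[R]_#|J| := \matrix_(a, b) (U (enum_val a) (enum_val b) * N (enum_val b)).
have h1 : AD *m A^T = 1%:M.
  apply/matrixP => a b; rewrite !mxE.
  rewrite -(inj_eq enum_val_inj) -hU (reindex (@enum_val J J)) /=.
    by apply: eq_bigr => c _; rewrite !mxE.
  by apply: onW_bij; exact: enum_val_bij.
have := mulmx1C h1 => /matrixP /(_ (enum_rank l') (enum_rank l)).
rewrite !mxE (inj_eq enum_rank_inj) eq_sym => h2.
apply: (mulIf (N0 l)); rewrite divfK // -h2 mulr_suml.
rewrite (reindex (@enum_val J J)) /=; last by apply: onW_bij; exact: enum_val_bij.
by apply: eq_bigr => c _; rewrite !mxE !enum_rankK; ring.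
Qed.

End OrthogonalFamilies.

Section NilpotentExponential.
Variable R : realType.

Lemma expmx_nilp (d : nat) (A : 'M[R]_d.+1) : A * A = 0 -> expmx A = 1 + A.
Proof.
move=> A0; apply/matrixP => i j; rewrite mxE.
apply: lim_near_cst => //; near=> N.
have [M ->] : exists M, N = M.+2.
  exists (N - 2)%N; rewrite -addn2 subnK //.
  by near: N; exact: nbhs_infty_ge.
rewrite /exp_partial !big_ord_recl big1 => [|k _].
  by rewrite fact0 factS fact0 invr1 !scale1r expr0 addr0.
by rewrite /= !exprS mulrA A0 mul0r scaler0.
Unshelve. all: by end_near. Qed.

End NilpotentExponential.

Arguments hermite : simpl never.

(** * The kernel expanded in the orthogonal basis *)

Section ChristoffelDarboux.
Variables (R : realType) (nu : R).
Local Notation H := (hermite R).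
Implicit Types (p : {poly 'M[R]_2}) (x y : R).

Lemma ord2P (i : 'I_2) : i = 0 \/ i = 1.
Proof. by case: i => [[|[|//]] h]; [left|right]; exact: val_inj. Qed.

Definition entry_poly p (i c : 'I_2) : {poly R} := \poly_(l < size p) (p`_l i c).

Lemma horner_entry_poly p x i c : p.[x%:M] i c = (entry_poly p i c).[x].
Proof.
rewrite horner_coef horner_poly summxE; apply: eq_bigr => l _.
have -> : (x%:M : 'M[R]_2) ^+ l = (x ^+ l)%:M.
  elim: (nat_of_ord l) => [|m IH]; first by rewrite !expr0.
  by rewrite !exprS IH -[_ * _]scalar_mxM.
by rewrite -[_ * _]/(_ *m _) mul_mx_scalar mxE mulrC.
Qed.

(* Entry (i, c) of p(x) e^(A2 x^2) as a polynomial in x. *)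
Definition twisted p (i c : 'I_2) : {poly R} :=
  if c == 0 then entry_poly p i 0
  else entry_poly p i 1 + nu *: ('X^2 * entry_poly p i 0).

Lemma A2_sqr x : (x ^+ 2 *: A2 nu) * (x ^+ 2 *: A2 nu) = 0.
Proof.
rewrite -[_ * _]/(_ *m _) /A2 scalerA -scalemxAl -scalemxAr.
by rewrite mul_delta_mx_0 // !scaler0.
Qed.

Lemma expmx_A2 x : expmx (x ^+ 2 *: A2 nu) = 1%:M + x ^+ 2 *: A2 nu.
Proof. exact: expmx_nilp (A2_sqr x). Qed.

Lemma expmx_A2T x : expmx (x ^+ 2 *: (A2 nu)^T) = (expmx (x ^+ 2 *: A2 nu))^T.
Proof.
rewrite expmx_A2 expmx_nilp; first by apply/matrixP => i j; rewrite !mxE eq_sym.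
have := congr1 trmx (A2_sqr x).
by rewrite -[_ * _]/(_ *m _) trmx_mul trmx0 linearZ /=.
Qed.

Lemma twistedE p x i c :
  (p.[x%:M] *m expmx (x ^+ 2 *: A2 nu)) i c = (twisted p i c).[x].
Proof.
rewrite expmx_A2 mulmxDr mulmx1 mxE horner_entry_poly /twisted.
rewrite -scalemxAr /A2 -scalemxAr !mxE !big_ord_recl big_ord0 !mxE /=.
case: (ord2P c) => -> /=.
  by rewrite !(mulr0, addr0).
rewrite hornerD hornerZ hornerM hornerXn -!horner_entry_poly.
by rewrite mulr0 !addr0 mulr1 mulrCA.
Qed.

Lemma PhiE (P : nat -> {poly 'M[R]_2}) k x i c :
  Phi nu P k x i c = expR (- x ^+ 2 / 2) * (twisted (P k) i c).[x].
Proof. by rewrite /Phi mxE twistedE. Qed.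

(** The weight factors as e^(-x^2) E E^T with E = e^(A2 x^2), so E is absorbed into both polynomials
    and only scalar Gaussian integrals remain. *)
Lemma mx_innerE p q i j :
  mx_inner (hermite_weight nu) (fun x => p.[x%:M]) (fun x => q.[x%:M]) i j =
  gint (\sum_c twisted p i c * twisted q j c).
Proof.
rewrite mxE /gint; apply: eq_Rintegral => x _.
rewrite /hermite_weight expmx_A2T -scalemxAr -scalemxAl mxE mulrC; congr (_ * _).
set E := expmx _.
rewrite (mulmxA _ E) -(mulmxA _ E^T) -trmx_mul mxE horner_sum; apply: eq_bigr => c _.
by rewrite hornerM -!twistedE; congr (_ * _); rewrite [LHS]mxE.
Qed.

Variables (P : nat -> {poly 'M[R]_2}) (n : nat).
Hypothesis hP : orthonormal_mxpoly (hermite_weight nu) P.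

Local Notation J := ('I_n * 'I_2)%type.

(** The component j.2 of the index selects the family: 0 for vectors with first entry H_k, 1 for (0,
    H_k). The test n <= k + 2 singles out k = n - 2 and n - 1 without truncated subtraction. *)
Definition cd_basis (j : J) (c : 'I_2) : {poly R} :=
  if j.2 == 0 then
    (if c == 0 then H j.1 else if (n <= j.1.+2)%N then (nu / 4) *: H j.1.+2 else 0)
  else (if c == 0 then 0 else H j.1).

Definition cd_norm (j : J) : R := Num.sqrt pi * (2 ^+ j.1 * j.1`!%:R) *
  (if (j.2 == 0) && (n <= j.1.+2)%N then delta_sq nu j.1.+2 else 1).

Lemma delta_sq_gt0 m : 0 < delta_sq nu m.
Proof.
rewrite /delta_sq ltr_wpDr // mulr_ge0 ?sqr_ge0 // divr_ge0 ?ler0n //.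
case: m => [|m]; first by rewrite mul0r.
by rewrite mulr_ge0 // subr_ge0 ler1n.
Qed.

Lemma cd_norm_neq0 j : cd_norm j != 0.
Proof.
rewrite /cd_norm !mulf_neq0 ?expf_neq0 ?pnatr_eq0 -?lt0n ?fact_gt0 //.
  by rewrite gt_eqF // sqrtr_gt0 pi_gt0.
by case: ifP => _; rewrite ?oner_neq0 // gt_eqF // delta_sq_gt0.
Qed.

Lemma gint_mulZ (a b : R) (p q : {poly R}) :
  gint ((a *: p) * (b *: q)) = a * b * gint (p * q).
Proof. by rewrite -scalerAl -scalerAr !gintZ mulrA. Qed.

Lemma cd_basis_orthogonal j l :
  gint (\sum_c cd_basis j c * cd_basis l c) = if j == l then cd_norm j else 0.
Proof.
rewrite !big_ord_recl big_ord0 addr0 gintD.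
case: j l => [k i] [m i']; rewrite xpair_eqE /cd_basis /cd_norm /=.
have [->|->] := ord2P i; have [->|->] := ord2P i'; rewrite /= ?andbT ?andbF.
- have [->|km] := eqVneq k m.
    rewrite gint_hermite eqxx; case: ifP => hm.
      rewrite gint_mulZ gint_hermite eqxx.
      by rewrite /delta_sq !factS !natrM !exprS -!natr1; field.
    by rewrite mul0r gint0 addr0 mulr1.
  have km' : (k == m :> nat) = false by apply/negbTE; rewrite val_eqE.
  rewrite gint_hermite km' add0r.
  case: ifP => hk; last by rewrite mul0r gint0.
  case: ifP => hm; last by rewrite mulr0 gint0.
  by rewrite gint_mulZ gint_hermite !eqSS km' mulr0.
(* The extra component H_(k+2) is present only if k + 2 >= n > m, so it is orthogonal to every
   available H_m. *)
- rewrite mulr0 gint0 add0r; case: ifP => hk; last by rewrite mul0r gint0.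
  rewrite -[H m]scale1r gint_mulZ gint_hermite.
  case: eqP => [km|_]; last by rewrite mulr0.
  by move: hk; rewrite km leqNgt ltn_ord.
- rewrite mul0r gint0 add0r; case: ifP => hm; last by rewrite mulr0 gint0.
  rewrite -[H k]scale1r gint_mulZ gint_hermite.
  case: eqP => [km|_]; last by rewrite mulr0.
  by move: hm; rewrite -km leqNgt ltn_ord.
- rewrite mulr0 gint0 add0r gint_hermite -val_eqE /=.
  by case: eqP => [->|//]; rewrite mulr1.
Qed.

(** The leading terms cancel, and the recurrence for X H_m applied twice shows that the remainder
    has degree at most k. *)
Lemma size_sqrX_hermite k : (size ('X^2 * H k - 4^-1 *: H k.+2)%R <= k.+1)%N.
Proof.
case: k => [|k].
  have -> : 'X^2 * H 0 - 4^-1 *: H 2 = (2^-1)%:P.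
    rewrite hermiteSS hermiteS (_ : H 0 = 1%:P) // derivC subr0 polyC1.
    rewrite -!mul_polyC expr2.
    have -> : (2 * 1)%:P = 2%:P :> {poly R} by rewrite mulr1.
    have e1 : (4^-1)%:P * 2%:P * 2%:P = 1 :> {poly R}.
      by rewrite -!polyCM (_ : _ * _ * _ = 1) //; field.
    have e2 : (4^-1)%:P * 2%:P = (2^-1)%:P :> {poly R}.
      by rewrite -polyCM (_ : _ * _ = 2^-1) //; field.
    transitivity ('X * 'X * (1 - (4^-1)%:P * 2%:P * 2%:P) + (4^-1)%:P * 2%:P : {poly R}).
      by ring.
    by rewrite e1 e2 subrr mulr0 add0r.
  exact: size_polyC_leq1.
have -> : 'X^2 * H k.+1 - 4^-1 *: H k.+3 =
    (k.+2%:R / 2) *: H k.+1 + k.+1%:R *: ('X * H k).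
  have e m : 'X * H m.+1 = 2^-1 *: H m.+2 + m.+1%:R *: H m.
    rewrite hermiteSS scalerBr !scalerA mulVf ?scale1r ?pnatr_eq0 //.
    by rewrite mulKf ?pnatr_eq0 // subrK.
  rewrite expr2 -mulrA e mulrDr -!scalerAr e scalerDr !scalerA.
  rewrite (_ : 2^-1 / 2 = 4^-1 :> R); last by field.
  by rewrite addrAC [X in X - _]addrC addrK mulrC.
apply: leq_trans (size_polyD _ _) _; rewrite geq_max; apply/andP; split.
  by apply: leq_trans (size_scale_leq _ _) _; exact: size_hermite_le.
apply: leq_trans (size_scale_leq _ _) _.
apply: leq_trans (size_polyMleq _ _) _; rewrite size_polyX /=.
by rewrite !ltnS; exact: size_hermite_le.
Qed.

Lemma cd_basis_span p i : (size p <= n)%N ->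
  exists U : J -> R, forall c, twisted p i c = \sum_j U j *: cd_basis j c.
Proof.
move=> sp.
have se c : (size (entry_poly p i c) <= n)%N.
  exact: leq_trans (size_poly _ _) sp.
have [a ha] := hermite_expansion (se 0).
(* What is left in the second component once the first has been expanded. It has degree below n: if
   k + 2 >= n by [size_sqrX_hermite], otherwise because nu x^2 H_k has degree k + 2 < n. *)
pose r := entry_poly p i 1 + \sum_(k < n) a k *: (nu *: ('X^2 * H k)
   - cd_basis (k, 0) 1).
have sr : (size r <= n)%N.
  apply: leq_trans (size_polyD _ _) _; rewrite geq_max se /=.
  apply: leq_trans (size_sum _ _ _) _; apply/bigmax_leqP => k _.
  apply: leq_trans (size_scale_leq _ _) _.
  rewrite /cd_basis /=; case: ifP => hk.
    rewrite -scalerA -scalerBr; apply: leq_trans (size_scale_leq _ _) _.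
    by apply: leq_trans (size_sqrX_hermite k) _; exact: ltn_ord.
  rewrite subr0; apply: leq_trans (size_scale_leq _ _) _.
  apply: leq_trans (size_polyMleq _ _) _; rewrite size_polyXn /=.
  rewrite !addSn /= add0n; apply: leq_trans (_ : k.+3 <= n)%N.
    by rewrite !ltnS; exact: size_hermite_le.
  by rewrite ltnNge hk.
have [d hd] := hermite_expansion sr.
exists (fun j : J => if j.2 == 0 then a j.1 else d j.1) => c.
rewrite -(pair_big predT predT
  (fun (k : 'I_n) (m : 'I_2) => (if m == 0 then a k else d k) *: cd_basis (k, m) c)) /=.
under eq_bigr do rewrite !big_ord_recl big_ord0 addr0 /=.
rewrite /twisted; case: (ord2P c) => -> /=.
  by rewrite ha; apply: eq_bigr => k _; rewrite /cd_basis /= scaler0 addr0.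
rewrite big_split /= /cd_basis /= -hd /r ha mulr_sumr scaler_sumr.
rewrite addrCA; congr (_ + _); rewrite -big_split /=; apply: eq_bigr => k _.
by rewrite -scalerDr addrCA subrr addr0 -scalerAr !scalerA mulrC.
Qed.

(** The rows of P_0, ..., P_(n-1) are as numerous as the basis vectors; orthonormality is the Gram
    identity for their coefficients U, and [gram_dual] collapses the double sum to its diagonal. *)
Lemma CD_kernelE x y a b : CD_kernel nu P n x y a b =
  expR (- (x ^+ 2 + y ^+ 2) / 2) *
  \sum_j (cd_basis j a).[y] * (cd_basis j b).[x] / cd_norm j.
Proof.
have hu (j : J) : {U : J -> R |
    forall c, twisted (P j.1) j.2 c = \sum_l U l *: cd_basis l c}.
  apply: cid; apply: cd_basis_span; rewrite hP.1; exact: ltn_ord.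
pose U j := sval (hu j).
have hU (j : J) c : twisted (P j.1) j.2 c = \sum_l U j l *: cd_basis l c.
  exact: (svalP (hu j)).
have gram (j j' : J) : \sum_l U j l * cd_norm l * U j' l = (j == j')%:R.
  have := mx_innerE (P j.1) (P j'.1) j.2 j'.2; rewrite hP.2.
  have -> : (if nat_of_ord j.1 == j'.1 then 1%:M else 0 : 'M[R]_2) j.2 j'.2 =
      (j == j')%:R.
    case: j j' => [k i] [k' i'] /=; rewrite xpair_eqE -val_eqE.
    by case: (_ == _) => /=; rewrite mxE.
  move=> ->; under [in RHS]eq_bigr do rewrite !hU.
  transitivity (gint (\sum_l \sum_l' (U j l * U j' l') *:
      (\sum_c cd_basis l c * cd_basis l' c))).
    rewrite gint_sum; apply: eq_bigr => l _; rewrite gint_sum (bigD1 l) //=.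
    rewrite gintZ cd_basis_orthogonal eqxx big1 ?addr0; first by ring.
    move=> l' l'l; rewrite gintZ cd_basis_orthogonal eq_sym (negbTE l'l).
    by rewrite mulr0.
  congr gint.
  transitivity (\sum_l \sum_l' \sum_c
      (U j l *: cd_basis l c) * (U j' l' *: cd_basis l' c)).
    apply: eq_bigr => l _; apply: eq_bigr => l' _; rewrite scaler_sumr.
    by apply: eq_bigr => c _; rewrite -scalerAl -scalerAr scalerA.
  under [RHS]eq_bigr do rewrite big_distrlr /=.
  by rewrite [RHS]exchange_big; apply: eq_bigr => l _; rewrite exchange_big.
have dual := gram_dual cd_norm_neq0 gram.
transitivity (expR (- (x ^+ 2 + y ^+ 2) / 2) *
    \sum_(j : J) (twisted (P j.1) j.2 a).[y] * (twisted (P j.1) j.2 b).[x]).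
  rewrite /CD_kernel summxE.
  rewrite -(pair_big predT predT (fun (k : 'I_n) (m : 'I_2) =>
    (twisted (P k) m a).[y] * (twisted (P k) m b).[x])) /= mulr_sumr.
  apply: eq_bigr => k _; rewrite mxE mulr_sumr; apply: eq_bigr => i _.
  have -> : expR (- (x ^+ 2 + y ^+ 2) / 2) = expR (- y ^+ 2 / 2) * expR (- x ^+ 2 / 2).
    by rewrite -expRD; congr expR; lra.
  have e1 : (Phi nu P k y)^T a i = expR (- y ^+ 2 / 2) * (twisted (P k) i a).[y].
    by rewrite mxE PhiE.
  have e2 := PhiE P k x i b.
  by rewrite e1 e2 mulrACA.
congr (_ * _).
transitivity (\sum_l \sum_l' (\sum_j U j l * U j l') *
    ((cd_basis l a).[y] * (cd_basis l' b).[x])).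
  transitivity (\sum_j \sum_l \sum_l' (U j l * U j l') *
      ((cd_basis l a).[y] * (cd_basis l' b).[x])).
    apply: eq_bigr => j _; rewrite !hU !horner_sum big_distrlr /=.
    apply: eq_bigr => l _; apply: eq_bigr => l' _; rewrite !hornerZ; ring.
  rewrite exchange_big; apply: eq_bigr => l _ /=.
  rewrite exchange_big; apply: eq_bigr => l' _ /=.
  by rewrite mulr_suml.
apply: eq_bigr => l _; under eq_bigr do rewrite dual.
rewrite (bigD1 l) //= big1 => [|l' l'l].
  by rewrite addr0 eqxx mul1r mulrC.
by rewrite eq_sym (negbTE l'l) !mul0r.
Qed.

End ChristoffelDarboux.

(** * Matrix powers and the coefficients B_n, Bhat_n *)

Section ComplexExponentialSeries.
Variable R : realType.
Implicit Types (z w : R[i]).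

Definition cexp_rem z (N : nat) (t : R) : R[i] :=
  cexp (t%:C * z) - \sum_(k < N) (t%:C * z) ^+ k / k`!%:R.

Lemma fact_neq0C k : k`!%:R != 0 :> R[i].
Proof. by rewrite pnatr_eq0 -lt0n fact_gt0. Qed.

Lemma is_cderive_line z t : is_cderive (fun s : R => s%:C * z) t z.
Proof.
apply: is_cderive_eq (is_cderiveM (is_cderive_id t) (is_cderive_cst z t)) _.
by rewrite mul1r mulr0 addr0.
Qed.

(* The partial sums depend on t only through t z, so differentiating in t shifts
   the remainder; integrating back gives the factor t^N / N!. *)
Lemma is_cderive_cexp_rem z N t : is_cderive (cexp_rem z N.+1) t (z * cexp_rem z N t).
Proof.
have dpow k : is_cderive (fun s : R => (s%:C * z) ^+ k / k`!%:R) t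
    (z * (k%:R * (t%:C * z) ^+ k.-1 / k`!%:R)).
  apply: is_cderive_eq (is_cderiveM (is_cderiveX k (is_cderive_line z t))
    (is_cderive_cst (k`!%:R^-1) t)) _.
  by ring.
have dsum M : is_cderive (fun s : R => \sum_(k < M.+1) (s%:C * z) ^+ k / k`!%:R) t
    (z * \sum_(k < M) (t%:C * z) ^+ k / k`!%:R).
  elim: M => [|M IH].
    apply: (@is_cderive_ext _ _ (fun=> 1)).
      by move=> s; rewrite big_ord1 expr0 fact0 divr1.
    by rewrite big_ord0 mulr0; exact: is_cderive_cst.
  apply: (@is_cderive_ext _ _ (fun s => \sum_(k < M.+1) (s%:C * z) ^+ k / k`!%:R
     + (s%:C * z) ^+ M.+1 / M.+1`!%:R)).
    by move=> s; rewrite big_ord_recr.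
  apply: is_cderive_eq (is_cderiveD IH (dpow M.+1)) _.
  rewrite [in RHS]big_ord_recr mulrDr /=; congr (_ + z * _).
  rewrite factS natrM; have := fact_neq0C M => f0.
  have M0 : 1 + M%:R != 0 :> R[i] by rewrite nat1r pnatr_eq0.
  by field; rewrite f0 M0.
apply: is_cderive_eq (is_cderiveB (is_cderive_cexp (is_cderive_line z t)) (dsum N)) _.
by rewrite /cexp_rem; ring.
Qed.

(** Each integration costs the factor 2 of [cderive_le], hence (2 |z|)^N; divided by N! it still
    tends to 0. *)
Lemma cexp_rem_bound z N t : 0 <= t <= 1 ->
  normc (cexp_rem z N t) <= expR (normc z) * ((2 * normc z * t) ^+ N / N`!%:R).
Proof.
elim: N t => [|N IH] t /andP[t0 t1].
  rewrite /cexp_rem big_ord0 subr0 normc_cexp expr0 fact0 divr1 mulr1 ler_expR.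
  rewrite cReM /= mul0r subr0; apply: le_trans (ler_norm _) _.
  rewrite normrM (ger0_norm t0) -[leRHS]mul1r ler_pM //; exact: normRe_le.
have rem0 M : cexp_rem z M.+1 0 = 0.
  rewrite /cexp_rem mul0r cexp0 big_ord_recl expr0 fact0 divr1 big1 ?addr0 ?subrr //.
  by move=> k _; rewrite expr0n mul0r.
set c := normc z; have c0 : 0 <= c by exact: normc_ge0.
pose K := expR c * (c * (2 * c) ^+ N / N`!%:R).
have fN : N`!%:R != 0 :> R by rewrite pnatr_eq0 -lt0n fact_gt0.
have nN : 1 + N%:R != 0 :> R by rewrite nat1r pnatr_eq0.
have du (s : R) : s \in `[0, t] ->
    is_derive s 1 (fun r : R => (K / N.+1%:R) * r ^+ N.+1) (K * s ^+ N).
  move=> _.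
  have dX : is_derive s 1 (fun r : R => r ^+ N.+1) (N.+1%:R * s ^+ N).
    have -> : (fun r : R => r ^+ N.+1) = horner ('X^(N.+1) : {poly R}).
      by apply/funext => r; rewrite hornerXn.
    apply: is_derive_eq (is_derive_poly _ s) _.
    by rewrite derivXn hornerMn hornerXn mulr_natl.
  by apply: is_derive_eq (is_deriveZ (K / N.+1%:R) dX) _; rewrite /GRing.scale /=; field.
have := @cderive_le _ (fun s => z * cexp_rem z N s) (cexp_rem z N.+1) _ _ 0 t t0
  (fun s _ => is_cderive_cexp_rem z N s) du.
rewrite rem0 subr0 expr0n mulr0 subr0 => h.
apply: le_trans (h _) _; last first.
  rewrite le_eqVlt; apply/orP; left; apply/eqP.
  by rewrite /K factS natrM !exprMn !exprS; field; rewrite fN nN.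
move=> s; rewrite in_itv /= => /andP[s0 st].
have s01 : 0 <= s <= 1 by rewrite s0 (le_trans st t1).
rewrite Normc.normcM; apply: le_trans (ler_wpM2l c0 (IH s s01)) _.
by rewrite -/c /K !exprMn le_eqVlt; apply/orP; left; apply/eqP; field.
Qed.

Lemma ccvg_cexp_series z :
  ccvg \oo (fun N : nat => \sum_(k < N) z ^+ k / k`!%:R) (cexp z).
Proof.
have h : ccvg \oo (fun N : nat => cexp_rem z N 1) 0.
  apply: (@ccvg_bound0 _ _ _ _ _ (fun N : nat =>
      expR (normc z) * ((2 * normc z) ^+ N / N`!%:R))).
    apply: nearW => N; have := @cexp_rem_bound z N 1; rewrite mulr1; apply.
    by rewrite ler01 lexx.
  rewrite -[X in _ --> X](mulr0 (expR (normc z))); apply: cvgMr.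
  exact: cvg_series_cvg_0 (is_cvg_series_exp_coeff (2 * normc z)).
rewrite -[X in ccvg _ _ X]subr0.
apply: (@ccvg_eq _ _ _ _ (fun N : nat => cexp z - cexp_rem z N 1)).
  by move=> N; rewrite /cexp_rem mul1r subKr.
by apply: ccvgB => //; exact: ccvg_cst.
Qed.

Lemma cexpmx_diag (d : nat) (v : 'rV[R[i]]_d.+1) :
  cexpmx (diag_mx v) = diag_mx (\row_j cexp (v 0 j)).
Proof.
apply/matrixP => i j; rewrite !mxE.
have e N : exp_partial (diag_mx v) N i j =
    (\sum_(k < N) v 0 i ^+ k / k`!%:R) *+ (i == j).
  rewrite /exp_partial summxE -sumrMnl; apply: eq_bigr => k _; rewrite mxE.
  have -> : diag_mx v ^+ k = diag_mx (\row_j (v 0 j ^+ k)).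
    elim: (nat_of_ord k) => [|m IH].
      by rewrite expr0; apply/matrixP => a b; rewrite !mxE expr0.
    rewrite exprS IH -[_ * _]/(_ *m _) mul_diag_mx.
    by apply/matrixP => a b; rewrite !mxE exprS mulrnAr.
  by rewrite !mxE mulrnAr mulrC.
case: (eqVneq i j) e => [<-|ij] e.
  apply: (ccvg_has_clim _ _).2; apply: ccvg_eq (ccvg_cexp_series (v 0 i)) => N.
  by rewrite e mulr1n.
apply: (ccvg_has_clim _ _).2; apply: (@ccvg_eq _ _ _ _ (fun=> 0)).
  by move=> N; rewrite e mulr0n.
exact: ccvg_cst.
Qed.

(** For integer exponents e^(m log z) = z^m, so the branch of the logarithm disappears. *)
Lemma cpowmx_diag_nat (d : nat) z (m : 'I_d.+1 -> nat) : z != 0 ->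
  cpowmx z (diag_mx (\row_j (m j)%:R)) = diag_mx (\row_j z ^+ m j).
Proof.
move=> z0; rewrite /cpowmx (_ : _ *: _ = diag_mx (\row_j ((m j)%:R * clog z))).
  rewrite cexpmx_diag; congr diag_mx; apply/rowP => j; rewrite !mxE.
  by rewrite cexpMn cexp_clog.
by apply/matrixP => a b; rewrite !mxE mulrnAr mulrC.
Qed.

Lemma cpowmx_diag_natN (d : nat) z (m : 'I_d.+1 -> nat) : z != 0 ->
  cpowmx z (- diag_mx (\row_j (m j)%:R)) = diag_mx (\row_j (z ^+ m j)^-1).
Proof.
move=> z0; rewrite /cpowmx (_ : _ *: _ = diag_mx (\row_j (- ((m j)%:R * clog z)))).
  rewrite cexpmx_diag; congr diag_mx; apply/rowP => j; rewrite !mxE.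
  by rewrite cexpN cexpMn cexp_clog.
by apply/matrixP => a b; rewrite !mxE mulrN mulrnAr mulrC mulNrn.
Qed.

End ComplexExponentialSeries.

(** * The algebra of B_n, Bhat_n and the delta factors *)

Section Coefficients.
Variables (R : realType) (nu : R) (n : nat).

Local Notation a := (delta_sq nu n.+1).
Local Notation b := (delta_sq nu n).

Lemma delta_sqS : a = b + n%:R * nu ^+ 2 / 2.
Proof. by rewrite /delta_sq -natr1; field. Qed.

Lemma delta_sq_bin : nu ^+ 2 * n%:R * (n%:R - 1) / 4 = b - 1.
Proof. by rewrite /delta_sq; field. Qed.

(* Exponents of z and w in the diagonal matrices z^(2 J2) and z^J3. *)
Definition colexp (i : 'I_2) : nat := if i == 0 then 2 else 0.
Definition midexp (c : 'I_3) : nat := 2 - c.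

(* [coef_tab i j l] is the (i, j) coefficient of H_l(y) / l! once the loop
   integral has been evaluated. *)
Definition coef_tab (i j : 'I_2) (l : nat) : R :=
  if i == 0 then
    (if (l < n)%N then
       (if j == 0 then (if (n <= l.+2)%N then (delta_sq nu l.+2)^-1 else 1)
        else (if (n <= l.+2)%N then nu / delta_sq nu l.+2 else 0))
     else 0)
  else
    (if (l < n)%N then (if j == 0 then 0 else 1)
     else nu * l%:R * (l%:R - 1) / (4 * delta_sq nu l) * (if j == 0 then 1 else nu)).

Lemma B_entries : [/\ B nu n 0 0 = 1 / a, B nu n 0 1 = n%:R * nu ^+ 2 / (2 * a * b),
   B nu n 0 (inord 2) = - nu, B nu n 1 0 = nu * n%:R * (n%:R + 1) / (4 * a) &
   B nu n 1 1 = - (n%:R * nu / (2 * a * b)) /\ B nu n 1 (inord 2) = 1].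
Proof. by split; rewrite ?mxE ?inordK //; split; rewrite !mxE ?inordK. Qed.

Lemma Bhat_entries : [/\ Bhat nu n 0 0 = 1, Bhat nu n 0 1 = nu,
   Bhat nu n 1 0 = 1, Bhat nu n 1 1 = nu &
   Bhat nu n (inord 2) 0 = - (nu * n%:R * (n%:R - 1) / (4 * b)) /\
   Bhat nu n (inord 2) 1 = 1 / b].
Proof. by split; rewrite ?mxE ?inordK //; split; rewrite !mxE ?inordK. Qed.

Lemma sum_ord3 (V : nmodType) (F : 'I_3 -> V) :
  \sum_c F c = F 0 + F 1 + F (inord 2).
Proof.
rewrite !big_ord_recl big_ord0 addr0 addrA.
by congr (F _ + F _ + F _); apply: val_inj; rewrite /= ?inordK.
Qed.

Lemma B_mul_Bhat : B nu n *m Bhat nu n = 1%:M.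
Proof.
have a0 : a != 0 by rewrite gt_eqF // delta_sq_gt0.
have b0 : b != 0 by rewrite gt_eqF // delta_sq_gt0.
have [B00 B01 B02 B10 [B11 B12]] := B_entries.
have [b00 b01 b10 b11 [b20 b21]] := Bhat_entries.
have hb := delta_sq_bin; have ha := delta_sqS.
set A := delta_sq nu n.+1 in a0 ha B00 B01 B10 B11 *.
set D := delta_sq nu n in b0 ha hb B01 B11 b20 b21 *.
(* [e0], [e1] and [e2] trade nu and n for the two deltas; [e2] rests on (n+1) D - (n-1) A = 2. *)
have e0 : n%:R * nu ^+ 2 = 2 * (A - D) by rewrite ha; field.
have e1 : nu * n%:R * (n%:R - 1) * nu = 4 * (D - 1) by rewrite -hb; field.
have e2 : nu * n%:R * ((n%:R + 1) * D - 2 - (n%:R - 1) * A) = 0.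
  rewrite ha.
  transitivity (nu * n%:R * (2 * (D - 1) - (nu * n%:R * (n%:R - 1) * nu) / 2)).
    by field.
  by rewrite e1; field.
apply/matrixP => i j; rewrite mxE sum_ord3.
have [->|->] := ord2P i; have [->|->] := ord2P j;
  rewrite ?(B00, B01, B02, B10, B11, B12, b00, b01, b10, b11, b20, b21) mxE /=.
- rewrite e0 (_ : - nu * - (nu * n%:R * (n%:R - 1) / (4 * D)) =
    nu * n%:R * (n%:R - 1) * nu / (4 * D)); last by field.
  by rewrite e1; field; rewrite a0 b0.
- by rewrite e0; field; rewrite a0 b0.
- transitivity (nu * n%:R * ((n%:R + 1) * D - 2 - (n%:R - 1) * A) / (4 * A * D)).
    by field; rewrite a0 b0.
  by rewrite e2 mul0r.
- transitivity ((nu * (nu * n%:R * ((n%:R + 1) * D - 2 - (n%:R - 1) * A)) +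
     nu * n%:R * (n%:R - 1) * nu * A + 4 * A) / (4 * A * D)).
    by field; rewrite a0 b0.
  by rewrite e2 e1; field; rewrite a0 b0.
Qed.

(** The indicator records how many Taylor terms the loop integral keeps for each c. Where all three
    c survive the sum is an entry of B_n Bhat_n = 1; only two boundary values of l per row need
    separate computation. *)
Lemma coef_tabE i j l : (l < n.+2)%N ->
  \sum_c B nu n i c * Bhat nu n c j * ((l < n + midexp c - colexp i)%N)%:R =
  coef_tab i j l.
Proof.
move=> ln.
have a0 : a != 0 by rewrite gt_eqF // delta_sq_gt0.
have b0 : b != 0 by rewrite gt_eqF // delta_sq_gt0.
have BB : \sum_c B nu n i c * Bhat nu n c j = (i == j)%:R.
  by have := B_mul_Bhat => /matrixP /(_ i j); rewrite !mxE.
have [B00 B01 B02 B10 [B11 B12]] := B_entries.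
have [b00 b01 b10 b11 [b20 b21]] := Bhat_entries.
have m0 : midexp 0 = 2 by [].
have m1 : midexp 1 = 1 by [].
have m2 : midexp (inord 2) = 0 by rewrite /midexp inordK.
rewrite sum_ord3 m0 m1 m2; move: BB; rewrite sum_ord3 /coef_tab /colexp.
have hb := delta_sq_bin; have ha := delta_sqS.
have e0 : n%:R * nu ^+ 2 = 2 * (a - b) by rewrite ha; field.
have e01 : 1 / a + n%:R * nu ^+ 2 / (2 * a * b) = b^-1.
  by rewrite e0; field; rewrite a0 b0.
have [->|->] := ord2P i => /= BB.
- rewrite addnK addn0 (_ : (l < n + 1 - 2) = (l.+1 < n))%N; last by lia.
  rewrite (_ : (l < n - 2) = (l.+2 < n))%N; last by lia.
  have [ll|ll] := leqP n l.+2; last first.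
    rewrite (ltnW ll) (ltnW (ltnW ll)) !mulr1 BB.
    by have [->|->] := ord2P j.
  have [l1|l1] := ltnP l.+1 n.
    (* First row, l = n - 2: the terms c = 0, 1 survive and [e01] adds them up. *)
    have e : l.+2 = n by lia.
    rewrite (ltnW l1) mulr0 addr0 !mulr1 B00 B01 e.
    have [->|->] := ord2P j; rewrite ?(b00, b01, b10, b11) /=.
      by rewrite !mulr1 e01.
    by rewrite -mulrDl e01 mulrC.
  rewrite !mulr0 !addr0; case: ltnP => l0; last by rewrite mulr0.
  have e : l.+2 = n.+1 by lia.
  rewrite e mulr1 B00.
  by have [->|->] := ord2P j; rewrite ?b00 ?b01 /= ?mulr1 mul1r // mulrC.
- rewrite !subn0 addn2 ln mulr1 addn1 addn0.
  have [l0|l0] := ltnP l n.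
    rewrite (ltnW l0 : (l < n.+1)%N) !mulr1 BB.
    by have [->|->] := ord2P j.
  have [l1|l1] := ltnP l n.+1.
    (* Second row, l = n: again c = 0, 1 survive; l = n + 1 will keep c = 0 only. *)
    have -> : l = n by lia.
    rewrite mulr0 addr0 mulr1 B10 B11.
    have e3 : nu * n%:R * (n%:R + 1) / (4 * a) - n%:R * nu / (2 * a * b) =
        nu * n%:R * (n%:R - 1) / (4 * b).
      have e2 : nu * n%:R * ((n%:R + 1) * b - 2 - (n%:R - 1) * a) = 0.
        by rewrite /delta_sq -natr1; field.
      apply: subr0_eq.
      transitivity (nu * n%:R * ((n%:R + 1) * b - 2 - (n%:R - 1) * a) / (4 * a * b)).
        by field; rewrite a0 b0.
      by rewrite e2 mul0r.
    have [->|->] := ord2P j; rewrite ?(b00, b01, b10, b11) /=.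
      by rewrite !mulr1.
    by rewrite -mulrDl e3.
  have -> : l = n.+1 by lia.
  rewrite !mulr0 !addr0 B10 (_ : n.+1%:R = n%:R + 1 :> R); last by rewrite natr1.
  rewrite addrK.
  by have [->|->] := ord2P j; rewrite ?(b00, b01) /=; field; rewrite a0.
Qed.

(** A negative power of w could occur only for i = 1, j = 0 and l = 0 or 1. There the coefficient is
    an off-diagonal entry of the identity if l < n, and contains l (l - 1) otherwise. *)
Lemma coef_tab_small i j l : (l < n.+2)%N -> (l + colexp i < colexp j)%N ->
  coef_tab i j l = 0.
Proof.
rewrite /coef_tab /colexp => ln.
have [->|->] := ord2P i; have [->|->] := ord2P j => //=; first by lia.
rewrite addn0 => l2; case: ltnP => // nl.
have [->|->] : l = 0%N \/ l = 1%N by lia.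
  by rewrite mulr0 !mul0r.
by rewrite subrr mulr0 !mul0r.
Qed.

(** Term by term comparison with the basis expansion. In the second row the contribution of (H_k, nu
    H_(k+2) / 4) sits at l = k + 2, and the terms l = 0, 1 left over by this shift vanish. *)
Lemma coef_tab_kernel (f g : nat -> R) (i j : 'I_2) :
  \sum_(k < n) \sum_(m : 'I_2)
    (if m == 0 then (if i == 0 then f k else if (n <= k.+2)%N then nu / 4 * f k.+2 else 0)
     else if i == 0 then 0 else f k) *
    (if m == 0 then (if j == 0 then g k else if (n <= k.+2)%N then nu / 4 * g k.+2 else 0)
     else if j == 0 then 0 else g k) /
    cd_norm nu (k, m) =
  (Num.sqrt pi)^-1 * \sum_(l < n.+2) coef_tab i j l * (f l / l`!%:R) *
    (2 ^- (l + colexp i - colexp j) * g (l + colexp i - colexp j)%N).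
Proof.
have p0 : Num.sqrt (pi : R) != 0 by rewrite gt_eqF // sqrtr_gt0 pi_gt0.
have f0 k : k`!%:R != 0 :> R by rewrite pnatr_eq0 -lt0n fact_gt0.
have w0 k : 2 ^+ k != 0 :> R by rewrite expf_neq0 // pnatr_eq0.
have d0 k : delta_sq nu k != 0 by rewrite gt_eqF // delta_sq_gt0.
rewrite mulr_sumr; under eq_bigr do rewrite !big_ord_recl big_ord0 addr0 /=.
have [->|->] := ord2P i; have [->|->] := ord2P j; rewrite /cd_norm /coef_tab /colexp /=.
- rewrite !big_ord_recr /= ltnn (ltnNge n.+1) leqnSn /= !mul0r !mulr0 !addr0.
  apply: eq_bigr => k _; rewrite !mul0r addr0 ltn_ord addnK.
  by case: ifP => _; field; rewrite ?p0 ?f0 ?w0 ?d0.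
- rewrite !big_ord_recr /= ltnn (ltnNge n.+1) leqnSn /= !mul0r !mulr0 !addr0.
  apply: eq_bigr => k _; rewrite !mul0r addr0 ltn_ord subn0 addn2.
  case: ifP => _; last by rewrite !mulr0 !mul0r mulr0.
  by rewrite !exprS; field; rewrite p0 f0 w0 d0.
- rewrite [RHS]big_ord_recl [in RHS]big_ord_recl /= !mulr0 !mul0r.
  rewrite (_ : (if (0 < n)%N then 0 else 0 : R) = 0); last by case: ifP.
  rewrite (_ : (if (1 < n)%N then 0 else _) = 0); last first.
    by case: ifP => // _; rewrite subrr !(mulr0, mul0r).
  rewrite !mul0r !mulr0 !add0r; apply: eq_bigr => k _; rewrite !mulr0 !mul0r addr0.
  rewrite /bump /= !add1n addn0 subn2 /= ltnNge.
  case: ifP => _ /=; last by rewrite !mul0r mulr0.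
  rewrite !factS !natrM -!(natr1 k.+1) -!(natr1 k).
  have k1 : k%:R + 1 != 0 :> R by rewrite natr1 pnatr_eq0.
  have k2 : k%:R + 1 + 1 != 0 :> R by rewrite !natr1 pnatr_eq0.
  by field; rewrite p0 f0 w0 d0 k1 k2.
(* [F1] collects the vectors (0, H_l), [F2] the components nu H_l / 4 with l >= n. *)
- pose F1 l := (Num.sqrt pi)^-1 * (f l / l`!%:R * (2 ^- l * g l)).
  pose F2 l := if (l < n)%N then 0 else (Num.sqrt pi)^-1 *
    (nu * l%:R * (l%:R - 1) / (4 * delta_sq nu l) * nu * (f l / l`!%:R) * (2 ^- l * g l)).
  transitivity (\sum_(l < n) F1 l + \sum_(l < n.+2) F2 l); last first.
    rewrite [in RHS](bigID (fun l : 'I_n.+2 => (l < n)%N)) /=; congr (_ + _).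
      rewrite (big_ord_widen_cond _ predT F1 (leqW (leqnSn n))) /=.
      by apply: eq_bigr => l ln; rewrite ln /F1 addn0 subn0 !mul1r.
    rewrite [LHS](bigID (fun l : 'I_n.+2 => (l < n)%N)) /= big1 ?add0r.
      by apply: eq_bigr => l ln; rewrite /F2 (negbTE ln) addn0 subn0.
    by move=> l ln; rewrite /F2 ln.
  have F20 : F2 0%N = 0 by rewrite /F2 mulr0 !mul0r mulr0; case: ifP.
  have F21 : F2 1%N = 0 by rewrite /F2 subrr !(mulr0, mul0r); case: ifP.
  rewrite [in RHS]big_ord_recl [in RHS]big_ord_recl /= F20 F21 !add0r -big_split /=.
  apply: eq_bigr => k _; rewrite addrC; congr (_ + _); last first.
    by rewrite /F1; field; rewrite p0 f0 w0.
  rewrite /F2 /bump /= !add1n ltnNge; case: ifP => _ /=; last by rewrite !mul0r.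
  rewrite !factS !natrM !exprS -!(natr1 k.+1) -!(natr1 k).
  have k1 : k%:R + 1 != 0 :> R by rewrite natr1 pnatr_eq0.
  have k2 : k%:R + 1 + 1 != 0 :> R by rewrite !natr1 pnatr_eq0.
  by field; rewrite p0 f0 w0 d0 k1 k2.
Qed.

End Coefficients.

(** * The double integral and its comparison with the kernel *)

Section DoubleContourIntegral.
Variables (R : realType) (nu : R) (n : nat) (x y : R).
Implicit Types (w z : R[i]) (i j : 'I_2).

Lemma J2E : 2 *: J2 R = diag_mx (\row_j (colexp j)%:R).
Proof.
apply/matrixP => i j; rewrite !mxE mulrnAr; congr (_ *+ _).
by have [->|->] := ord2P i; rewrite /colexp /= ?mulr1 ?mulr0.
Qed.

Lemma J3E : J3 R = diag_mx (\row_j (midexp j)%:R).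
Proof.
apply/matrixP => i j; rewrite !mxE; congr (_ *+ _).
by case: i => [[|[|[|//]]] h].
Qed.

Definition cd_weight i j (c : 'I_3) w : R[i] :=
  gauss_line x w * w ^+ n * (w ^+ midexp c / w ^+ colexp j)
  * (B nu n i c * Bhat nu n c j)%:C.

(** Summing over the middle index c separates w from z except in 1 / (w - z). The exponent of z is
    put in the form 2 - k required by [loop_integral_cauchy]. *)
Lemma CD_integrandE w z i j : w != 0 -> z != 0 ->
  CD_integrand nu n x y w z i j =
  \sum_c cd_weight i j c w *
    (z ^+ 2 / z ^+ (n + midexp c + (2 - colexp i)) * (hermite_exp y z / (w - z))).
Proof.
move=> w0 z0; rewrite /CD_integrand J2E J3E.
rewrite (cpowmx_diag_nat _ z0) (cpowmx_diag_nat _ w0).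
rewrite (cpowmx_diag_natN _ z0) (cpowmx_diag_natN _ w0).
rewrite mxE !mul_mx_diag mxE mxE mulr_suml mulr_sumr; apply: eq_bigr => c _.
rewrite mul_diag_mx !mxE.
have -> : w ^+ 2 - 2 * x%:C * w - z ^+ 2 + 2 * z * y%:C + n%:R * clog (w / z) =
    (w ^+ 2 - 2 * x%:C * w) + (- z ^+ 2 + 2 * z * y%:C) + n%:R * clog (w / z) by ring.
rewrite 2!cexpD cexpMn cexp_clog; last by rewrite mulf_neq0 ?invr_eq0.
have -> : z ^+ 2 / z ^+ (n + midexp c + (2 - colexp i)) =
    z ^+ colexp i / z ^+ midexp c / z ^+ n.
  rewrite !exprD; have [->|->] := ord2P i; rewrite /colexp /= ?subnn ?subn0 ?expr0;
  by field; rewrite ?expf_neq0.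
rewrite /cd_weight !mxE /gauss_line /hermite_exp rmorphM expr_div_n; ring.
Qed.

Definition cd_inner i j w : R[i] := \sum_(l < n.+2)
  (2 * pi%:C * 'i%C * (coef_tab nu n i j l)%:C * hermite_coef y l) *
  (w ^+ (l + colexp i - colexp j) * gauss_line x w).

Lemma cd_innerE i j w : w != 0 ->
  \sum_c cd_weight i j c w * (2 * pi%:C * 'i%C *
    \sum_(l < n + midexp c + (2 - colexp i) - 2)
       hermite_coef y l * w ^+ l / w ^+ (n + midexp c + (2 - colexp i) - 2)) =
  cd_inner i j w.
Proof.
move=> w0.
have eK c : (n + midexp c + (2 - colexp i) - 2 = n + midexp c - colexp i)%N.
  by have [->|->] := ord2P i; rewrite /colexp /=; lia.
have leK c : (n + midexp c - colexp i <= n.+2)%N.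
  by rewrite /midexp; lia.
(* Indicators extend the inner sums to a range independent of c, so that the two sums can be
   exchanged. *)
transitivity (\sum_c \sum_(l < n.+2) cd_weight i j c w * (2 * pi%:C * 'i%C *
    (hermite_coef y l * w ^+ l / w ^+ (n + midexp c - colexp i)
     * ((l < n + midexp c - colexp i)%N)%:R))).
  apply: eq_bigr => c _; rewrite eK -!mulr_sumr; congr (_ * (_ * _)).
  rewrite (big_ord_widen _ (fun l => hermite_coef y l * w ^+ l /
    w ^+ (n + midexp c - colexp i)) (leK c)) big_mkcond /=.
  by apply: eq_bigr => l _; case: ifP => _; rewrite ?mulr1 ?mulr0.
rewrite exchange_big /=; apply: eq_bigr => l _.
transitivity (\sum_c (B nu n i c * Bhat nu n c j *
    ((l < n + midexp c - colexp i)%N)%:R)%:C * (2 * pi%:C * 'i%C * hermite_coef y l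
    * gauss_line x w * (w ^+ (l + colexp i) / w ^+ colexp j))).
  apply: eq_bigr => c _; case: ltnP => lK; last by rewrite !mulr0 mul0r.
  have e : w ^+ n * w ^+ midexp c =
      w ^+ (n + midexp c - colexp i) * w ^+ colexp i.
    by rewrite -!exprD subnK //; lia.
  rewrite /cd_weight !mulr1 exprD.
  rewrite (_ : gauss_line x w * w ^+ n * (w ^+ midexp c / w ^+ colexp j) =
    gauss_line x w * (w ^+ n * w ^+ midexp c) / w ^+ colexp j); last by ring.
  rewrite e; move: (hermite_coef y l) => hc.
  by field; rewrite !expf_neq0.
rewrite -mulr_suml -rmorph_sum (coef_tabE nu i j (ltn_ord l)).
have [lj|lj] := leqP (colexp j) (l + colexp i).
  rewrite (_ : w ^+ (l + colexp i) / w ^+ colexp j = w ^+ (l + colexp i - colexp j)).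
    by ring.
  by rewrite -{1}(subnK lj) exprD mulfK // expf_neq0.
by rewrite (coef_tab_small nu (ltn_ord l) lj) mulr0 !mul0r.
Qed.

Lemma CD_kernel_coef_tab (P : nat -> {poly 'M[R]_2}) i j :
  orthonormal_mxpoly (hermite_weight nu) P ->
  CD_kernel nu P n x y i j = expR (- (x ^+ 2 + y ^+ 2) / 2) *
  ((Num.sqrt pi)^-1 * \sum_(l < n.+2) coef_tab nu n i j l *
    ((hermite R l).[y] / l`!%:R) * (2 ^- (l + colexp i - colexp j) *
    (hermite R (l + colexp i - colexp j)).[x])).
Proof.
move=> hP; rewrite (CD_kernelE n hP); congr (_ * _).
rewrite -(coef_tab_kernel nu n (fun l => (hermite R l).[y])
  (fun l => (hermite R l).[x])) pair_big /=.
apply: eq_bigr => -[k m] _; rewrite /cd_basis /=; congr (_ * _ / _).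
  by case: ifP => _; case: ifP => _; rewrite ?horner0 //; case: ifP => _;
    rewrite ?horner0 ?hornerZ.
by case: ifP => _; case: ifP => _; rewrite ?horner0 //; case: ifP => _;
  rewrite ?horner0 ?hornerZ.
Qed.

Variables (gamma : R -> R[i]) (L : R).
Hypotheses (hgamma : loop_around_cut gamma) (hL : 0 < L).
Hypothesis hleft : forall t, Re (gamma t) < L.

Lemma vertical_neq0 s : vertical_line L s != 0.
Proof. by rewrite eq_complex /= negb_and gt_eqF. Qed.

Lemma inner_integral s :
  contour_integrable gamma (CD_integrand nu n x y (vertical_line L s)) /\
  contour_integral gamma (CD_integrand nu n x y (vertical_line L s)) =
    \matrix_(i, j) cd_inner i j (vertical_line L s).
Proof.
apply: contour_integralE => i j; rewrite mxE -cd_innerE ?vertical_neq0 //.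
apply: improper_integral_ext (improper_integral_sum _ (fun c => cd_weight i j c _)
  (fun c => loop_integral_cauchy hL hgamma hleft y _
    (erefl : Re (vertical_line L s) = L))).
move=> t; rewrite CD_integrandE ?vertical_neq0 //; last first.
  exact: slit_neq0 (@loop_slit _ _ hgamma t).
by rewrite mulr_suml; apply: eq_bigr => c _; rewrite -[LHS]mulrA.
Qed.

Definition cd_outer i j : R[i] := \sum_(l < n.+2)
  (2 * pi%:C * 'i%C * (coef_tab nu n i j l)%:C * hermite_coef y l) *
  ('i%C * (Num.sqrt pi * expR (- x ^+ 2) * (2 ^- (l + colexp i - colexp j) *
     (hermite R (l + colexp i - colexp j)).[x]))%:C).

Lemma outer_integral :
  contour_integrable (vertical_line L)
    (fun w => contour_integral gamma (CD_integrand nu n x y w)) /\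
  contour_integral (vertical_line L)
    (fun w => contour_integral gamma (CD_integrand nu n x y w)) =
    \matrix_(i, j) cd_outer i j.
Proof.
apply: contour_integralE => i j; rewrite mxE.
apply: improper_integral_ext (improper_integral_sum _ _
  (fun l : 'I_n.+2 => vertical_integral_pow L x (l + colexp i - colexp j))) => s.
rewrite (inner_integral s).2 mxE path_deriv_vertical /cd_inner mulr_suml.
by apply: eq_bigr => l _; rewrite !mulrA.
Qed.

End DoubleContourIntegral.

Theorem proposition2p2 (R : realType) (nu : R) (P : nat -> {poly 'M[R]_2})
    (hP : orthonormal_mxpoly (hermite_weight nu) P)
    (n : nat) (x y : R)
    (gamma : R -> R[i]) (L : R)
    (hgamma : loop_around_cut gamma)
    (hL : 0 < L) (hleft : forall t : R, complex.Re (gamma t) < L) :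
  [/\ (* both integrals converge *)
      (forall s : R,
         contour_integrable gamma
           (CD_integrand nu n x y (vertical_line L s))),
      contour_integrable (vertical_line L)
        (fun w => contour_integral gamma (CD_integrand nu n x y w)),
      mx_toC (CD_kernel nu P n x y)
      = (2 / (2 * (pi : R)%:C * 'i%C) ^+ 2
         * (expR ((x ^+ 2 - y ^+ 2) / 2))%:C) *:
        contour_integral (vertical_line L)
          (fun w => contour_integral gamma (CD_integrand nu n x y w))
    & B nu n *m Bhat nu n = 1%:M].
Proof.
have [oi oe] := outer_integral nu n x y hgamma hL hleft.
split; [|exact: oi| |exact: B_mul_Bhat].
  by move=> s; have [] := inner_integral nu n x y hgamma hL hleft s.
rewrite oe; apply/matrixP => i j; rewrite !mxE (CD_kernel_coef_tab n x y i j hP).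
pose S := \sum_(l < n.+2) coef_tab nu n i j l *
    ((hermite R l).[y] / l`!%:R) * (2 ^- (l + colexp i - colexp j) *
    (hermite R (l + colexp i - colexp j)).[x]).
(* 2 pi i comes from the loop, i sqrt(pi) e^(-x^2) from the line. *)
have -> : cd_outer nu n x y i j = 2 * pi%:C * 'i%C * 'i%C *
    (Num.sqrt pi * expR (- x ^+ 2) * S)%:C.
  rewrite /S mulr_sumr rmorph_sum mulr_sumr; apply: eq_bigr => l _.
  by rewrite /hermite_coef !rmorphM; ring.
have p0 : Num.sqrt (pi : R) != 0 by rewrite gt_eqF // sqrtr_gt0 pi_gt0.
have pE : pi = Num.sqrt (pi : R) ^+ 2 by rewrite sqr_sqrtr // pi_ge0.
have pC : pi%:C != 0 :> R[i] by rewrite eq_complex /= gt_eqF // pi_gt0.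
have i0 : 'i%C != 0 :> R[i] by rewrite eq_complex /= oner_eq0 andbF.
have -> : expR (- (x ^+ 2 + y ^+ 2) / 2) =
    expR ((x ^+ 2 - y ^+ 2) / 2) * expR (- x ^+ 2).
  by rewrite -expRD; congr expR; lra.
(* 2 / (2 pi i)^2 times 2 pi i . i sqrt(pi) equals sqrt(pi) / pi; in this form pi can be treated as
   an independent nonzero atom. *)
have -> : (Num.sqrt pi)^-1 = Num.sqrt pi / pi :> R 
  by rewrite [X in _ = _ / X]pE expr2 invfM mulrA divff // mul1r.
rewrite -/S !rmorphM fmorphV /=.
move: (pi%:C) pC => q q0.
by field; rewrite i0 q0.
Qed.
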